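(* Let $T>0$ and $H\in(0,1)$. Assume: (a) in the case of the wave equation, $u_0$ is continuous and $v_0\in L^1_{loc}(\mathbb{R})$; (b) in the case of the heat equation, $u_0$ is continuous and bounded. Then, for each of the two equations, there exists a unique solution $u^H=\{u^H(t,x),\,(t,x)\in[0,T]\times\mathbb{R}\}$ of $$u^H(t,x)=I_0(t,x)+\int_0^t\int_{\mathbb{R}}G_{t-s}(x-y)\,W^H(ds,dy).$$ Moreover, the random field $u^H$ admits a modification with continuous sample paths.
   Context: Noise. On a complete probability space, $W^H=\{W^H(\varphi)\}$ is a centered Gaussian family indexed by $\varphi\in C_0^\infty([0,\infty)\times\mathbb{R})$ with covariance $\mathrm{E}[W^H(\varphi)W^H(\psi)]=\int_0^\infty\int_{\mathbb{R}}\mathcal{F}\varphi(t,\cdot)(\xi)\,\overline{\mathcal{F}\psi(t,\cdot)(\xi)}\,c_H|\xi|^{1-2H}\,d\xi\,dt$, where $c_H=\frac{\Gamma(2H+1)\sin(\pi H)}{2\pi}$ and $\mathcal{F}f(\xi)=\int_{\mathbb{R}}e^{-i\xi x}f(x)\,dx$ is the Fourier transform in space. $W^H$ extends isometrically to the completion $\mathcal{H}^H$ of $C_0^\infty([0,\infty)\times\mathbb{R})$ for this inner product; $\mathcal{H}^H$ contains all functions $g$ with $\int_0^\infty\int_{\mathbb{R}}|\mathcal{F}g(t,\cdot)(\xi)|^2|\xi|^{1-2H}d\xi\,dt<\infty$, and one writes $\int_0^\infty\int_{\mathbb{R}}g\,dW^H:=W^H(g)$ (Wiener integral), and $\int_0^t\int_{\mathbb{R}}g\,dW^H:=W^H(1_{[0,t]}g)$.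 Filtration: $\mathcal{F}^H_t$ is generated by $W^H(1_{[0,s]}\varphi)$, $s\in[0,t]$, $\varphi\in C_0^\infty(\mathbb{R})$, and the null sets. Kernels and initial terms ($u_0,v_0:\mathbb{R}\to\mathbb{R}$ deterministic). Wave: $G_t(x)=\frac12 1_{\{|x|<t\}}$ and $I_0(t,x)=\frac12\int_{x-t}^{x+t}v_0(y)\,dy+\frac12\big(u_0(x+t)+u_0(x-t)\big)$. Heat: $G_t(x)=(2\pi t)^{-1/2}e^{-|x|^2/(2t)}$ and $I_0(t,x)=\int_{\mathbb{R}}G_t(x-y)u_0(y)\,dy$ for $t>0$, $I_0(0,x)=u_0(x)$. A solution is an adapted, jointly measurable process satisfying the displayed identity almost surely for every $(t,x)\in[0,T]\times\mathbb{R}$; uniqueness is up to modification. (In particular the Wiener integral is a well-defined centered Gaussian random variable for every $(t,x)$.) *)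

(* Defs.v *)
From HB Require Import structures.
From mathcomp Require Import all_boot all_order all_algebra.
From mathcomp Require Import complex.
From mathcomp Require Import all_classical all_reals all_analysis.

Set Implicit Arguments.
Unset Strict Implicit.
Unset Printing Implicit Defensive.

Import Order.TTheory GRing.Theory Num.Theory.
Import numFieldTopology.Exports numFieldNormedType.Exports.

Local Open Scope classical_set_scope.
Local Open Scope ring_scope.

Section TestFunctions.
Context {R : realType}.

(* All iterated directional derivatives are Frechet differentiable; on R and
   on R * R, where this is used, it is the same as being C^oo. *)
Definition smooth (V : normedModType R) (f : V -> R) : Prop :=
  forall (vs : seq V) (z : V),
    differentiable (foldr (fun v (g : V -> R) => 'D_v g) f vs) z.

Definition C0_infty (V : normedModType R) (f : V -> R) : Prop :=
  smooth f /\ compact (closure [set z | f z != 0]).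

(* C_0^oo([0,oo) x R): smoothness up to the boundary t = 0 means being the
   restriction of a smooth function on R x R, and the support may meet t = 0.
   Functions on [0,oo) x R are represented by their extension by 0 to t < 0. *)
Definition C0_infty_half (phi : R * R -> R) : Prop :=
  exists2 psi : R * R -> R, C0_infty psi &
    phi = (fun z => if 0 <= z.1 then psi z else 0).

End TestFunctions.

Section SpectralSpace.
Context {R : realType}.
Local Notation mu := (@lebesgue_measure R).

Definition cintegral (D : set R) (f : R -> R[i]) : R[i] :=
  Complex (\int[mu]_(x in D) complex.Re (f x))
          (\int[mu]_(x in D) complex.Im (f x)).

Definition expi (a : R) : R[i] := Complex (cos a) (sin a).

Definition fourier (f : R -> R) (xi : R) : R[i] :=
  cintegral setT (fun x => expi (- (xi * x)) * (f x)%:C%C).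

Definition euler_gamma (z : R) : R :=
  \int[mu]_(x in `]0, +oo[) (x `^ (z - 1) * expR (- x)).

Definition c_ (H : R) : R :=
  euler_gamma (2 * H + 1) * sin (pi * H) / (2 * pi).

Definition spectral_density (H xi : R) : R := c_ H * `|xi| `^ (1 - 2 * H).

Definition inner_H (H : R) (phi psi : R * R -> R) : R[i] :=
  cintegral `[0, +oo[ (fun t =>
    cintegral setT (fun xi =>
      fourier (fun x => phi (t, x)) xi * (fourier (fun x => psi (t, x)) xi)^*%C
      * (spectral_density H xi)%:C%C)).

Definition sqnorm_H (H : R) (g : R * R -> R) : \bar R :=
  (\int[mu]_(t in `[0%R, +oo[) \int[mu]_xi
    (ComplexField.Normc.normc (fourier (fun x => g (t, x)) xi) ^+ 2
     * spectral_density H xi)%:E)%E.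

(* Functions identified with elements of the completion. Integrability of
   g(t, .) makes its Fourier transform the classical one. *)
Definition in_H (H : R) (g : R * R -> R) : Prop :=
  [/\ measurable_fun [set z : R * R | 0 <= z.1] g,
      {ae mu, forall t, 0 <= t ->
         mu.-integrable setT (fun x => (g (t, x))%:E)} &
      (sqnorm_H H g < +oo)%E].

End SpectralSpace.

Section Noise.
Context {R : realType} {d : measure_display} {Omega : measurableType d}.
Variable P : probability Omega R.

(* The degenerate law (Dirac mass at 0) is allowed; it is treated apart because
   normal_prob m 0 is not a Dirac mass. The parameter s of normal_prob is the
   standard deviation. *)
Definition centered_gaussian (X : Omega -> R) : Prop :=
  measurable_fun setT X /\
  exists2 s : R, 0 <= s & forall B : set R, measurable B ->
    P (X @^-1` B) = if s == 0 then \d_(0 : R) B else normal_prob 0 s B.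

Definition centered_gaussian_family (I : Type) (D : set I)
    (W : I -> Omega -> R) : Prop :=
  forall (n : nat) (i_ : 'I_n -> I) (a : 'I_n -> R),
    (forall k, D (i_ k)) ->
    centered_gaussian (fun w => \sum_(k < n) a k * W (i_ k) w).

Definition is_noise (H : R) (W : (R * R -> R) -> Omega -> R) : Prop :=
  centered_gaussian_family C0_infty_half W /\
  forall phi psi, C0_infty_half phi -> C0_infty_half psi ->
    (\int[P]_w (W phi w * W psi w))%:C%C = inner_H H phi psi.

(* X is a version of W(g): the isometric extension of W to the completion maps
   the limit g of test functions phi_n to the L^2(Omega)-limit of W(phi_n). *)
Definition wiener_integral (H : R) (W : (R * R -> R) -> Omega -> R)
    (g : R * R -> R) (X : Omega -> R) : Prop :=
  [/\ in_H H g, measurable_fun setT X &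
    exists phi : nat -> R * R -> R,
      [/\ forall n, C0_infty_half (phi n),
          sqnorm_H H (fun z => phi n z - g z) @[n --> \oo] --> 0%E &
          (\int[P]_w ((W (phi n) w - X w) ^+ 2)%:E)%E @[n --> \oo] --> 0%E]].

Definition noise_filtration (H : R) (W : (R * R -> R) -> Omega -> R) (t : R) :
    set (set Omega) :=
  <<s [set A | exists (s : R) (f : R -> R) (X : Omega -> R) (B : set R),
         [/\ 0 <= s <= t, C0_infty f,
             wiener_integral H W (fun z => if 0 <= z.1 <= s then f z.2 else 0) X,
             measurable B & A = X @^-1` B]]
      `|` P.-negligible >>.

End Noise.

Section Equations.
Context {R : realType}.
Local Notation mu := (@lebesgue_measure R).

Inductive spde :=
  | Wave of (R -> R) & (R -> R)
  | Heat of (R -> R).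

Definition admissible (e : spde) : Prop :=
  match e with
  | Wave u0 v0 => continuous u0 /\ locally_integrable setT v0
  | Heat u0 => continuous u0 /\ exists M : R, forall x, `|u0 x| <= M
  end.

Definition heat_kernel (t x : R) : R :=
  (2 * pi * t) `^ (- 2^-1) * expR (- (`|x| ^+ 2 / (2 * t))).

Definition wave_kernel (t x : R) : R := 2^-1 * (`|x| < t)%R%:R.

Definition kernel_G (e : spde) : R -> R -> R :=
  match e with Wave _ _ => wave_kernel | Heat _ => heat_kernel end.

Definition I0 (e : spde) (t x : R) : R :=
  match e with
  | Wave u0 v0 =>
      2^-1 * (\int[mu]_(y in `[(x - t), (x + t)]) v0 y)
      + 2^-1 * (u0 (x + t) + u0 (x - t))
  | Heat u0 =>
      if 0 < t then \int[mu]_y (heat_kernel t (x - y) * u0 y) else u0 x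
  end.

Definition mild_integrand (e : spde) (t x : R) (z : R * R) : R :=
  if 0 <= z.1 <= t then kernel_G e (t - z.1) (x - z.2) else 0.

Context {d : measure_display} {Omega : measurableType d}.
Variable P : probability Omega R.

Definition jointly_measurable (T : R) (u : R -> R -> Omega -> R) : Prop :=
  measurable_fun [set z : R * R * Omega | 0 <= z.1.1 <= T]
    (fun z => u z.1.1 z.1.2 z.2).

Definition adapted (T : R) (F : R -> set (set Omega))
    (u : R -> R -> Omega -> R) : Prop :=
  forall t x, 0 <= t <= T ->
    forall B : set R, measurable B -> F t (u t x @^-1` B).

Definition is_solution (H T : R) (W : (R * R -> R) -> Omega -> R) (e : spde)
    (u : R -> R -> Omega -> R) : Prop :=
  [/\ jointly_measurable T u,
      adapted T (noise_filtration P H W) u &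
      forall t x, 0 <= t <= T -> exists X : Omega -> R,
        [/\ wiener_integral P H W (mild_integrand e t x) X,
            centered_gaussian P X &
            {ae P, forall w, u t x w = I0 e t x + X w}]].

(* If P is complete and u(t, x) is measurable, then so is v(t, x). *)
Definition modification (T : R) (u v : R -> R -> Omega -> R) : Prop :=
  forall t x, 0 <= t <= T -> {ae P, forall w, u t x w = v t x w}.

Definition continuous_paths (T : R) (u : R -> R -> Omega -> R) : Prop :=
  forall w, {within [set z : R * R | 0 <= z.1 <= T],
               continuous (fun z => u z.1 z.2 w)}.

End Equations.

Arguments spde R : clear implicits.

(* Main.v *)
(** Both kernels are, at each positive time r, even and nonincreasing in |x|,
    with a bounded integral, with G_r^2 <= C / r, and with
    \int |G_{r+h} - G_r| <= C h / r. A unimodal function bounded by M is an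
    average of multiples of indicators of intervals, so its Fourier transform
    at xi is bounded by a multiple of M / |xi|. Interpolating between these
    bounds shows, for every H in (0, 1) and without computing a Fourier
    transform, that the mild integrand has finite norm and that
    ||G_{t - .}(x - .) - G_{t' - .}(x' - .)||^2 is at most a multiple of
    |t - t'|^(H/4) + |x - x'|^(H/4).

    The integrand is a limit of step functions in time, combining bumps in
    space, which gives existence of its Wiener integral together with
    adaptedness. L^2-limits of centered Gaussian variables are centered
    Gaussian, so the increments of the stochastic convolution have Gaussian
    tails, and chaining along the dyadic grid of the plane gives a continuous
    version, obtained as a limit along the grid and hence jointly measurable. *)

From HB Require Import structures.
Require Import Defs.
From mathcomp Require Import all_boot all_order all_algebra.
From mathcomp Require Import complex.
From mathcomp Require Import all_classical all_reals all_analysis.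
From mathcomp Require Import measurable_realfun.
From mathcomp Require Import zify ring lra.

Set Implicit Arguments.
Unset Strict Implicit.
Unset Printing Implicit Defensive.

Import Order.TTheory GRing.Theory Num.Theory.
Import numFieldTopology.Exports numFieldNormedType.Exports.

Local Open Scope classical_set_scope.
Local Open Scope ring_scope.

(** The obstacle is the range of [H]: the density [|xi|^(1 - 2 H)] is singular at 0 when [H > 1/2]
    and grows at infinity when [H < 1/2]. The bound [|F G_r(xi)|^2 <= C / (r xi^2)] just fails in
    time, since [1 / r] is not integrable, but has decay in frequency to spare. The exponents trade
    one for the other: lowering the power of [1 / (r xi^2)] to [1 - H / 2] still leaves
    [|xi|^(H - 2)], integrable at infinity against the density, and the gain in [r] pays both for
    integrability in time and for the Holder factor [h^(H / 4)].

    The noise is only a Gaussian family with a prescribed covariance, so its linearity on test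
    functions is itself derived, from a vanishing second moment. Beyond test functions an inequality
    with a constant stands in for the isometry. The filtration is generated by integrals of [1_[0,s]
    f] with [f] smooth, which is why the kernels are reached through interval indicators in space,
    and why limits are taken as explicit measurable limits instead of arbitrary representatives in
    L^2. *)

Lemma ler_cvg (R : realFieldType) (f g : nat -> R) (a b : R) :
  f n @[n --> \oo] --> a -> g n @[n --> \oo] --> b -> (forall n, f n <= g n) ->
  a <= b.
Proof.
move=> fa gb fg; rewrite -(cvg_lim _ fa)// -(cvg_lim _ gb)//.
by apply: ler_lim; [apply/cvg_ex; exists a|apply/cvg_ex; exists b|exact: nearW].
Qed.

(** * Fourier transforms of unimodal functions *)

Section Affine.
Context {R : realType}.
Local Notation mu := (@lebesgue_measure R).
Local Open Scope ereal_scope.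

Let aff (a b : R) : R -> measurableTypeR R := (fun x => (a * x + b)%R).

Let maff a b : measurable_fun [set: measurableTypeR R] (aff a b).
Proof. exact: measurable_funD. Qed.


(** The measure [a] times the image of Lebesgue measure under [x |-> a x + b] agrees with Lebesgue
    measure on half-open intervals, hence everywhere. *)
Lemma ge0_integral_affine (a b : R) (f : R -> \bar R) : (0 < a)%R ->
  measurable_fun setT f -> (forall x, 0 <= f x) ->
  \int[mu]_x f (a * x + b)%R = a^-1%:E * \int[mu]_x f x.
Proof.
move=> a0 mf f0.
have a0' := ltW a0.
have H (A : set R) : measurable A ->
    mu A = mscale (NngNum a0') (pushforward mu (aff a b)) A.
  move=> mA; apply: lebesgue_measure_unique => //= _ [[u v]] _ <-.
  rewrite /mscale/= /pushforward.
  have -> : aff a b @^-1` [set` `](u, v).1, (u,v).2]] =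
     [set` `](u - b) / a, (v - b) / a]]%R.
    apply/seteqP; split => x /=; rewrite !in_itv/= /aff => /andP[H1 H2].
      by rewrite ltr_pdivrMr// ler_pdivlMr// ltrBlDr lerBrDr mulrC H1.
    by move: H1 H2; rewrite ltr_pdivrMr// ler_pdivlMr// ltrBlDr lerBrDr mulrC => -> ->.
  rewrite !lebesgue_measure_itv/= !lte_fin ltr_pM2r ?invr_gt0// ltrD2r.
  case: ifPn => _; last by rewrite mule0.
  by rewrite -!EFinB -EFinM -mulrBl mulrCA divff ?gt_eqF// mulr1; congr EFin; ring.
rewrite [in RHS](eq_measure_integral (mscale (NngNum a0') (pushforward mu (aff a b)))); last first.
  by move=> A mA _; exact: H.
rewrite ge0_integral_mscale//= muleA -EFinM mulVf ?gt_eqF// mul1e.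
by rewrite ge0_integral_pushforward.
Qed.

(** Positive and negative parts keep their integrals separately, so the equality also covers the
    default values of [Rintegral]. *)
Lemma Rintegral_translate (b : R) (f : R -> R) : measurable_fun setT f ->
  (\int[mu]_x f (x + b)%R = \int[mu]_x f x)%R.
Proof.
move=> mf; rewrite /Rintegral; congr fine.
have mfE : measurable_fun setT (EFin \o f) by exact/measurable_EFinP.
rewrite integralE [RHS]integralE; congr (_ - _).
  rewrite -[RHS]mul1e -[X in X%:E * _]invr1.
  rewrite -(ge0_integral_affine b)//; last exact: measurable_funepos.
  by apply: eq_integral => x _; rewrite /= !funeposE /= mul1r.
rewrite -[RHS]mul1e -[X in X%:E * _]invr1.
rewrite -(ge0_integral_affine b)//; last exact: measurable_funeneg.
by apply: eq_integral => x _; rewrite /= !funenegE /= mul1r.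
Qed.

Lemma integrable_affine (a b : R) (f : R -> R) : (0 < a)%R ->
  mu.-integrable setT (EFin \o f) ->
  mu.-integrable setT (fun x => (f (a * x + b))%:E).
Proof.
move=> a0 /integrableP[/measurable_EFinP mf fi].
have mg : measurable_fun setT (fun x : R => f (a * x + b)%R).
  by apply: (measurableT_comp mf); exact: (maff a b).
apply/integrableP; split; first exact/measurable_EFinP.
rewrite (ge0_integral_affine b (f := fun x => `|(f x)%:E|)) //; last first.
  by apply: measurableT_comp => //; exact/measurable_EFinP.
by apply: lte_mul_pinfty => //; rewrite lee_fin invr_ge0 ltW.
Qed.

Lemma Rintegral_affine (a b : R) (f : R -> R) : (0 < a)%R ->
  mu.-integrable setT (EFin \o f) ->
  (\int[mu]_x f (a * x + b)%R = a^-1 * \int[mu]_x f x)%R.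
Proof.
move=> a0 fi; have fi2 := integrable_affine b a0 fi.
have mf : measurable_fun setT f by apply/measurable_EFinP; exact: measurable_int fi.
rewrite /Rintegral -[(a^-1)%R]/(fine a^-1%:E) -fineM//; last exact: integrable_fin_num.
congr fine; rewrite integralE [in RHS]integralE.
have mfE : measurable_fun setT (EFin \o f) by exact/measurable_EFinP.
have -> : \int[mu]_x (fun x0 => (f (a * x0 + b)%R)%:E)^\+ x =
    a^-1%:E * \int[mu]_x (EFin \o f)^\+ x.
  rewrite -(ge0_integral_affine b)//; last exact: measurable_funepos.
  by apply: eq_integral => x _; rewrite /= !funeposE.
have -> : \int[mu]_x (fun x0 => (f (a * x0 + b)%R)%:E)^\- x =
    a^-1%:E * \int[mu]_x (EFin \o f)^\- x.
  rewrite -(ge0_integral_affine b)//; last exact: measurable_funeneg.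
  by apply: eq_integral => x _; rewrite /= !funenegE.
have h : \int[mu]_x (EFin \o f)^\+ x +? - \int[mu]_x (EFin \o f)^\- x.
  by apply: fin_num_adde_defl; rewrite fin_numN; exact: integrable_neg_fin_num.
by rewrite [RHS]muleBr.
Qed.

End Affine.

(** * Integrals against bounded oscillating weights *)

Section WeightedIntegral.
Context {R : realType}.
Local Notation mu := (@lebesgue_measure R).

Definition L1 (f : R -> R) : Prop := mu.-integrable setT (EFin \o f).

(** Stands for cosine and sine at once, so that the real and imaginary parts of the Fourier
    transform are treated by a single argument. *)
Definition osc (k : R -> R) : Prop :=
  measurable_fun setT k /\ forall x, `|k x| <= 1.

Definition wint (k f : R -> R) : R := \int[mu]_x (k x * f x).

Lemma osc_cos xi : osc (fun x => cos (xi * x)).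
Proof.
split; last by move=> x; rewrite ler_norml cos_geN1 cos_le1.
apply: continuous_measurable_fun => x.
by apply: (@continuous_comp _ _ _ ( *%R xi) cos); [exact: mulrl_continuous|exact: continuous_cos].
Qed.

Lemma osc_sin xi : osc (fun x => sin (xi * x)).
Proof.
split; last by move=> x; rewrite ler_norml sin_geN1 sin_le1.
apply: continuous_measurable_fun => x.
by apply: (@continuous_comp _ _ _ ( *%R xi) sin); [exact: mulrl_continuous|exact: continuous_sin].
Qed.

Lemma L1_measurable (f : R -> R) :
  L1 f -> measurable_fun setT f.
Proof. by move=> fi; apply/measurable_EFinP; exact: measurable_int fi. Qed.

Lemma L1D (f g : R -> R) : L1 f -> L1 g -> L1 (fun x => f x + g x).
Proof. by move=> fi gi; apply: (integrableD measurableT fi gi). Qed.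

Lemma L1Z c (f : R -> R) : L1 f -> L1 (fun x => c * f x).
Proof. by move=> fi; apply: (integrableZl measurableT c fi). Qed.

Lemma L1B (f g : R -> R) : L1 f -> L1 g -> L1 (fun x => f x - g x).
Proof. by move=> fi gi; apply: (integrableB measurableT fi gi). Qed.

Lemma L1_norm (f : R -> R) : L1 f -> L1 (fun x => `|f x|).
Proof. by move=> /integrable_norm. Qed.

Lemma L1_0 : L1 (fun=> 0).
Proof. exact: integrable0. Qed.

Lemma L1_le (f g : R -> R) : measurable_fun setT f -> (forall x, `|f x| <= g x) -> L1 g -> L1 f.
Proof.
move=> mf fg gi; apply: (le_integrable measurableT _ _ gi).
  exact/measurable_EFinP.
by move=> x _ /=; rewrite lee_fin (le_trans (fg x))// ler_norm.
Qed.

Lemma L1_sum n (f : 'I_n -> R -> R) (a : 'I_n -> R) : (forall i, L1 (f i)) ->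
  L1 (fun x => \sum_(i < n) a i * f i x).
Proof.
move=> fi; rewrite (_ : (fun _ => _) = fun x => \sum_(i <- index_enum 'I_n) a i * f i x)//.
elim: (index_enum _) => [|i s IH].
  by rewrite (_ : (fun _ => _) = fun=> 0)//; [exact: L1_0|apply/funext => x; rewrite big_nil].
rewrite (_ : (fun _ => _) = fun x => a i * f i x + \sum_(j <- s) a j * f j x).
  by apply: L1D => //; exact: L1Z.
by apply/funext => x; rewrite big_cons.
Qed.

Lemma L1_osc (k f : R -> R) : osc k -> L1 f -> L1 (fun x => k x * f x).
Proof.
move=> [mk k1] fi; apply: (L1_le (g := fun x => `|f x|)).
- by apply: measurable_funM => //; exact: L1_measurable.
- by move=> x; rewrite normrM ler_piMl.
- exact: L1_norm.
Qed.

Lemma wint_lin (k f g : R -> R) c : osc k -> L1 f -> L1 g ->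
  wint k (fun x => f x + c * g x) = wint k f + c * wint k g.
Proof.
move=> ok fi gi; rewrite /wint -RintegralZl//; last exact: L1_osc.
rewrite -RintegralD//; first by apply: eq_Rintegral => x _; ring.
  exact: L1_osc.
by apply: L1Z; exact: L1_osc.
Qed.

Lemma wint0 k : wint k (fun=> 0) = 0.
Proof.
rewrite /wint (@eq_Rintegral _ _ _ _ _ (fun x => 0)); last by move=> x _; rewrite mulr0.
by rewrite /Rintegral integral0.
Qed.

Lemma wintZ (k f : R -> R) c : osc k -> L1 f -> wint k (fun x => c * f x) = c * wint k f.
Proof.
move=> ok fi; rewrite /wint -RintegralZl//; last exact: L1_osc.
by apply: eq_Rintegral => x _; ring.
Qed.

Lemma wintB (k f g : R -> R) : osc k -> L1 f -> L1 g ->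
  wint k (fun x => f x - g x) = wint k f - wint k g.
Proof.
move=> ok fi gi; rewrite -[X in _ - X]mul1r -mulNr -wint_lin//.
by apply: eq_Rintegral => x _; rewrite mulN1r.
Qed.

Lemma wint_sum k n (f : 'I_n -> R -> R) (a : 'I_n -> R) : osc k ->
  (forall i, L1 (f i)) ->
  wint k (fun x => \sum_(i < n) a i * f i x) = \sum_(i < n) a i * wint k (f i).
Proof.
move=> ok; elim: n f a => [|n IH] f a fi.
  rewrite big_ord0 -[RHS](wint0 k); congr wint.
  by apply/funext => x; rewrite big_ord0.
rewrite big_ord_recr/= -IH// -wint_lin//; last exact: L1_sum.
by apply: eq_Rintegral => x _; rewrite big_ord_recr.
Qed.

Lemma wint_le k f : osc k -> L1 f -> `|wint k f| <= \int[mu]_x `|f x|.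
Proof.
move=> ok fi; have kfi := L1_osc ok fi.
apply: (le_trans (le_normr_Rintegral measurableT kfi)).
apply: le_Rintegral => //.
- exact: (L1_norm kfi).
- exact: L1_norm.
- by move=> x _; rewrite normrM ler_piMl//; case: ok.
Qed.

(** Counts the levels [1, ..., K] that lie below [y]; it turns a sum of level-set indicators into a
    truncation. *)
Lemma truncn_sum (K : nat) (y : R) : 0 <= y ->
  \sum_(j < K) (j.+1%:R <= y)%R%:R = (minn K (Num.truncn y))%:R :> R.
Proof.
move=> y0; elim: K => [|K IH]; first by rewrite big_ord0 min0n.
rewrite big_ord_recr/= IH -truncn_ge_nat// -natrD; congr _%:R.
case: (leqP K.+1 (Num.truncn y)) => h /=.
  by rewrite (minn_idPl (ltnW h)) addn1.
by rewrite addn0 (minn_idPr _).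
Qed.

Lemma dominated_wint k (f_ : nat -> R -> R) (f g : R -> R) : osc k ->
  (forall n, measurable_fun setT (f_ n)) -> measurable_fun setT f ->
  (forall x, f_ ^~ x @ \oo --> f x) -> L1 g ->
  (forall n x, `|f_ n x| <= g x) ->
  wint k (f_ n) @[n --> \oo] --> wint k f.
Proof.
move=> [mk k1] mf_ mf cf gi fg; rewrite /wint /Rintegral.
have [] := @dominated_convergence _ _ _ mu _ measurableT
  (fun n x => (k x * f_ n x)%:E) (fun x => (k x * f x)%:E) (EFin \o g).
- by move=> n; apply/measurable_EFinP; apply: measurable_funM => //; exact: mf_.
- by apply/measurable_EFinP; apply: measurable_funM.
- by apply: aeW => x _; apply: cvg_EFin; [exact: nearW|apply: cvgMl_tmp; exact: cf].
- exact: gi.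
- apply: aeW => x n _ /=; rewrite lee_fin normrM (le_trans _ (fg n x))//.
  by rewrite ler_piMl.
move=> fi _ h; apply: fine_cvg.
rewrite fineK; last exact: integrable_fin_num.
exact: h.
Qed.

End WeightedIntegral.

(** * Oscillatory integrals of unimodal functions *)

Section Unimodal.
Context {R : realType}.
Local Notation mu := (@lebesgue_measure R).

Lemma Rintegral_FTC (F f : R -> R) (a b : R) : a <= b ->
  (forall x : R, is_derive x (1 : R) F (f x)) -> continuous f ->
  \int[mu]_(x in `[a, b]) f x = F b - F a.
Proof.
rewrite le_eqVlt => /predU1P[->|ab] dF cf.
  by rewrite set_itv1 /Rintegral integral_set1 subrr.
rewrite /Rintegral (continuous_FTC2 (F := F) ab)//.
- exact: continuous_subspaceT.
- have cF : continuous F.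
    by move=> x; apply: differentiable_continuous; apply/derivable1_diffP; case: (dF x).
  split.
  + by move=> x _; case: (dF x).
  + exact/cvg_at_right_filter/cF.
  + exact/cvg_at_left_filter/cF.
- by move=> x _; rewrite derive1E; exact: derive_val.
Qed.

Lemma is_derive_mull (c x : R) : is_derive x (1 : R) (fun y => c * y) c.
Proof.
rewrite -[X in is_derive _ _ _ X]mulr1.
exact: (is_deriveZ (f := id) c).
Qed.

(** Uniform in the interval: for cosine and sine of frequency [xi] the bound [2 / |xi|] comes from
    their bounded primitives. It is the source of decay in frequency for unimodal profiles. *)
Definition osc_bound (k : R -> R) (L : R) : Prop :=
  forall a b, a <= b -> `|\int[mu]_(x in `[a, b]) k x| <= L.

Lemma osc_bound_cos (xi : R) : xi != 0 -> osc_bound (fun x => cos (xi * x)) (2 / `|xi|).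
Proof.
move=> xi0 a b ab.
have dF (x : R) : is_derive x (1 : R) (fun x => sin (xi * x) / xi) (cos (xi * x)).
  have h := is_derive1_comp (is_derive_sin (xi * x)) (is_derive_mull xi x).
  have -> : cos (xi * x) = xi^-1 * (cos (xi * x) * xi) by field.
  rewrite (_ : (fun _ => _) = xi^-1 \*: (sin \o *%R xi)).
    exact: is_deriveZ.
  by apply/funext => y /=; rewrite mulrC.
rewrite (Rintegral_FTC ab dF) //; last first.
  by move=> x; apply: (@continuous_comp _ _ _ ( *%R xi) cos); [exact: mulrl_continuous|exact: continuous_cos].
rewrite -mulrBl normrM normfV ler_pM2r ?invr_gt0 ?normr_gt0//.
rewrite (le_trans (ler_normB _ _))// (_ : 2 = 1 + 1)//.
by apply: lerD; rewrite ler_norml ?sin_geN1 ?sin_le1.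
Qed.

Lemma osc_bound_sin (xi : R) : xi != 0 -> osc_bound (fun x => sin (xi * x)) (2 / `|xi|).
Proof.
move=> xi0 a b ab.
have dF (x : R) : is_derive x (1 : R) (fun x => - cos (xi * x) / xi) (sin (xi * x)).
  have h := is_derive1_comp (is_derive_cos (xi * x)) (is_derive_mull xi x).
  have -> : sin (xi * x) = - xi^-1 * (- sin (xi * x) * xi) by field.
  rewrite (_ : (fun _ => _) = (- xi^-1) \*: (cos \o *%R xi)).
    exact: is_deriveZ.
  by apply/funext => y /=; rewrite -[RHS]/(_ * _) mulNr mulrC mulNr.
rewrite (Rintegral_FTC ab dF) //; last first.
  by move=> x; apply: (@continuous_comp _ _ _ ( *%R xi) sin); [exact: mulrl_continuous|exact: continuous_sin].
rewrite -mulrBl normrM normfV ler_pM2r ?invr_gt0 ?normr_gt0//.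
rewrite (le_trans (ler_normB _ _))// (_ : 2 = 1 + 1)// normrN.
by apply: lerD; rewrite ?normrN ler_norml ?cos_geN1 ?cos_le1.
Qed.

(** Finite measure excludes the unbounded intervals; the empty set is written as []0, 0]]. *)
Lemma is_interval_L1 (A : set R) : is_interval A -> L1 (\1_A : R -> R) ->
  exists a b b0 b1, a <= b /\ A = [set` Interval (BSide b0 a) (BSide b1 b)].
Proof.
move=> /is_intervalP AE Ai.
have mA : measurable A by rewrite AE; exact: measurable_itv.
have muA : (mu A < +oo)%E.
  move: Ai => /integrableP[_].
  under eq_integral do rewrite /= ger0_norm//.
  by rewrite integral_indic// setIT.
have E0 : exists a b b0 b1, a <= b /\ @set0 R = [set` Interval (BSide b0 a) (BSide b1 b)].
  by exists 0, 0, false, false; split => //; rewrite set_itvoc0.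
have [A0|/set0P[z Az]] := eqVneq A set0; first by rewrite A0.
move: muA Az; rewrite AE lebesgue_measure_itv.
case: (Rhull A) => -[b0 a|[|]] [b1 b|[|]] //=; rewrite ?in_itv/= ?ltry ?ltNyr ?addye ?addey//=.
- move=> _ zab; exists a, b, b0, b1; split => //.
  by move: zab => /andP[/lteifW h1 /lteifW h2]; exact: le_trans h1 h2.
all: by rewrite ?andbF ?ltry// ?ltNyr//= ?ltxx.
Qed.

Lemma wint_interval (k : R -> R) L A : osc k -> osc_bound k L -> is_interval A ->
  L1 (\1_A : R -> R) -> `|wint k \1_A| <= L.
Proof.
move=> [mk k1] kL iA /(is_interval_L1 iA)[a [b [b0 [b1 [ab AE]]]]].
have := kL _ _ ab; congr (`|_| <= _).
have -> : wint k \1_A = \int[mu]_(x in A) k x.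
  rewrite Rintegral_mkcond; apply: eq_Rintegral => x _.
  by rewrite patchE indicE; case: ifPn; rewrite ?mulr1 ?mulr0.
have mkE (D : set R) : measurable_fun D (EFin \o k).
  exact/measurable_EFinP/measurable_funTS.
rewrite AE /Rintegral (integral_itv_bndoo (f := EFin \o k)) ?(mkE `]a, b[)//.
by rewrite [in RHS](integral_itv_bndoo (f := EFin \o k)).
Qed.

Definition unimodal (f : R -> R) : Prop :=
  (forall x, 0 <= f x) /\ (forall c, 0 < c -> is_interval [set x | c <= f x]).

Definition level (f : R -> R) (m j : nat) : set R := [set x | j.+1%:R / m.+1%:R <= f x].

(* Layer-cake approximation: [f] is the average of the indicators of its level
   sets, which are intervals when [f] is unimodal. *)
Definition stair (f : R -> R) (m K : nat) (x : R) : R :=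
  \sum_(j < K) m.+1%:R^-1 * \1_(level f m j) x.

Lemma stairE (f : R -> R) m K x : 0 <= f x ->
  stair f m K x = (minn K (Num.truncn (m.+1%:R * f x)))%:R / m.+1%:R.
Proof.
move=> f0; rewrite -truncn_sum ?mulr_ge0// mulrC mulr_sumr; apply: eq_bigr => j _.
rewrite indicE; congr (_ * _%:R).
rewrite (_ : (x \in _) = (j.+1%:R <= m.+1%:R * f x))//.
by apply/idP/idP; rewrite inE /level/= ler_pdivrMr// mulrC.
Qed.

Lemma stair_le (f : R -> R) m K x : 0 <= f x -> 0 <= stair f m K x <= f x.
Proof.
move=> f0; rewrite stairE// divr_ge0//= ler_pdivrMr// (mulrC (f x)).
rewrite (@le_trans _ _ (Num.truncn (m.+1%:R * f x))%:R)//.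
  by rewrite ler_nat geq_minr.
by rewrite truncn_le// mulr_ge0.
Qed.

Lemma stair_ge (f : R -> R) m K x : 0 <= f x -> m.+1%:R * f x <= K%:R ->
  f x - m.+1%:R^-1 <= stair f m K x.
Proof.
move=> f0 fK; rewrite stairE// lerBlDr -{2}[_^-1]mul1r -mulrDl ler_pdivlMr// (mulrC (f x)).
rewrite (minn_idPr _).
  by rewrite natr1 ltW// truncnS_gt.
by rewrite -(@ler_nat R) (le_trans _ fK)// truncn_le// mulr_ge0.
Qed.

Lemma level_interval (f : R -> R) m j : unimodal f -> is_interval (level f m j).
Proof. by move=> [_ iv]; apply: iv; rewrite divr_gt0. Qed.

Lemma level_L1 (f : R -> R) m j : (forall x, 0 <= f x) -> L1 f ->
  L1 (\1_(level f m j) : R -> R).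
Proof.
move=> f0 fi; apply: (L1_le (g := fun x => (m.+1%:R / j.+1%:R) * f x)); last exact: L1Z.
  apply: measurable_indic; rewrite /level -[X in measurable X]setTI.
  rewrite (_ : [set _ | _] = f @^-1` `[j.+1%:R / m.+1%:R, +oo[); last first.
    by apply/seteqP; split => x /=; rewrite in_itv/= andbT.
  by apply: (L1_measurable fi) => //; exact: measurable_itv.
move=> x; rewrite ger0_norm// indicE; case: (boolP (x \in _)) => [|_].
  by rewrite inE /level /= ler_pdivrMr// mulrAC ler_pdivlMr// mul1r mulrC.
by rewrite mulr_ge0// divr_ge0.
Qed.

Lemma stair_L1 (f : R -> R) m K : (forall x, 0 <= f x) -> L1 f -> L1 (stair f m K).
Proof. by move=> f0 fi; apply: L1_sum => i; exact: level_L1. Qed.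

Lemma wint_stair (k f : R -> R) m K : osc k -> (forall x, 0 <= f x) -> L1 f ->
  wint k (stair f m K) = \sum_(j < K) m.+1%:R^-1 * wint k \1_(level f m j).
Proof.
by move=> ok f0 fi; rewrite /stair wint_sum// => i; exact: level_L1.
Qed.

Lemma wint_stair_le (k f : R -> R) m K L : osc k -> osc_bound k L -> unimodal f -> L1 f ->
  `|wint k (stair f m K)| <= K%:R / m.+1%:R * L.
Proof.
move=> ok kL uf fi; have f0 := uf.1; rewrite wint_stair//.
rewrite (le_trans (ler_norm_sum _ _ _))//.
rewrite (@le_trans _ _ (\sum_(j < K) m.+1%:R^-1 * L))//.
  apply: ler_sum => i _; rewrite normrM ger0_norm ?invr_ge0// ler_wpM2l ?invr_ge0//.
  by apply: wint_interval => //; [exact: level_interval|exact: level_L1].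
by rewrite sumr_const card_ord -[leLHS]mulr_natl mulrA.
Qed.

(** The number of levels of mesh [1 / (m + 1)] that covers a function bounded by [M]; the factor of
    [L] in [wint_stair_le] is then at most [M + 1 / (m + 1)]. *)
Definition stair_height (M : R) (m : nat) : nat := (Num.truncn (m.+1%:R * M)).+1.

Lemma stair_height_ge (M : R) m : m.+1%:R * M <= (stair_height M m)%:R.
Proof. by rewrite ltW// truncnS_gt. Qed.

Lemma stair_height_le (M : R) m : 0 <= M ->
  (stair_height M m)%:R / m.+1%:R <= M + m.+1%:R^-1.
Proof.
move=> M0; rewrite ler_pdivrMr// mulrDl mulVf// mulrC /stair_height -natr1 lerD2r mulrC.
by rewrite truncn_le// mulr_ge0.
Qed.

Lemma cvg_stair (f : R -> R) M x : 0 <= f x -> f x <= M ->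
  stair f m (stair_height M m) x @[m --> \oo] --> f x.
Proof.
move=> f0 fM; apply: (@squeeze_cvgr _ _ _ _ (fun m => f x - m.+1%:R^-1) (fun=> f x)).
- apply: nearW => m; rewrite (proj2 (andP (stair_le _ _ f0))) andbT stair_ge//.
  by rewrite (le_trans _ (stair_height_ge M m))// ler_wpM2l.
- rewrite -[X in _ --> X]subr0; apply: cvgB; first exact: cvg_cst.
  exact: (cvg_harmonic (R := R)).
- exact: cvg_cst.
Qed.

Lemma cvg_wint_stair (k f : R -> R) M : osc k -> (forall x, 0 <= f x <= M) -> L1 f ->
  wint k (stair f m (stair_height M m)) @[m --> \oo] --> wint k f.
Proof.
move=> ok fM fi; have f0 x : 0 <= f x by case/andP: (fM x).
apply: (dominated_wint (g := f)) => //.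
- by move=> n; apply: L1_measurable; exact: stair_L1.
- exact: L1_measurable.
- by move=> x; apply: cvg_stair => //; case/andP: (fM x).
- by move=> n x; case/andP: (stair_le n (stair_height M n) (f0 x)) => h1 h2; rewrite ger0_norm.
Qed.

Lemma wint_unimodal (k f : R -> R) M L : osc k -> osc_bound k L -> unimodal f ->
  (forall x, f x <= M) -> L1 f -> `|wint k f| <= M * L.
Proof.
move=> ok kL uf fM fi; have f0 := uf.1.
have M0 : 0 <= M := le_trans (f0 0) (fM 0).
have L0 : 0 <= L := le_trans (normr_ge0 _) (kL 0 0 (lexx 0)).
have h1 : `|wint k (stair f m (stair_height M m))| @[m --> \oo] --> `|wint k f|.
  by apply: cvg_norm; apply: cvg_wint_stair => // x; rewrite f0 fM.
have h2 : (M + m.+1%:R^-1) * L @[m --> \oo] --> (M + 0) * L.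
  apply: cvgM; last exact: cvg_cst.
  by apply: cvgD; [exact: cvg_cst|exact: (cvg_harmonic (R := R))].
rewrite -[M]addr0.
apply: (ler_cvg h1 h2) => m; rewrite (le_trans (wint_stair_le _ _ ok kL uf fi))//.
by rewrite ler_wpM2r// stair_height_le.
Qed.

(** A point [z] between [x] and [y] is no farther from [m] than [x] if it lies on the left of [m],
    and no farther than [y] otherwise. *)
Lemma unimodal_sym (Phi : R -> R) (m : R) : (forall r, 0 <= Phi r) ->
  (forall r s, 0 <= r -> r <= s -> Phi s <= Phi r) ->
  unimodal (fun x => Phi `|x - m|).
Proof.
move=> P0 Pd; split => // c c0 x y /= cx cy z /andP[xz zy].
have : `|z - m| <= `|x - m| \/ `|z - m| <= `|y - m|.
  have [zm|zm] := leP z m; [left|right].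
    by rewrite !ler0_norm; lra.
  by rewrite !ger0_norm; lra.
by move=> [h|h]; [apply: (le_trans cx)|apply: (le_trans cy)]; exact: Pd.
Qed.

End Unimodal.

(** * Squared modulus of the Fourier transform: bounds, shifts, measurability *)

Section FourierTransform.
Context {R : realType}.
Local Notation mu := (@lebesgue_measure R).
Implicit Types f g : R -> R.

Lemma sqr_le_norm (a b : R) : `|a| <= b -> a ^+ 2 <= b ^+ 2.
Proof.
move=> h; have b0 : 0 <= b := le_trans (normr_ge0 _) h.
by rewrite -[leLHS]real_normK ?num_real// ler_sqr ?nnegrE.
Qed.

Definition FC f xi := wint (fun x => cos (xi * x)) f.
Definition FS f xi := wint (fun x => sin (xi * x)) f.
Definition Fsq f xi := FC f xi ^+ 2 + FS f xi ^+ 2.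

Lemma Fsq_ge0 f xi : 0 <= Fsq f xi.
Proof. by rewrite addr_ge0// sqr_ge0. Qed.

Lemma fourierE f xi : L1 f -> fourier f xi = Complex (FC f xi) (- FS f xi).
Proof.
move=> fi; rewrite /fourier /cintegral; congr Complex.
  by apply: eq_Rintegral => x _ /=; rewrite cosN mulr0 subr0.
rewrite -mulN1r /FS -wintZ//; last exact: osc_sin.
by apply: eq_Rintegral => x _ /=; rewrite sinN; ring.
Qed.

Lemma normc_fourier f xi : L1 f ->
  ComplexField.Normc.normc (fourier f xi) ^+ 2 = Fsq f xi.
Proof.
by move=> fi; rewrite fourierE//= sqr_sqrtr ?sqrrN// addr_ge0// sqr_ge0.
Qed.

Lemma Fsq_B_le f g xi : L1 f -> L1 g ->
  Fsq (fun x => f x - g x) xi <= 2 * Fsq f xi + 2 * Fsq g xi.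
Proof.
move=> fi gi; rewrite /Fsq /FC /FS !wintB//; try exact: osc_sin; try exact: osc_cos.
set a := wint _ f; set b := wint _ g; set c := wint _ f; set d := wint _ g.
have := sqr_ge0 (a + b); have := sqr_ge0 (c + d); nra.
Qed.

(** Cosine and sine parts are bounded separately by the L1 norm, whence the factor 2. *)
Lemma Fsq_le_L1 f xi : L1 f -> Fsq f xi <= 2 * (\int[mu]_x `|f x|) ^+ 2.
Proof.
move=> fi; rewrite mulr_natl mulr2n; apply: lerD; apply: sqr_le_norm; apply: wint_le => //.
  exact: osc_cos.
exact: osc_sin.
Qed.

(** Twice the square of [M * (2 / |xi|)], once for each of cosine and sine. *)
Lemma Fsq_unimodal f M xi : xi != 0 -> unimodal f -> (forall x, f x <= M) -> L1 f ->
  Fsq f xi <= 8 * M ^+ 2 / xi ^+ 2.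
Proof.
move=> xi0 uf fM fi.
have M0 : 0 <= M := le_trans (uf.1 0) (fM 0).
have -> : 8 * M ^+ 2 / xi ^+ 2 = (M * (2 / `|xi|)) ^+ 2 + (M * (2 / `|xi|)) ^+ 2.
  rewrite !exprMn exprVn real_normK ?num_real//.
  by field.
apply: lerD; apply: sqr_le_norm.
  by apply: (wint_unimodal (osc_cos _) (osc_bound_cos xi0)).
by apply: (wint_unimodal (osc_sin _) (osc_bound_sin xi0)).
Qed.

Lemma FC_shift f a xi : L1 f ->
  FC (fun x => f (x - a)) xi = cos (xi * a) * FC f xi - sin (xi * a) * FS f xi.
Proof.
move=> fi; rewrite /FC /FS /wint.
have mf := L1_measurable fi.
rewrite -(Rintegral_translate a); last first.
  apply: measurable_funM; first by have [] := osc_cos xi.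
  by apply: (measurableT_comp mf); exact: measurable_funB.
rewrite -!RintegralZl//; [|exact: (L1_osc (osc_sin xi) fi)|exact: (L1_osc (osc_cos xi) fi)].
rewrite -RintegralB//; last 2 first.
- by apply: L1Z; exact: (L1_osc (osc_cos xi) fi).
- by apply: L1Z; exact: (L1_osc (osc_sin xi) fi).
by apply: eq_Rintegral => x _; rewrite addrK mulrDr cosD; ring.
Qed.

Lemma FS_shift f a xi : L1 f ->
  FS (fun x => f (x - a)) xi = cos (xi * a) * FS f xi + sin (xi * a) * FC f xi.
Proof.
move=> fi; rewrite /FC /FS /wint.
have mf := L1_measurable fi.
rewrite -(Rintegral_translate a); last first.
  apply: measurable_funM; first by have [] := osc_sin xi.
  by apply: (measurableT_comp mf); exact: measurable_funB.
rewrite -!RintegralZl//; [|exact: (L1_osc (osc_cos xi) fi)|exact: (L1_osc (osc_sin xi) fi)].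
rewrite -RintegralD//; last 2 first.
- by apply: L1Z; exact: (L1_osc (osc_sin xi) fi).
- by apply: L1Z; exact: (L1_osc (osc_cos xi) fi).
by apply: eq_Rintegral => x _; rewrite addrK mulrDr sinD; ring.
Qed.

Lemma L1_shift f a : L1 f -> L1 (fun x => f (x - a)).
Proof.
move=> fi; have := integrable_affine (- a) (@ltr01 R) fi.
by apply: eq_integrable => // x _ /=; rewrite mul1r.
Qed.

Lemma Fsq_shift f a xi : L1 f -> Fsq (fun x => f (x - a)) xi = Fsq f xi.
Proof.
move=> fi; rewrite /Fsq FC_shift// FS_shift//; have := cos2Dsin2 (xi * a).
set c := cos _; set s := sin _; set p := FC _ _; set q := FS _ _ => h.
rewrite -[RHS]mul1r -h; ring.
Qed.

(** The factor is [|exp(- i xi a) - exp(- i xi b)|^2]. *)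
Lemma Fsq_shiftB f a b xi : L1 f ->
  Fsq (fun x => f (x - a) - f (x - b)) xi = (2 - 2 * cos (xi * (a - b))) * Fsq f xi.
Proof.
move=> fi; rewrite {1}/Fsq /FC /FS !wintB//; try exact: L1_shift; [|exact: osc_sin|exact: osc_cos].
rewrite -!/(FC _ _) -!/(FS _ _) !FC_shift// !FS_shift// mulrBr cosB.
have := cos2Dsin2 (xi * a); have := cos2Dsin2 (xi * b); rewrite /Fsq.
set c := cos _; set s := sin _; set c' := cos _; set s' := sin _.
set p := FC _ _; set q := FS _ _ => h h'.
have -> : (2 - 2 * (c' * c + s' * s)) * (p ^+ 2 + q ^+ 2) =
  ((c ^+ 2 + s ^+ 2) + (c' ^+ 2 + s' ^+ 2) - 2 * (c' * c + s' * s)) * (p ^+ 2 + q ^+ 2).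
  by rewrite h h' (_ : 1 + 1 = 2).
ring.
Qed.

Lemma normr_sin_le (x : R) : `|sin x| <= `|x|.
Proof.
have pos (y : R) : 0 < y -> `|sin y| <= y.
  move=> y0.
  have [c _] := @MVT R sin cos 0 y y0 (fun z _ => is_derive_sin z)
    (continuous_subspaceT (@continuous_sin R)).
  rewrite sin0 !subr0 => ->; rewrite normrM (gtr0_norm y0) ler_piMl ?(ltW y0)//.
  by rewrite ler_norml cos_geN1 cos_le1.
have [x0|x0|->] := ltgtP x 0; last by rewrite sin0 normr0.
  by rewrite (ltr0_norm x0) -normrN -sinN pos// oppr_gt0.
by rewrite (gtr0_norm x0) pos.
Qed.

(** The left side is [4 sin(x / 2)^2]. *)
Lemma cos_quad (x : R) : 2 - 2 * cos x <= x ^+ 2.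
Proof.
have -> : cos x = 1 - 2 * sin (x / 2) ^+ 2.
  by rewrite [in LHS](splitr x) cosD; have := cos2Dsin2 (x / 2); lra.
have : sin (x / 2) ^+ 2 <= (x / 2) ^+ 2.
  rewrite -[leRHS]real_normK ?num_real//; apply: sqr_le_norm; exact: normr_sin_le.
rewrite expr_div_n; lra.
Qed.

Lemma Fsq_shiftB_le f a b xi : L1 f ->
  Fsq (fun x => f (x - a) - f (x - b)) xi <= (xi * (a - b)) ^+ 2 * Fsq f xi.
Proof. by move=> fi; rewrite Fsq_shiftB// ler_wpM2r ?Fsq_ge0// cos_quad. Qed.

(** [Rintegral] is [fine] of the difference of the integrals of the positive and negative parts, and
    each of these is measurable in the parameters by Tonelli. *)
Lemma measurable_slice_wint (k : R * R -> R) (g : R * R -> R) :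
  measurable_fun setT k -> measurable_fun setT g ->
  measurable_fun setT (fun z : R * R => wint (fun x => k (z.2, x)) (fun x => g (z.1, x))).
Proof.
move=> mk mg.
pose h : (R * R) * R -> \bar R := fun y => (k (y.1.2, y.2) * g (y.1.1, y.2))%:E.
have mh : measurable_fun setT h.
  apply/measurable_EFinP; apply: measurable_funM.
    apply: (measurableT_comp mk); apply: measurable_fun_pair => //.
    exact: (measurableT_comp measurable_snd measurable_fst).
  apply: (measurableT_comp mg); apply: measurable_fun_pair => //.
  exact: (measurableT_comp measurable_fst measurable_fst).
rewrite (_ : (fun _ => _) = fine \o
  ((fubini_F mu h^\+) \- (fubini_F mu h^\-))%E); last first.
  apply/funext => z /=; rewrite /wint /Rintegral integralE /fubini_F.
  by congr fine; congr (_ - _)%E; apply: eq_integral => x _; rewrite ?funeposE ?funenegE.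
apply: (measurableT_comp (fine_measurable measurableT)).
apply: emeasurable_funB; apply: measurable_fun_fubini_tonelli_F => //.
  exact: measurable_funepos.
exact: measurable_funeneg.
Qed.

Lemma measurable_slice_FC (g : R * R -> R) : measurable_fun setT g ->
  measurable_fun setT (fun z : R * R => FC (fun x => g (z.1, x)) z.2).
Proof.
move=> mg; apply: (@measurable_slice_wint (fun y => cos (y.1 * y.2))) => //.
apply: (measurableT_comp (continuous_measurable_fun (@continuous_cos R))).
by apply: measurable_funM.
Qed.

Lemma measurable_slice_FS (g : R * R -> R) : measurable_fun setT g ->
  measurable_fun setT (fun z : R * R => FS (fun x => g (z.1, x)) z.2).
Proof.
move=> mg; apply: (@measurable_slice_wint (fun y => sin (y.1 * y.2))) => //.
apply: (measurableT_comp (continuous_measurable_fun (@continuous_sin R))).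
by apply: measurable_funM.
Qed.

Lemma measurable_slice_Fsq (g : R * R -> R) : measurable_fun setT g ->
  measurable_fun setT (fun z : R * R => Fsq (fun x => g (z.1, x)) z.2).
Proof.
move=> mg; apply: measurable_funD; apply: measurable_funX.
  exact: measurable_slice_FC.
exact: measurable_slice_FS.
Qed.

End FourierTransform.

(** * The spectral norm *)

Section PowerIntegrals.
Context {R : realType}.
Local Notation mu := (@lebesgue_measure R).
Local Open Scope ereal_scope.

Lemma integral_powR (a b p : R) : (0 < a)%R -> (a <= b)%R -> (p + 1 != 0)%R ->
  \int[mu]_(x in `[a, b]) (x `^ p)%:E = ((b `^ (p + 1) - a `^ (p + 1)) / (p + 1))%:E.
Proof.
move=> a0 + p0; rewrite le_eqVlt => /predU1P[<-|ab].
  by rewrite set_itv1 integral_set1 subrr mul0r.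
have dF (x : R) : (0 < x)%R -> is_derive x (1%R : R) (fun y => (p + 1)^-1 * y `^ (p + 1))%R (x `^ p)%R.
  move=> x0; have -> : (x `^ p = (p + 1)^-1 * ((p + 1) * x `^ (p + 1 - 1)))%R.
    by rewrite addrK mulrA mulVf// mul1r.
  by have h := is_derive1_powR (p + 1)%R x0; exact: (is_deriveZ (f := (@powR R)^~ (p + 1)%R)).
have cF q (x : R) : (0 < x)%R -> {for x, continuous ((@powR R)^~ q)}.
  move=> x0; apply: differentiable_continuous; apply/derivable1_diffP.
  by case: (is_derive1_powR q x0).
have x_gt0 (x : R) : x \in `[a, b] -> (0 < x)%R.
  by rewrite in_itv/= => /andP[ax _]; exact: lt_le_trans ax.
pose F : R -> R := (fun y => (p + 1)^-1 * y `^ (p + 1))%R.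
rewrite (continuous_FTC2 (f := (@powR R)^~ p) (F := F) ab) ?/F//=.
- by rewrite -EFinB -mulrBr mulrC.
- apply: continuous_in_subspaceT => x; rewrite inE/= => xab.
  by apply: cF; exact: x_gt0.
- have cF' (x : R) : (0 < x)%R -> {for x, continuous (fun y => (p + 1)^-1 * y `^ (p + 1))%R}.
    by move=> x0; apply: continuousM; [exact: cst_continuous|exact: cF].
  split.
  + by move=> x xab; case: (dF x) => //; apply: x_gt0; exact: subset_itv_oo_cc.
  + by apply/cvg_at_right_filter/cF'.
  + by apply/cvg_at_left_filter/cF'; exact: lt_trans ab.
- move=> x xab; rewrite derive1E.
  have x0 : (0 < x)%R by apply: x_gt0; exact: subset_itv_oo_cc.
  by have := dF x x0 => ?; exact: derive_val.
Qed.

(** Monotone convergence along [[b / (n + 1), b]], where the fundamental theorem of calculus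
    applies. *)
Lemma integral_powR0_le (b p : R) : (0 <= b)%R -> (0 < p + 1)%R ->
  \int[mu]_(x in `]0%R, b]) (x `^ p)%:E <= (b `^ (p + 1) / (p + 1))%:E.
Proof.
rewrite le_eqVlt => /predU1P[<-|b0] p0.
  by rewrite set_itvoc0 integral_set0 lee_fin divr_ge0// ?powR_ge0 ?ltW.
pose F n : set R := `[(b / n.+1%:R)%R, b]%classic.
have -> : `]0%R, b]%classic = \bigcup_n F n :> set R.
  apply/seteqP; split => x /=; rewrite in_itv/=.
    move=> /andP[x0 xb]; exists (Num.truncn (b / x)) => //=.
    rewrite /F/= in_itv/= xb andbT ler_pdivrMr// mulrC -ler_pdivrMr//.
    by rewrite ltW// truncnS_gt.
  move=> [n _]; rewrite /F/= in_itv/= => /andP[nx ->]; rewrite andbT.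
  by rewrite (lt_le_trans _ nx)// divr_gt0.
have cF : \int[mu]_(x in F n) (x `^ p)%:E @[n --> \oo] --> \int[mu]_(x in \bigcup_n F n) (x `^ p)%:E.
  apply: ge0_nondecreasing_set_cvg_integral.
  - move=> m n mn; apply/subsetPset => x; rewrite /F /= !in_itv/= => /andP[h ->].
    by rewrite andbT (le_trans _ h)// ler_pM2l// lef_pV2 ?posrE// ler_nat.
  - by move=> n; exact: measurable_itv.
  - by move=> n; apply/measurable_EFinP; apply: measurable_funTS; exact: measurable_powR.
  - by move=> n x _; rewrite lee_fin powR_ge0.
rewrite -(cvg_lim _ cF)//.
apply: lime_le; last first.
  apply: nearW => n; rewrite integral_powR ?gt_eqF//; last 2 first.
  + by rewrite divr_gt0.
  + by rewrite ler_pdivrMr// ler_peMr ?(ltW b0)// ler1n.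
  by rewrite lee_fin ler_pM2r ?invr_gt0// lerBlDr lerDl powR_ge0.
apply: ereal_nondecreasing_is_cvgn => m n mn.
apply: ge0_subset_integral => //=; [exact: measurable_itv|exact: measurable_itv|..].
- by apply/measurable_EFinP; apply: measurable_funTS; exact: measurable_powR.
- by move=> x _; rewrite lee_fin powR_ge0.
- move=> x; rewrite /F /= !in_itv/= => /andP[h ->]; rewrite andbT.
  by rewrite (le_trans _ h)// ler_pM2l// lef_pV2 ?posrE// ler_nat.
Qed.

Lemma integral_powRy_le (p : R) : (p + 1 < 0)%R ->
  \int[mu]_(x in `[1%R, +oo[) (x `^ p)%:E <= ((- (p + 1))^-1)%:E.
Proof.
move=> p0; pose F n : set R := `[1%R, n.+1%:R]%classic.
have -> : `[1%R, +oo[%classic = \bigcup_n F n :> set R.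
  apply/seteqP; split => x /=; rewrite in_itv/= ?andbT.
    move=> x1; exists (Num.truncn x) => //=.
    by rewrite /F/= in_itv/= x1 ltW// truncnS_gt.
  by move=> [n _]; rewrite /F/= in_itv/= => /andP[].
have cF : \int[mu]_(x in F n) (x `^ p)%:E @[n --> \oo] --> \int[mu]_(x in \bigcup_n F n) (x `^ p)%:E.
  apply: ge0_nondecreasing_set_cvg_integral.
  - move=> m n mn; apply/subsetPset => x; rewrite /F /= !in_itv/= => /andP[-> h] /=.
    by rewrite (le_trans h)// ler_nat.
  - by move=> n; exact: measurable_itv.
  - by move=> n; apply/measurable_EFinP; apply: measurable_funTS; exact: measurable_powR.
  - by move=> n x _; rewrite lee_fin powR_ge0.
rewrite -(cvg_lim _ cF)//.
apply: lime_le; last first.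
  apply: nearW => n; rewrite integral_powR ?lt_eqF// ?ler1n//.
  rewrite lee_fin powR1 invrN -[leRHS]mulN1r ler_nM2r ?invr_lt0//.
  by rewrite -[leLHS]add0r lerD2r powR_ge0.
apply: ereal_nondecreasing_is_cvgn => m n mn.
apply: ge0_subset_integral => //=; [exact: measurable_itv|exact: measurable_itv|..].
- by apply/measurable_EFinP; apply: measurable_funTS; exact: measurable_powR.
- by move=> x _; rewrite lee_fin powR_ge0.
- move=> x; rewrite /F /= !in_itv/= => /andP[-> h] /=.
  by rewrite (le_trans h)// ler_nat.
Qed.

Lemma integral_norm_le (f : R -> \bar R) : measurable_fun setT f -> (forall x, 0 <= f x) ->
  \int[mu]_x f `|x|%R <= \int[mu]_(x in `[0%R, +oo[) f x + \int[mu]_(x in `[0%R, +oo[) f x.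
Proof.
move=> mf f0.
have mn : measurable_fun setT (fun x : R => f `|x|%R) by exact: (measurableT_comp mf).
rewrite -(@setUv R `[0%R, +oo[%classic) ge0_integral_setU//=; last 3 first.
- exact: measurableC.
- by rewrite setUv.
- by rewrite disj_set2E setICr.
apply: leeD.
  rewrite le_eqVlt; apply/orP; left; apply/eqP; apply: eq_integral => x.
  by rewrite inE/= in_itv/= andbT => x0; rewrite ger0_norm.
rewrite [leRHS]ge0_integration_by_substitution0//.
apply: (@le_trans _ _ (\int[mu]_(x in ~` `[0%R, +oo[) f (- x)%R)).
  rewrite le_eqVlt; apply/orP; left; apply/eqP; apply: eq_integral => x.
  by rewrite inE/= in_itv/= andbT => /negP; rewrite -ltNge => x0; rewrite ltr0_norm.
apply: ge0_subset_integral => //.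
- by apply: measurableC.
- by apply: measurable_funTS; exact: (measurableT_comp mf).
- by move=> x /=; rewrite !in_itv/= andbT => /negP; rewrite -ltNge => /ltW.
Qed.

Lemma integral_reflect (b : R) (f : R -> \bar R) : measurable_fun setT f -> (forall x, 0 <= f x) ->
  \int[mu]_x f (b - x)%R = \int[mu]_x f x.
Proof.
move=> mf f0; rewrite -[RHS]mul1e -[X in X%:E * _]invr1 -(ge0_integral_affine b)//.
rewrite [RHS](eq_measure_integral (pushforward mu (-%R : R -> measurableTypeR R))); last first.
  by move=> A mA _; rewrite /= lebesgue_measureN.
rewrite ge0_integral_pushforward//=; last first.
  by apply: (measurableT_comp mf); apply: measurable_funD => //; exact: measurable_funM.
by apply: eq_integral => x _ /=; rewrite mul1r addrC.
Qed.

End PowerIntegrals.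

(** * The squared norm as an integral over time and frequency *)

Section SpectralNorm.
Context {R : realType}.
Local Notation mu := (@lebesgue_measure R).
Local Notation mu2 := (mu \x mu)%E.
Variable H : R.
Hypothesis H01 : 0 < H < 1.
Implicit Types f g : R * R -> R.

Lemma c_ge0 : 0 <= c_ H.
Proof.
have /andP[H0 H1] := H01.
rewrite /c_ divr_ge0 ?mulr_ge0 ?pi_ge0//.
  by apply: Rintegral_ge0 => x _; rewrite mulr_ge0 ?powR_ge0 ?expR_ge0.
apply: sin_ge0_pi; rewrite mulr_ge0 ?pi_ge0 ?(ltW H0)//=.
by rewrite ler_piMr ?pi_ge0// ltW.
Qed.

Lemma spectral_density_ge0 xi : 0 <= spectral_density H xi.
Proof. by rewrite mulr_ge0 ?c_ge0 ?powR_ge0. Qed.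

Lemma measurable_spectral_density : measurable_fun setT (spectral_density H).
Proof.
apply: measurable_funM => //.
have h : measurable_fun setT (fun x : R => `|x|) by exact: normr_measurable.
exact: (measurableT_comp (measurable_powR (1 - 2 * H)) h).
Qed.

(** A pointwise version of [in_H] without the finite norm: vanishing for [t < 0] lets the norm be an
    integral over the whole plane, and integrability of every slice makes the transform of a linear
    combination the combination of the transforms at every time. *)
Definition nice g : Prop :=
  [/\ measurable_fun setT g, forall t x, t < 0 -> g (t, x) = 0 &
      forall t, L1 (fun x => g (t, x))].

Definition slice_sq g (z : R * R) : R := Fsq (fun x => g (z.1, x)) z.2.

Definition sqnorm g : \bar R :=
  (\int[mu2]_z (slice_sq g z * spectral_density H z.2)%:E)%E.

Lemma nice_lin f g c : nice f -> nice g -> nice (fun z => f z + c * g z).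
Proof.
move=> [mf zf lf] [mg zg lg]; split.
- by apply: measurable_funD => //; exact: measurable_funM.
- by move=> t x t0; rewrite zf// zg// mulr0 addr0.
- by move=> t; apply: L1D => //; exact: L1Z.
Qed.

Lemma niceB f g : nice f -> nice g -> nice (fun z => f z - g z).
Proof.
move=> nf ng; have := nice_lin (-1) nf ng.
by rewrite (_ : (fun _ => _) = fun z => f z - g z)//; apply/funext => z; rewrite mulN1r.
Qed.

Lemma nice0 : nice (fun=> 0).
Proof. by split => // t; exact: L1_0. Qed.

Lemma measurable_sq_density f : measurable_fun setT f ->
  measurable_fun setT (fun z => (slice_sq f z * spectral_density H z.2)%:E).
Proof.
move=> mf; apply/measurable_EFinP; apply: measurable_funM.
  exact: measurable_slice_Fsq.
exact: (measurableT_comp measurable_spectral_density measurable_snd).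
Qed.

Lemma sq_density_ge0 f z : (0 <= (slice_sq f z * spectral_density H z.2)%:E)%E.
Proof. by rewrite lee_fin mulr_ge0 ?Fsq_ge0 ?spectral_density_ge0. Qed.

Lemma sqnorm_ge0 g : (0 <= sqnorm g)%E.
Proof. by apply: integral_ge0 => z _; exact: sq_density_ge0. Qed.

Lemma sqnorm_HE g : nice g -> sqnorm_H H g = sqnorm g.
Proof.
move=> [mg zg lg]; rewrite /sqnorm.
transitivity (\int[mu]_t fubini_F mu
    (fun z => (slice_sq g z * spectral_density H z.2)%:E) t)%E; last first.
  symmetry; apply: fubini_tonelli1; last exact: sq_density_ge0.
  exact: measurable_sq_density.
rewrite /sqnorm_H integral_mkcond; apply: eq_integral => t _.
rewrite patchE; case: ifPn => [_|].
  apply: eq_integral => xi _; congr ((_ * _)%:E).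
  by rewrite normc_fourier.
rewrite notin_setE/= in_itv/= andbT => /negP; rewrite -ltNge => t0.
rewrite /fubini_F integral0_eq// => xi _; rewrite /slice_sq/=.
rewrite (_ : (fun x => g (t, x)) = (fun=> 0)); last by apply/funext => x; rewrite zg.
by rewrite /Fsq /FC /FS !wint0 expr0n addr0 mul0r.
Qed.

Lemma nice_in_H g : nice g -> (sqnorm g < +oo)%E -> in_H H g.
Proof.
move=> ng Ng; have [mg zg lg] := ng; split.
- exact: measurable_funTS.
- by apply: aeW => t _; exact: lg.
- by rewrite sqnorm_HE.
Qed.

Lemma slice_sqB_le f g z : nice f -> nice g ->
  slice_sq (fun z => f z - g z) z <= 2 * slice_sq f z + 2 * slice_sq g z.
Proof. by move=> [_ _ lf] [_ _ lg]; apply: Fsq_B_le. Qed.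

Lemma sqnormB_le f g : nice f -> nice g ->
  (sqnorm (fun z => f z - g z)%R <= 2%:E * sqnorm f + 2%:E * sqnorm g)%E.
Proof.
move=> nf ng; have [mf _ _] := nf; have [mg _ _] := ng.
have [mfg _ _] := niceB nf ng.
rewrite /sqnorm -[X in (_ <= X + _)%E]ge0_integralZl; [|exact: measurableT|exact: measurable_sq_density|by move=> z _; exact: sq_density_ge0|by []].
rewrite -[X in (_ <= _ + X)%E]ge0_integralZl; [|exact: measurableT|exact: measurable_sq_density|by move=> z _; exact: sq_density_ge0|by []].
rewrite -ge0_integralD//; last 4 first.
- by move=> z _; rewrite mule_ge0// sq_density_ge0.
- by apply: measurable_funeM; exact: measurable_sq_density.
- by move=> z _; rewrite mule_ge0// sq_density_ge0.
- by apply: measurable_funeM; exact: measurable_sq_density.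
apply: ge0_le_integral => //.
- by move=> z _; exact: sq_density_ge0.
- exact: measurable_sq_density.
- by apply: emeasurable_funD; apply: measurable_funeM; exact: measurable_sq_density.
move=> z _; rewrite -!EFinM -EFinD lee_fin (mulrA 2) (mulrA 2 (slice_sq g z)) -mulrDl ler_wpM2r ?spectral_density_ge0//.
exact: slice_sqB_le.
Qed.

(** Outside a null set: finitely many times, where kernels are singular or indicators jump, and the
    frequency 0, where [freq_weight] takes the value 0 by the convention for powers of 0 and cannot
    serve as a bound. *)
Definition off (S : seq R) (z : R * R) : Prop := z.1 \notin S /\ z.2 != 0.

Lemma off_null (S : seq R) : exists N : set (R * R),
  [/\ measurable N, mu2 N = 0%E & forall z, ~ N z -> off S z].
Proof.
have mS : measurable ([set` S] : set R).
  by apply: countable_measurable => //; exact: finite_set_countable (finite_seq S).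
have S0 : mu [set` S] = 0%E.
  by apply: countable_lebesgue_measure0; exact: finite_set_countable (finite_seq S).
exists (([set` S] `*` setT) `|` (setT `*` [set 0])); split.
- by apply: measurableU; apply: measurableX.
- have n1 : mu2 ([set` S] `*` setT) = 0%E.
    by rewrite product_measure1E//= S0 mul0e.
  have n2 : mu2 (setT `*` [set 0]) = 0%E.
    by rewrite product_measure1E//= lebesgue_measure_set1 mule0.
  by rewrite measureU0//; exact: measurableX.
- move=> z Nz; split.
  + by apply/negP => zS; apply: Nz; left.
  + by apply/eqP => z0; apply: Nz; right.
Qed.

Lemma sqnorm_le S f (B : R * R -> R) : nice f -> measurable_fun setT B ->
  (forall z, off S z -> slice_sq f z <= B z) ->
  (sqnorm f <= \int[mu2]_z (`|B z| * spectral_density H z.2)%:E)%E.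
Proof.
move=> [mf _ _] mB fB; apply: ae_ge0_le_integral => //.
- by move=> z _; exact: sq_density_ge0.
- exact: measurable_sq_density.
- by move=> z _; rewrite lee_fin mulr_ge0 ?spectral_density_ge0.
- apply/measurable_EFinP; apply: measurable_funM; first exact: measurableT_comp.
  exact: (measurableT_comp measurable_spectral_density measurable_snd).
- have [N [mN N0 NS]] := off_null S.
  exists N; split => // z; apply: contra_notP => /NS/fB h _; rewrite lee_fin ler_wpM2r ?spectral_density_ge0//.
  by rewrite (le_trans h)// ler_norm.
Qed.

(** Dominated convergence on the frequency side. The majorant is [4 B] because
    [|a - b|^2 <= 2 |a|^2 + 2 |b|^2]. *)
Lemma sqnorm_dominated S (f_ : nat -> R * R -> R) f (B : R * R -> R) :
  (forall n, nice (f_ n)) -> nice f -> measurable_fun setT B ->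
  (\int[mu2]_z (`|B z| * spectral_density H z.2)%:E < +oo)%E ->
  (forall n z, off S z -> slice_sq (f_ n) z <= B z) ->
  (forall z, off S z -> slice_sq f z <= B z) ->
  (forall z, off S z -> slice_sq (fun z => f_ n z - f z) z @[n --> \oo] --> 0) ->
  sqnorm (fun z => f_ n z - f z)%R @[n --> \oo] --> 0%E.
Proof.
move=> nf_ nf mB iB fB_ fB cf.
have mBd : measurable_fun setT (fun z : R * R => `|B z| * spectral_density H z.2).
  apply: measurable_funM; first exact: measurableT_comp.
  exact: (measurableT_comp measurable_spectral_density measurable_snd).
have [|||||_ _] := @dominated_convergence _ _ _ mu2 setT measurableT
  (fun n z => (slice_sq (fun z => f_ n z - f z) z * spectral_density H z.2)%:E)
  (fun=> 0%E) (fun z => 4%:E * (`|B z| * spectral_density H z.2)%:E)%E.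
- by move=> n; apply: measurable_sq_density; have [] := niceB (nf_ n) nf.
- exact: measurable_cst.
- have [N [mN N0 NS]] := off_null S.
  exists N; split => // z; apply: contra_notP => /NS/cf h _; rewrite -[X in _ --> X]/(0%:E).
  apply: cvg_EFin; first exact: nearW.
  by rewrite -[X in _ --> X](mul0r (spectral_density H z.2)); apply: cvgM => //; exact: cvg_cst.
- apply: integrableZl => //; apply/integrableP; split; first exact/measurable_EFinP.
  apply: le_lt_trans iB; rewrite le_eqVlt; apply/orP; left; apply/eqP.
  apply: eq_integral => z _ /=; rewrite ger0_norm// mulr_ge0// spectral_density_ge0//.
- have [N [mN N0 NS]] := off_null S.
  exists N; split => // z; apply: contra_notP => /NS Sz n _.
  rewrite -EFinM lee_fin ger0_norm; last by rewrite -lee_fin; exact: sq_density_ge0.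
  rewrite (mulrA 4) ler_wpM2r ?spectral_density_ge0//.
  rewrite (le_trans (slice_sqB_le _ (nf_ n) nf))//.
  have := fB z Sz; have := fB_ n z Sz; have := ler_norm (B z).
  lra.
by rewrite [X in _ --> X]integral0.
Qed.

End SpectralNorm.

(** * Integrable majorants in frequency and in time *)

Section Weights.
Context {R : realType}.
Local Notation mu := (@lebesgue_measure R).
Local Notation mu2 := (mu \x mu)%E.
Variable H : R.
Hypothesis H01 : 0 < H < 1.

(* Decays fast enough for [freq_weight xi * |xi| `^ (1 - 2 * H)] to be
   integrable, both at 0 and at infinity, for every [H] in ]0, 1[. *)
Definition freq_weight (xi : R) : R := Num.min 1 (`|xi| `^ (H - 2)).

Lemma freq_weight_ge0 xi : 0 <= freq_weight xi.
Proof. by rewrite le_min ler01 powR_ge0. Qed.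

Lemma measurable_norm_powR p : measurable_fun setT (fun x : R => `|x| `^ p).
Proof.
have h : measurable_fun setT (fun x : R => `|x|) by exact: normr_measurable.
exact: (measurableT_comp (measurable_powR p) h).
Qed.

Lemma measurable_freq_weight : measurable_fun setT freq_weight.
Proof. by apply: measurable_minr => //; exact: measurable_norm_powR. Qed.

Lemma freq_weight_int : exists2 K : R, 0 <= K &
  (\int[mu]_xi (freq_weight xi * spectral_density H xi)%:E <= K%:E)%E.
Proof.
have /andP[H0 H1] := H01.
(* Near 0 the exponent [p = 1 - 2 H] of the density exceeds [-1] by itself; at infinity
   [freq_weight] lowers it to [q = - 1 - H], below [-1]. *)
pose p := 1 - 2 * H; pose q := - 1 - H.
pose h (x : R) : R := freq_weight x * `|x| `^ p.
have h0 x : 0 <= h x by rewrite mulr_ge0 ?freq_weight_ge0 ?powR_ge0.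
have mh : measurable_fun setT (fun x => (h x)%:E).
  apply/measurable_EFinP; apply: measurable_funM; first exact: measurable_freq_weight.
  exact: measurable_norm_powR.
have p1 : 0 < p + 1 by rewrite /p; lra.
have q1 : q + 1 < 0 by rewrite /q; lra.
pose A : R := (p + 1)^-1 + (- (q + 1))^-1.
have A0 : 0 <= A by rewrite addr_ge0// invr_ge0 ?oppr_ge0 ltW.
have hA : (\int[mu]_(x in `[0%R, +oo[) (h x)%:E <= A%:E)%E.
  rewrite -integral_itv_obnd_cbnd; last exact: measurable_funTS.
  have -> : `]0%R, +oo[%classic = `]0, 1] `|` `]1, +oo[ :> set R.
    apply/seteqP; split => x /=; rewrite !in_itv/= ?andbT.
      by move=> x0; case: (leP x 1) => x1; [left; rewrite x0|right].
    by move=> [/andP[]//|]; exact: lt_trans.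
  rewrite ge0_integral_setU//=; last 3 first.
  - exact: measurable_funTS.
  - by move=> x _; rewrite lee_fin.
  - rewrite disj_set2E; apply/eqP; apply/seteqP; split => x //=.
    by rewrite !in_itv/= andbT => -[/andP[_ h1] h2]; move: (le_lt_trans h1 h2); rewrite ltxx.
  rewrite /A EFinD; apply: leeD.
    have -> : (p + 1)^-1 = 1 `^ (p + 1) / (p + 1) by rewrite powR1 mul1r.
    apply: le_trans (integral_powR0_le ler01 p1).
    apply: ge0_le_integral => //.
    - by move=> x _; rewrite lee_fin.
    - exact: measurable_funTS.
    - by apply/measurable_EFinP; apply: measurable_funTS; exact: measurable_powR.
    - move=> x /=; rewrite in_itv/= => /andP[x0 x1]; rewrite lee_fin /h (gtr0_norm x0).
      by rewrite ler_piMl ?powR_ge0// /freq_weight ge_min lexx.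
  apply: le_trans (integral_powRy_le q1).
  rewrite [leRHS](_ : _ = (\int[mu]_(x in `]1%R, +oo[) (x `^ q)%:E)%E); last first.
    rewrite -integral_itv_obnd_cbnd//; apply/measurable_EFinP.
    by apply: measurable_funTS; exact: measurable_powR.
  apply: ge0_le_integral => //.
  - by move=> x _; rewrite lee_fin.
  - exact: measurable_funTS.
  - by apply/measurable_EFinP; apply: measurable_funTS; exact: measurable_powR.
  - move=> x /=; rewrite in_itv/= andbT => x1; rewrite lee_fin /h.
    have x0 : 0 < x := lt_trans ltr01 x1.
    rewrite (gtr0_norm x0) (@le_trans _ _ (x `^ (H - 2) * x `^ p))//.
      by rewrite ler_wpM2r ?powR_ge0// /freq_weight (gtr0_norm x0) ge_min lexx orbT.
    rewrite -powRD; last by rewrite (gt_eqF x0) implybT.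
    by rewrite (_ : H - 2 + p = q)// /p /q; ring.
exists (c_ H * (A + A)); first by rewrite mulr_ge0 ?c_ge0// addr_ge0.
rewrite (_ : (fun xi => _) = fun xi => ((c_ H)%:E * (h `|xi|)%:E)%E); last first.
  apply/funext => xi; rewrite -EFinM /h /spectral_density; congr EFin.
  by rewrite /freq_weight normr_id mulrCA.
rewrite ge0_integralZl//; last 3 first.
- by apply: (measurableT_comp mh); exact: normr_measurable.
- by move=> x _; rewrite lee_fin.
- by rewrite lee_fin c_ge0.
rewrite [leRHS]EFinM; apply: lee_wpmul2l; first by rewrite lee_fin c_ge0.
apply: le_trans (integral_norm_le mh _) _; first by move=> x; rewrite lee_fin.
by rewrite EFinD; exact: leeD.
Qed.

(** By Tonelli a majorant that is a product of a function of time and [freq_weight] factorizes. Norm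
    estimates thus reduce to pointwise bounds of the transform, with a constant [K] that depends
    only on [H]. *)
Lemma sqnorm_weight : exists2 K : R, 0 <= K &
  forall (tau : R -> R) (A : R), measurable_fun setT tau -> (forall s, 0 <= tau s) ->
  0 <= A -> (\int[mu]_s (tau s)%:E <= A%:E)%E ->
  (\int[mu2]_z (`|tau z.1 * freq_weight z.2| * spectral_density H z.2)%:E <= (A * K)%:E)%E.
Proof.
have [K K0 hK] := freq_weight_int; exists K => // tau A mtau tau0 A0 hA.
have md := measurable_spectral_density H.
have mf : measurable_fun setT (fun xi => (freq_weight xi * spectral_density H xi)%:E).
  by apply/measurable_EFinP; apply: measurable_funM => //; exact: measurable_freq_weight.
have f0 xi : (0 <= (freq_weight xi * spectral_density H xi)%:E)%E.
  by rewrite lee_fin mulr_ge0 ?freq_weight_ge0 ?spectral_density_ge0.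
pose F (z : R * R) : \bar R := ((tau z.1)%:E * (freq_weight z.2 * spectral_density H z.2)%:E)%E.
have F0 z : (0 <= F z)%E by apply: mule_ge0; [rewrite lee_fin|exact: f0].
have -> : (\int[mu2]_z (`|tau z.1 * freq_weight z.2| * spectral_density H z.2)%:E)%E
    = (\int[mu2]_z F z)%E.
  apply: eq_integral => z _; rewrite /F -EFinM; congr EFin.
  by rewrite (ger0_norm (mulr_ge0 (tau0 _) (freq_weight_ge0 _))) (mulrA (tau z.1)).
rewrite (_ : (\int[mu2]_z F z)%E = (\int[mu]_s fubini_F mu F s)%E); last first.
  apply: fubini_tonelli1; last exact: F0.
  apply: emeasurable_funM; first by apply/measurable_EFinP; exact: (measurableT_comp mtau measurable_fst).
  exact: (measurableT_comp mf measurable_snd).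
apply: (@le_trans _ _ (\int[mu]_s ((tau s)%:E * K%:E))%E).
  apply: ge0_le_integral => //.
  - by move=> s _; apply: integral_ge0 => xi _; exact: F0.
  - apply: measurable_fun_fubini_tonelli_F; last exact: F0.
    apply: emeasurable_funM; first by apply/measurable_EFinP; exact: (measurableT_comp mtau measurable_fst).
    exact: (measurableT_comp mf measurable_snd).
  - by apply: emeasurable_funM => //; exact/measurable_EFinP.
  - move=> s _; rewrite /fubini_F /F/= ge0_integralZl//; last by rewrite lee_fin.
    by apply: lee_wpmul2l; rewrite ?lee_fin.
rewrite ge0_integralZr//; last 2 first.
- exact/measurable_EFinP.
- by move=> s _; rewrite lee_fin.
by rewrite [leRHS]EFinM; apply: lee_wpmul2r.
Qed.

(* [time_weight] is integrable because [1 - H / 4 < 1]. *)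
Definition time_weight (a t s : R) : R :=
  if a <= s < t then (t - s) `^ (- (1 - H / 4)) else 0.

Lemma time_weight_ge0 a t s : 0 <= time_weight a t s.
Proof. by rewrite /time_weight; case: ifP => // _; rewrite powR_ge0. Qed.

Lemma measurable_time_weight a t : measurable_fun setT (time_weight a t).
Proof.
apply: measurable_fun_ifT => //.
  apply: measurable_and; first exact: measurable_fun_ler.
  exact: measurable_fun_ltr.
apply: (measurableT_comp (measurable_powR _)).
exact: measurable_funB.
Qed.

Lemma time_weight_int a t : a <= t ->
  (\int[mu]_s (time_weight a t s)%:E <= ((t - a) `^ (H / 4) / (H / 4))%:E)%E.
Proof.
move=> at_; have /andP[H0 H1] := H01.
pose p := - (1 - H / 4).
have -> : H / 4 = p + 1 by rewrite /p; ring.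
have p1 : 0 < p + 1 by rewrite /p; lra.
apply: (@le_trans _ _ (\int[mu]_(s in `]0%R, (t - a)%R]) (s `^ p)%:E)%E); last first.
  by apply: integral_powR0_le => //; rewrite subr_ge0.
rewrite [leRHS]integral_mkcond -[leRHS](integral_reflect t); last 2 first.
- apply/(measurable_restrictT _ _).1 => //.
  by apply/measurable_EFinP; apply: measurable_funTS; exact: measurable_powR.
- by move=> x; rewrite patchE; case: ifP => // _; rewrite lee_fin powR_ge0.
rewrite le_eqVlt; apply/orP; left; apply/eqP; apply: eq_integral => s _.
rewrite patchE /time_weight mem_setE in_itv/= subr_gt0 lerD2l lerN2 andbC.
by case: ifP.
Qed.

End Weights.

(** * Smooth bumps *)

Lemma expR_pow_le {R : realType} (y : R) n : 0 <= y -> y ^+ n <= n`!%:R * expR y.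
Proof.
move=> y0; case: n => [|n]; first by rewrite expr0 fact0 mul1r -expR0 ler_expR.
rewrite mulrC -ler_pdivrMr ?ltr0n ?fact_gt0//.
by rewrite (le_trans _ (expR_ge1Dxn n y0))// lerDr.
Qed.

Section SmoothClosure.
Context {R : realType} {V : normedModType R}.
Implicit Types (f g : V -> R).

(** Smoothness is obtained from a class of differentiable functions that is closed under directional
    derivatives, in place of a formula for the iterated ones. *)
Lemma smooth_class (C : (V -> R) -> Prop) :
  (forall f, C f -> forall z, differentiable f z) ->
  (forall f v, C f -> C ('D_v f)) -> forall f, C f -> smooth f.
Proof.
move=> dC DC f Cf vs z; apply: dC.
by elim: vs => //= v vs IH; exact: DC.
Qed.

Lemma smooth_lin f g c : smooth f -> smooth g -> smooth (fun z => f z + c * g z).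
Proof.
move=> sf sg vs z.
have -> : foldr (fun v (h : V -> R) => 'D_v h) (fun z => f z + c * g z) vs =
    (foldr (fun v (h : V -> R) => 'D_v h) f vs) +
    c \*: (foldr (fun v (h : V -> R) => 'D_v h) g vs).
  elim: vs => //= v vs ->; apply/funext => y.
  rewrite deriveD ?deriveZ//.
  - exact/diff_derivable/sg.
  - exact/diff_derivable/sf.
  - by apply/diff_derivable/differentiableZ/sg.
by apply: differentiableD; [exact: sf|apply: differentiableZ; exact: sg].
Qed.

Lemma C0_infty_lin f g c : C0_infty f -> C0_infty g -> C0_infty (fun z => f z + c * g z).
Proof.
move=> [sf cf] [sg cg]; split; first exact: smooth_lin.
apply: (subclosed_compact _ (compactU cf cg)); first exact: closed_closure.
rewrite -closureU; apply: closureS => z /= h.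
have [fz|fz] := eqVneq (f z) 0; last by left.
by right; apply: contra_neq h => gz; rewrite fz gz mulr0 addr0.
Qed.

Lemma C0_infty_continuous f : C0_infty f -> continuous f.
Proof. by move=> [sf _] z; apply: differentiable_continuous; exact: (sf [::] z). Qed.

End SmoothClosure.

Lemma C0_infty_half_lin (R : realType) (f g : R * R -> R) c :
  C0_infty_half f -> C0_infty_half g -> C0_infty_half (fun z => f z + c * g z).
Proof.
move=> [f' sf ->] [g' sg ->]; exists (fun z => f' z + c * g' z).
  exact: C0_infty_lin.
by apply/funext => z; case: ifP => // _; rewrite mulr0 addr0.
Qed.

Section SmoothBump.
Context {R : realType}.
Variables (a b k : R).
Hypothesis ab : a < b.
Hypothesis k0 : 0 < k.

Let q : {poly R} := ('X - a%:P) * (b%:P - 'X).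

Let qE x : q.[x] = (x - a) * (b - x).
Proof. by rewrite /q !hornerE. Qed.

Let q_gt0 x : a < x < b -> 0 < q.[x].
Proof. by move=> /andP[h1 h2]; rewrite qE mulr_gt0// subr_gt0. Qed.

(* The functions [p / q ^ j * exp (- 1 / (k q))] on ]a, b[, extended by 0; this
   class is stable by differentiation. *)
Definition bump_poly (p : {poly R}) (j : nat) (x : R) : R :=
  if a < x < b then p.[x] * q.[x]^-1 ^+ j * expR (- (k * q.[x])^-1) else 0.

(** The numerator of the derivative over [q ^ (j + 2)]: the three terms come from differentiating
    [p], the power [q ^ - j] and the exponential. *)
Let dbump (p : {poly R}) (j : nat) : {poly R} :=
  p^`() * q ^+ 2 - p * q^`() * q *+ j + k^-1 *: (p * q^`()).

(** Quadratic flatness at every point outside []a, b[], end points included, makes the derivative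
    there equal to 0. The exponential beats [q ^ - j] because [y ^ (j + 2) <= (j + 2)! exp y] at
    [y = 1 / (k q)], which leaves a factor [q ^ 2]. *)
Lemma bump_poly_flat p j x0 : ~~ (a < x0 < b) ->
  exists C : R, forall x, `|bump_poly p j x| <= C * (x - x0) ^+ 2.
Proof.
move=> x0ab.
have [M hM] : exists M : R, forall x, a <= x <= b -> `|p.[x]| <= M.
  have := @EVT_max R (fun x => `|p.[x]|) a b (ltW ab) _.
  case.
    by apply: continuous_subspaceT => x; apply: continuous_comp; [exact: continuous_horner|exact: norm_continuous].
  by move=> c _ h; exists `|p.[c]| => x xab; apply: h; rewrite in_itv.
have M0 : 0 <= M by rewrite (le_trans (normr_ge0 _) (hM a _))// lexx ltW.
exists (M * (j.+2)`!%:R * k ^+ j.+2 * (b - a) ^+ 2) => x.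
rewrite /bump_poly; case: ifPn => [xab|_]; last first.
  have kj : 0 <= k ^+ j.+2 by rewrite exprn_ge0 ?(ltW k0).
  rewrite normr0; apply: mulr_ge0 (sqr_ge0 _); apply: mulr_ge0 (sqr_ge0 _).
  by apply: mulr_ge0 kj; exact: mulr_ge0.
have qx := q_gt0 xab; have /andP[ax xb] := xab.
have r0 : 0 < (k * q.[x])^-1 by rewrite invr_gt0 mulr_gt0.
rewrite normrM (ger0_norm (expR_ge0 _)) normrM (@ger0_norm _ (q.[x]^-1 ^+ j)); last first.
  by rewrite exprn_ge0// invr_ge0 ltW.
have h1 : `|p.[x]| <= M by apply: hM; rewrite !ltW.
have h2 : q.[x]^-1 ^+ j * expR (- (k * q.[x])^-1) <= (j.+2)`!%:R * k ^+ j.+2 * q.[x] ^+ 2.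
  have h3 := expR_pow_le j.+2 (ltW r0).
  have h4 : expR (- (k * q.[x])^-1) <= (j.+2)`!%:R * (k * q.[x]) ^+ j.+2.
    rewrite expRN -div1r ler_pdivrMr ?expR_gt0// mulrAC.
    rewrite -ler_pdivrMr ?exprn_gt0 ?mulr_gt0// mul1r.
    by rewrite -exprVn.
  apply: (@le_trans _ _ (q.[x]^-1 ^+ j * ((j.+2)`!%:R * (k * q.[x]) ^+ j.+2))).
    by rewrite ler_wpM2l// exprn_ge0// invr_ge0 ltW.
  rewrite le_eqVlt; apply/orP; left; apply/eqP.
  rewrite exprMn -[in q.[x] ^+ j.+2]addn2 exprD exprVn.
  by field; rewrite expf_neq0// gt_eqF.
(* As [x0] is outside []a, b[], one of [x - a] and [b - x] is at most [|x - x0|]; the other is at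
   most [b - a]. *)
have h5 : q.[x] ^+ 2 <= (b - a) ^+ 2 * (x - x0) ^+ 2.
  rewrite -exprMn -[leRHS]real_normK ?num_real// ler_sqr ?nnegrE ?(ltW qx)//.
  rewrite normrM (ger0_norm (_ : 0 <= b - a)) ?subr_ge0 ?(ltW ab)// qE; move: x0ab; rewrite negb_and -!leNgt => /orP[h|h].
    have : x - a <= `|x - x0| by rewrite ger0_norm; lra.
    have : b - x <= b - a by lra.
    nra.
  have : b - x <= `|x - x0| by rewrite ler0_norm; lra.
  have : x - a <= b - a by lra.
  nra.
apply: (@le_trans _ _ (M * ((j.+2)`!%:R * k ^+ j.+2 * q.[x] ^+ 2))).
  rewrite -mulrA; apply: ler_pM => //; apply: mulr_ge0; rewrite ?expR_ge0//.
  by rewrite exprn_ge0// invr_ge0 ltW.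
have kj : 0 <= k ^+ j.+2 by rewrite exprn_ge0 ?(ltW k0).
rewrite -(mulrA _ ((b - a) ^+ 2)) mulrA (mulrA M); apply: ler_wpM2l => //.
by apply: mulr_ge0 kj; exact: mulr_ge0.
Qed.

Lemma is_derive_bump_poly p j x :
  is_derive x (1 : R) (bump_poly p j) (bump_poly (dbump p j) j.+2 x).
Proof.
have [xab|xab] := boolP (a < x < b); last first.
  have [C hC] := bump_poly_flat p j xab.
  rewrite {2}/bump_poly (negbTE xab).
  have Fx : bump_poly p j x = 0 by rewrite /bump_poly (negbTE xab).
  have C0 : 0 <= C.
    by have := hC (x + 1); rewrite addrAC subrr add0r expr1n mulr1; exact: le_trans.
  have cF : h^-1 *: (bump_poly p j (h *: (1 : R) + x) - bump_poly p j x) @[h --> 0^'] --> (0 : R).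
    apply/cvgr0Pnorm_lt => e e0.
    have [d d0 hd] : exists2 d : R, 0 < d & C * d < e.
      exists (e / (C + 1)); first by rewrite divr_gt0// ltr_wpDl.
      by rewrite mulrA ltr_pdivrMr ?ltr_wpDl// mulrC ltr_pM2l// ltrDl.
    near=> h.
    have h0 : h != 0 by near: h; exact: nbhs_dnbhs_neq.
    rewrite Fx subr0 normrM normfV ltr_pdivrMl ?normr_gt0//.
    apply: (le_lt_trans (hC _)).
    rewrite -[h *: 1]/(h * 1) mulr1 addrK -real_normK ?num_real//.
    rewrite expr2 mulrCA ltr_pM2l ?normr_gt0//.
    apply: le_lt_trans hd; rewrite ler_wpM2l//.
    near: h; apply: dnbhs0_le => //.
  split; first by apply/cvg_ex; exists 0.
  by rewrite /derive; apply/cvg_lim.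
pose G (y : R) := p.[y] * q.[y]^-1 ^+ j * expR (- (k * q.[y])^-1).
have FG : {near x, G =1 bump_poly p j}.
  near=> y; rewrite /bump_poly ifT//; near: y.
  have := xab; rewrite -[a < x < b]/(x \in `]a, b[) => /near_in_itvoo.
  exact.
apply: (near_eq_is_derive FG).
have qx := q_gt0 xab; have q0 : q.[x] != 0 by rewrite gt_eqF.
have k0' : k != 0 by rewrite gt_eqF.
have dp := is_derive_poly p x; have dq := is_derive_poly q x.
rewrite /bump_poly xab.
have dr : is_derive x (1 : R) (fun y => q.[y]^-1) (- q.[x] ^- 2 *: q^`().[x]).
  exact: is_deriveV.
pose v (y : R) := - (k * q.[y])^-1.
have dkr : is_derive x (1 : R) v (- k^-1 * (- q.[x] ^- 2 * q^`().[x])).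
  rewrite (_ : v = (- k^-1) \*: (fun y => q.[y]^-1)).
    exact: is_deriveZ.
  by apply/funext => y /=; rewrite /v invfM -[RHS]/(_ * _) mulNr.
have de := is_derive1_comp (is_derive_expR (v x)) dkr.
have drj : is_derive x (1 : R) (fun y => q.[y]^-1 ^+ j)
    ((j%:R * q.[x]^-1 ^+ j.-1) * (- q.[x] ^- 2 * q^`().[x])).
  have := is_deriveX j dr.
  rewrite (_ : (fun y => q.[y]^-1) ^+ j = (fun y => q.[y]^-1 ^+ j)) //.
  exact: exprfctE.
have dG := is_deriveM (is_deriveM dp drj) de.
apply: (is_derive_eq (f := G) dG).
have -> : (dbump p j).[x] =
    p^`().[x] * q.[x] ^+ 2 - p.[x] * q^`().[x] * q.[x] *+ j + k^-1 * (p.[x] * q^`().[x]).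
  rewrite /dbump; move: (q) => qq.
  by rewrite !(hornerD, hornerN, hornerM, hornerMn, hornerZ, horner_exp).
rewrite -/(v x) /= -[(horner p * _) x]/(p.[x] * q.[x]^-1 ^+ j).
set P := p.[x]; set P' := p^`().[x]; set Q' := q^`().[x]; set e := expR _.
rewrite -[LHS]/(P * q.[x]^-1 ^+ j * (e * (- k^-1 * (- q.[x] ^- 2 * Q'))) +
  e * (P * (j%:R * q.[x]^-1 ^+ j.-1 * (- q.[x] ^- 2 * Q')) + q.[x]^-1 ^+ j * P')).
clearbody P P' Q' e; clear dG drj FG G.
move: (q.[x]) q0 => y y0; rewrite -(mulr_natr (P * Q' * y)).
case: j => [|j] /=; first by rewrite !expr0 expr2 !mul0r mulr0; field; rewrite y0.
by rewrite !exprVn !exprS; field; rewrite y0 k0' expf_neq0.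
Unshelve. all: by end_near.
Qed.

Lemma bump_poly_differentiable p j x : differentiable (bump_poly p j) x.
Proof. by apply/derivable1_diffP; case: (is_derive_bump_poly p j x). Qed.

Lemma derive_bump_poly p j v x :
  'D_v (bump_poly p j) x = bump_poly (v *: dbump p j) j.+2 x.
Proof.
rewrite deriveE; last exact: bump_poly_differentiable.
rewrite -[v in LHS]mulr1 -[v * 1]/(v *: (1 : R)) linearZ /=.
rewrite -deriveE; last exact: bump_poly_differentiable.
have := is_derive_bump_poly p j x => ?; rewrite derive_val.
rewrite /bump_poly; case: ifP => _; last exact: mulr0.
by rewrite -[LHS]/(_ * _) hornerZ !mulrA.
Qed.

(** The parameter [k] sharpens the bump: as it grows, the exponent tends to 0 inside []a, b[] and
    the values tend to the indicator of this open interval. *)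
Definition bump (x : R) : R :=
  if a < x < b then expR (- (k * ((x - a) * (b - x)))^-1) else 0.

Lemma bumpE : bump = bump_poly 1 0.
Proof.
apply/funext => x; rewrite /bump /bump_poly; case: ifP => // _.
by rewrite hornerC expr0 !mul1r qE.
Qed.

Definition bump_class (f : R -> R) : Prop := exists p j, f = bump_poly p j.

Lemma bump_classP : bump_class bump.
Proof. by exists 1, 0; exact: bumpE. Qed.

Lemma bump_class_differentiable f : bump_class f -> forall x, differentiable f x.
Proof. by move=> [p [j ->]] x; exact: bump_poly_differentiable. Qed.

Lemma bump_class_derive f v : bump_class f -> bump_class ('D_v f).
Proof.
move=> [p [j ->]]; exists (v *: dbump p j), j.+2.
by apply/funext => x; exact: derive_bump_poly.
Qed.

Lemma bump_class_support f : bump_class f -> [set x | f x != 0] `<=` `[a, b].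
Proof.
move=> [p [j ->]] x /=; rewrite /bump_poly in_itv/=; case: ifP; last by rewrite eqxx.
by move=> /andP[h1 h2] _; rewrite !ltW.
Qed.

Lemma bump_C0_infty : C0_infty bump.
Proof.
split.
  apply: (smooth_class (C := bump_class)) bump_classP.
  - exact: bump_class_differentiable.
  - by move=> f v; exact: bump_class_derive.
apply: (subclosed_compact _ (@segment_compact R a b)); first exact: closed_closure.
rewrite [X in _ `<=` X](closure_id _).1; last exact: interval_closed.
exact: closureS (bump_class_support bump_classP).
Qed.

Lemma bump_ge0 x : 0 <= bump x.
Proof. by rewrite /bump; case: ifP => // _; rewrite expR_ge0. Qed.

Lemma bump_le1 x : bump x <= 1.
Proof.
rewrite /bump; case: ifP => // /andP[h1 h2]; rewrite -expR0 ler_expR oppr_le0 invr_ge0.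
by rewrite mulr_ge0 ?(ltW k0)// mulr_ge0// subr_ge0 ltW.
Qed.

End SmoothBump.

(** * Smooth bumps in time and space *)

Section TensorBump.
Context {R : realType}.

(** Sums are included because the Leibniz rule turns one product into two. *)
Inductive tensor_class (C D : (R -> R) -> Prop) : (R * R -> R) -> Prop :=
| tensor_mul g h : C g -> D h -> tensor_class C D (fun z => g z.1 * h z.2)
| tensor_add f g : tensor_class C D f -> tensor_class C D g ->
    tensor_class C D (fun z => f z + g z).

Lemma differentiable_fst_comp (g : R -> R) (z : R * R) : differentiable g z.1 ->
  differentiable (fun z : R * R => g z.1) z /\ forall v, 'D_v (fun z : R * R => g z.1) z = 'D_(v.1) g z.1.
Proof.
move=> dg.
have dfst : differentiable (fst : R * R -> R) z.
  by apply: linear_differentiable => w; exact: cvg_fst.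
have d : differentiable (g \o fst) z by exact: differentiable_comp.
split => // v; rewrite !deriveE// diff_comp//=.
Qed.

Lemma differentiable_snd_comp (g : R -> R) (z : R * R) : differentiable g z.2 ->
  differentiable (fun z : R * R => g z.2) z /\ forall v, 'D_v (fun z : R * R => g z.2) z = 'D_(v.2) g z.2.
Proof.
move=> dg.
have dsnd : differentiable (snd : R * R -> R) z.
  by apply: linear_differentiable => w; exact: cvg_snd.
have d : differentiable (g \o snd) z by exact: differentiable_comp.
by split => // v; rewrite !deriveE// diff_comp//=.
Qed.

Lemma tensor_class_diff (C D : (R -> R) -> Prop) f :
  (forall g, C g -> forall x, differentiable g x) ->
  (forall g, D g -> forall x, differentiable g x) ->
  (forall g v, C g -> C ('D_v g)) -> (forall g v, D g -> D ('D_v g)) ->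
  tensor_class C D f ->
  (forall z, differentiable f z) /\ (forall v, tensor_class C D ('D_v f)).
Proof.
move=> dC dD DC DD; elim => {f} [g h Cg Dh|f g _ [df Df] _ [dg Dg]].
  have dg z := differentiable_fst_comp (dC g Cg z.1).
  have dh z := differentiable_snd_comp (dD h Dh z.2).
  have dg1 z := (dg z).1; have dh1 z := (dh z).1.
  split => [z|v]; first exact: differentiableM.
  rewrite (_ : 'D_v _ = fun z => g z.1 * 'D_(v.2) h z.2 + 'D_(v.1) g z.1 * h z.2).
    exact: (tensor_add (tensor_mul Cg (DD _ v.2 Dh)) (tensor_mul (DC _ v.1 Cg) Dh)).
  apply/funext => z; rewrite (deriveM (diff_derivable _) (diff_derivable _))//.
  by rewrite (dg z).2 (dh z).2 -!/(_ * _) [X in _ + X]mulrC.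
split => [z|v]; first exact: differentiableD.
rewrite (_ : 'D_v _ = fun z => 'D_v f z + 'D_v g z); first exact: tensor_add.
by apply/funext => z; rewrite (deriveD (diff_derivable _) (diff_derivable _)).
Qed.

Lemma tensor_bump_C0_infty (a b k a' b' k' : R) : a < b -> 0 < k -> a' < b' -> 0 < k' ->
  C0_infty (fun z : R * R => bump a b k z.1 * bump a' b' k' z.2).
Proof.
move=> ab k0 ab' k0'; split.
  apply: (smooth_class (C := tensor_class (bump_class a b k) (bump_class a' b' k'))).
  - move=> f Cf; apply: (tensor_class_diff _ _ _ _ Cf).1.
    + exact: bump_class_differentiable.
    + exact: bump_class_differentiable.
    + by move=> g v; exact: bump_class_derive.
    + by move=> g v; exact: bump_class_derive.
  - move=> f v Cf; apply: (tensor_class_diff _ _ _ _ Cf).2.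
    + exact: bump_class_differentiable.
    + exact: bump_class_differentiable.
    + by move=> g w; exact: bump_class_derive.
    + by move=> g w; exact: bump_class_derive.
  - by apply: tensor_mul; exact: bump_classP.
apply: (subclosed_compact _ (compact_setX (@segment_compact R a b) (@segment_compact R a' b'))).
  exact: closed_closure.
rewrite [X in _ `<=` X](closure_id _).1; last first.
  apply: compact_closed; first exact: norm_hausdorff.
  by apply: compact_setX; exact: segment_compact.
apply: closureS => z /= h; split.
  apply: (bump_class_support (bump_classP a b k)) => /=.
  by apply: contra_neq h => ->; rewrite mul0r.
apply: (bump_class_support (bump_classP a' b' k')) => /=.
by apply: contra_neq h => ->; rewrite mulr0.
Qed.

End TensorBump.

(** * Centered Gaussian variables *)

Section SecondMoment.
Context {R : realType} {d : measure_display} {Omega : measurableType d}.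
Variable P : probability Omega R.
Implicit Types U V X : Omega -> R.

Definition E2 U : \bar R := (\int[P]_w ((U w) ^+ 2)%:E)%E.

Lemma measurable_sqE U : measurable_fun setT U -> measurable_fun setT (fun w => (U w ^+ 2)%:E).
Proof. by move=> mU; apply/measurable_EFinP; exact: measurable_funX. Qed.

Lemma E2_ge0 U : (0 <= E2 U)%E.
Proof. by apply: integral_ge0 => w _; rewrite lee_fin sqr_ge0. Qed.

Lemma E2D_le U V : measurable_fun setT U -> measurable_fun setT V ->
  (E2 (fun w => U w + V w)%R <= 2%:E * E2 U + 2%:E * E2 V)%E.
Proof.
move=> mU mV; rewrite /E2.
rewrite -[X in (_ <= X + _)%E]ge0_integralZl; [|exact: measurableT|exact: measurable_sqE|by move=> w _; rewrite lee_fin sqr_ge0|by []].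
rewrite -[X in (_ <= _ + X)%E]ge0_integralZl; [|exact: measurableT|exact: measurable_sqE|by move=> w _; rewrite lee_fin sqr_ge0|by []].
rewrite -ge0_integralD; [|exact: measurableT|by move=> w _; rewrite mule_ge0// lee_fin sqr_ge0| |by move=> w _; rewrite mule_ge0// lee_fin sqr_ge0|].
- apply: ge0_le_integral => //.
  + by move=> w _; rewrite lee_fin sqr_ge0.
  + by apply: measurable_sqE; exact: measurable_funD.
  + by apply: emeasurable_funD; apply: measurable_funeM; exact: measurable_sqE.
  + move=> w _; rewrite -!EFinM -EFinD lee_fin; have := sqr_ge0 (U w - V w); nra.
- by apply: measurable_funeM; exact: measurable_sqE.
- by apply: measurable_funeM; exact: measurable_sqE.
Qed.

Lemma E2N U : E2 (fun w => - U w) = E2 U.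
Proof. by apply: eq_integral => w _; rewrite sqrrN. Qed.

Lemma E2B_sym U V : E2 (fun w => U w - V w) = E2 (fun w => V w - U w).
Proof. by rewrite -E2N; apply: eq_integral => w _; rewrite opprB. Qed.

Lemma E2_triangle U V X : measurable_fun setT U -> measurable_fun setT V -> measurable_fun setT X ->
  (E2 (fun w => U w - X w)%R <=
    2%:E * E2 (fun w => U w - V w)%R + 2%:E * E2 (fun w => V w - X w)%R)%E.
Proof.
move=> mU mV mX.
rewrite (_ : (fun w => U w - X w) = fun w => (U w - V w) + (V w - X w)).
  by apply: E2D_le; exact: measurable_funB.
by apply/funext => w; ring.
Qed.

Lemma measurable_gt_norm U (e : R) : measurable_fun setT U -> measurable [set w | e < `|U w|].
Proof.
move=> mU; rewrite -[X in measurable X]setTI.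
rewrite (_ : [set _ | _] = (fun w => `|U w|) @^-1` `]e, +oo[); last first.
  by apply/seteqP; split => w /=; rewrite in_itv/= andbT.
by apply: (measurableT_comp (@normr_measurable R setT) mU).
Qed.

Lemma chebyshev_E2 U (e : R) : measurable_fun setT U -> 0 < e ->
  (P [set w | (e < `|U w|)%R] <= (e ^- 2)%:E * E2 U)%E.
Proof.
move=> mU e0; have mA := measurable_gt_norm e mU.
rewrite /E2 -ge0_integralZl//; last 3 first.
- exact: measurable_sqE.
- by move=> w _; rewrite lee_fin sqr_ge0.
- by rewrite lee_fin invr_ge0 sqr_ge0.
rewrite -(setIT [set w | _]) -integral_indic//; apply: ge0_le_integral => //.
- by apply/measurable_EFinP; exact: measurable_indic.
- by apply: measurable_funeM; exact: measurable_sqE.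
move=> w _; rewrite -EFinM lee_fin indicE; case: (boolP (w \in _)) => [|_].
  rewrite inE/= => h; rewrite mulrC ler_pdivlMr ?exprn_gt0// mul1r.
  by rewrite -[leRHS]real_normK ?num_real// ler_sqr ?nnegrE ?(ltW e0)// ltW.
by rewrite mulr_ge0// ?sqr_ge0// invr_ge0 sqr_ge0.
Qed.

Lemma E2_eq0 U : measurable_fun setT U -> E2 U = 0%E -> {ae P, forall w, U w = 0}.
Proof.
move=> mU E0.
have h : (\int[P]_w `|(U w ^+ 2)%:E| = 0)%E.
  by rewrite -E0; apply: eq_integral => w _; rewrite gee0_abs// lee_fin sqr_ge0.
have := (ae_eq_integral_abs P measurableT (measurable_sqE mU)).1 h.
apply: filterS => w /(_ I) /= [/eqP]; rewrite sqrf_eq0 => /eqP//.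
Qed.

End SecondMoment.

(** * Laws of limits in probability *)

Section LawConvergence.
Context {R : realType}.

Lemma law_unique (m1 m2 : {measure set R -> \bar R}) : (m1 setT < +oo)%E -> (m2 setT < +oo)%E ->
  (forall a : R, m1 `]-oo, a]%classic = m2 `]-oo, a]%classic) -> forall A, measurable A -> m1 A = m2 A.
Proof.
move=> m1T m2T m12; pose g k : set R := `]- k%:R, k%:R]%classic.
apply: (@measure_unique _ R _ (@ocitv R) g) => //.
- move=> A B [[a b] _ <-] [[a' b'] _ <-].
  exists (Num.max a a', Num.min b b') => //=.
  apply/seteqP; split => x /=; rewrite !in_itv/= gt_max le_min.
    by move=> /andP[/andP[-> ->] /andP[-> ->]].
  by move=> [/andP[-> ->] /andP[-> ->]].
- by move=> k; exact: is_ocitv.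
- apply/seteqP; split => // x _.
  exists (Num.truncn `|x|).+1 => //; rewrite /g /= in_itv/=.
  have h : `|x| < (Num.truncn `|x|).+1%:R by exact: truncnS_gt.
  by move: (ltW h); rewrite ler_norml => /andP[_ ->]; move: h; rewrite ltr_norml => /andP[->].
- move=> A [[a b] _ <-] /=.
  have [ab|ab] := leP a b; last by rewrite set_itv_ge ?measure0// bnd_simp -leNgt ltW.
  have -> : `]a, b]%classic = `]-oo, b]%classic `\` `]-oo, a]%classic.
    apply/seteqP; split => x /=; rewrite !in_itv/=.
      by move=> /andP[h ->]; split => //; apply/negP; rewrite -ltNge.
    by move=> [-> /negP]; rewrite -ltNge => ->.
  have sub : `]-oo, a]%classic `<=` (`]-oo, b]%classic : set R) by exact: subset_itvl.
  have fin (m : {measure set R -> \bar R}) B : (m setT < +oo)%E -> measurable B -> (m B < +oo)%E.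
    by move=> mT mB; apply: le_lt_trans mT; apply: le_measure; rewrite ?inE.
  rewrite !measureD; try exact: measurable_itv; try (apply: fin => //; exact: measurable_itv).
  by congr (_ - _)%E; [exact: m12|rewrite (setIidr sub); exact: m12].
- by move=> k; apply: le_lt_trans m1T; apply: le_measure; rewrite ?inE//; exact: measurable_itv.
Qed.

End LawConvergence.

Section LimitsInLaw.
Context {R : realType}.

Lemma cvg_ereal_le (a b : \bar R) (e : nat -> \bar R) : b \is a fin_num ->
  e n @[n --> \oo] --> 0%E -> (forall n, a <= b + e n)%E -> (a <= b)%E.
Proof.
move=> bf e0 h.
have cb : (b + e n)%E @[n --> \oo] --> b.
  rewrite -[X in _ --> X]adde0; apply: cvgeD => //; last exact: cvg_cst.
  by rewrite fin_num_adde_defr.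
rewrite -(cvg_lim _ cb)//; apply: lime_ge; last exact: nearW.
by apply/cvg_ex; exists b.
Qed.

Section TwoSpaces.
Context {d1 d2 : measure_display} {O1 : measurableType d1} {O2 : measurableType d2}.
Variables (P : probability O1 R) (Q : probability O2 R).

Let measurable_le_preimage {d} {O : measurableType d} (U : O -> R) a :
  measurable_fun setT U -> measurable [set w | U w <= a].
Proof.
move=> mU; rewrite -[X in measurable X]setTI.
rewrite (_ : [set _ | _] = U @^-1` `]-oo, a]%classic); first exact: mU.
by apply/seteqP; split => w /=; rewrite in_itv.
Qed.

(** Passing from [X0] to [X n], and from [Y n] to [Y0], costs each time a shift [e] and a
    probability that tends to 0. The total shift [e + e] is removed afterwards by right continuity
    of the distribution function. *)
Lemma cdf_le_limit (X : nat -> O1 -> R) (X0 : O1 -> R) (Y : nat -> O2 -> R) (Y0 : O2 -> R) (a e : R) :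
  0 < e ->
  (forall n, measurable_fun setT (X n)) -> measurable_fun setT X0 ->
  (forall n, measurable_fun setT (Y n)) -> measurable_fun setT Y0 ->
  (forall n B, measurable B -> P (X n @^-1` B) = Q (Y n @^-1` B)) ->
  P [set w | e < `|X n w - X0 w|] @[n --> \oo] --> 0%E ->
  Q [set w | e < `|Y n w - Y0 w|] @[n --> \oo] --> 0%E ->
  (P [set w | (X0 w <= a)%R] <= Q [set w | (Y0 w <= a + (e + e))%R])%E.
Proof.
move=> e0 mX mX0 mY mY0 XY cX cY.
pose A n := [set w | e < `|X n w - X0 w|].
pose B n := [set w | e < `|Y n w - Y0 w|].
have mA n : measurable (A n) by apply: measurable_gt_norm; exact: measurable_funB.
have mB n : measurable (B n) by apply: measurable_gt_norm; exact: measurable_funB.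
apply: (@cvg_ereal_le _ _ (fun n => Q (B n) + P (A n))%E).
- by apply: fin_num_measure; exact: measurable_le_preimage.
- by rewrite -[X in _ --> X](adde0 0%E); apply: cvgeD.
move=> n; rewrite addeA.
have h1 : (P [set w | (X0 w <= a)%R] <= P [set w | (X n w <= a + e)%R] + P (A n))%E.
  apply: (@le_trans _ _ (P ([set w | (X n w <= a + e)%R] `|` A n))); last first.
    by apply: measureU2 => //; exact: measurable_le_preimage.
  apply: le_measure; rewrite ?inE; [exact: measurable_le_preimage| |].
    by apply: measurableU => //; exact: measurable_le_preimage.
  move=> w /= Xa; have [h|h] := leP (`|X n w - X0 w|) e; last by right.
  by left; move: h; rewrite ler_norml => /andP[_ h]; lra.
have h2 : (Q [set w | (Y n w <= a + e)%R] <= Q [set w | (Y0 w <= a + (e + e))%R] + Q (B n))%E.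
  apply: (@le_trans _ _ (Q ([set w | (Y0 w <= a + (e + e))%R] `|` B n))); last first.
    by apply: measureU2 => //; exact: measurable_le_preimage.
  apply: le_measure; rewrite ?inE; [exact: measurable_le_preimage| |].
    by apply: measurableU => //; exact: measurable_le_preimage.
  move=> w /= Ya; have [h|h] := leP (`|Y n w - Y0 w|) e; last by right.
  by left; move: h; rewrite ler_norml => /andP[h _]; lra.
apply: (le_trans h1); apply: leeD => //.
have -> : [set w | (X n w <= a + e)%R] = X n @^-1` `]-oo, (a + e)%R]%classic.
  by apply/seteqP; split => w /=; rewrite in_itv.
rewrite XY; last exact: measurable_itv.
by rewrite (_ : _ @^-1` _ = [set w | (Y n w <= a + e)%R]).
Qed.

Lemma cdf_right_limit (Y : O2 -> R) a (c : \bar R) : measurable_fun setT Y ->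
  (forall e : R, 0 < e -> (c <= Q [set w | (Y w <= a + (e + e))%R])%E) ->
  (c <= Q [set w | (Y w <= a)%R])%E.
Proof.
move=> mY h.
pose e n : R := n.+1%:R^-1.
pose F n := [set w | Y w <= a + (e n + e n)].
have -> : [set w | Y w <= a] = \bigcap_n F n.
  apply/seteqP; split => w /=.
    by move=> Ya n _; rewrite /F/= (le_trans Ya)// lerDl addr_ge0// invr_ge0.
  move=> FY; apply/ler_addgt0Pr => r r0.
  have [n hn] : exists n, e n <= r / 2.
    exists (Num.truncn (2 / r)); rewrite /e invf_ple ?posrE// ?divr_gt0//.
    by rewrite invf_div ltW// truncnS_gt.
  by have := FY n I; rewrite /F/= => h1; lra.
have cF : Q (F n) @[n --> \oo] --> Q (\bigcap_n F n).
  apply: nonincreasing_cvg_mu.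
  - by rewrite (le_lt_trans (probability_le1 _ _)) ?ltry//; exact: measurable_le_preimage.
  - by move=> n; exact: measurable_le_preimage.
  - by apply: bigcapT_measurable => n; exact: measurable_le_preimage.
  - move=> m n mn; apply/subsetPset => w; rewrite /F/= => hw.
    have : e n <= e m by rewrite /e lef_pV2 ?posrE// ler_nat.
    lra.
rewrite -(cvg_lim _ cF)//; apply: lime_ge; first by apply/cvg_ex; eexists; exact: cF.
by apply: nearW => n; apply: h; rewrite /e invr_gt0.
Qed.

End TwoSpaces.

(** The two sequences live on different spaces and share only their laws. With multiples of a
    standard Gaussian as [Y n], this identifies the law of a limit of Gaussian variables through
    distribution functions alone. *)
Lemma cvg_same_law {d1 d2 : measure_display} {O1 : measurableType d1} {O2 : measurableType d2}
    (P : probability O1 R) (Q : probability O2 R)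
    (X : nat -> O1 -> R) (X0 : O1 -> R) (Y : nat -> O2 -> R) (Y0 : O2 -> R) :
  (forall n, measurable_fun setT (X n)) -> measurable_fun setT X0 ->
  (forall n, measurable_fun setT (Y n)) -> measurable_fun setT Y0 ->
  (forall n B, measurable B -> P (X n @^-1` B) = Q (Y n @^-1` B)) ->
  (forall e : R, 0 < e -> P [set w | e < `|X n w - X0 w|] @[n --> \oo] --> 0%E) ->
  (forall e : R, 0 < e -> Q [set w | e < `|Y n w - Y0 w|] @[n --> \oo] --> 0%E) ->
  forall B, measurable B -> P (X0 @^-1` B) = Q (Y0 @^-1` B).
Proof.
move=> mX mX0 mY mY0 XY cX cY.
have E a : P (X0 @^-1` `]-oo, a]%classic) = Q (Y0 @^-1` `]-oo, a]%classic).
  have -> : X0 @^-1` `]-oo, a]%classic = [set w | X0 w <= a].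
    by apply/seteqP; split => w /=; rewrite in_itv.
  have -> : Y0 @^-1` `]-oo, a]%classic = [set w | Y0 w <= a].
    by apply/seteqP; split => w /=; rewrite in_itv.
  apply/eqP; rewrite eq_le; apply/andP; split; apply: cdf_right_limit => // e e0.
    by apply: (cdf_le_limit (X := X) (Y := Y)) => //; [exact: cX|exact: cY].
  apply: (cdf_le_limit (X := Y) (Y := X)) => //; [|exact: cY|exact: cX].
  by move=> n B mB; rewrite XY.
move=> B mB.
pose X0' : {mfun O1 >-> R} := mfun_Sub (mem_set mX0).
pose Y0' : {mfun O2 >-> R} := mfun_Sub (mem_set mY0).
have T1 : (distribution P X0' setT < +oo)%E by rewrite probability_setT ltry.
have T2 : (distribution Q Y0' setT < +oo)%E by rewrite probability_setT ltry.
exact: (law_unique T1 T2 E mB).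
Qed.

End LimitsInLaw.

Lemma cvge0_lt (R : realType) (u : nat -> \bar R) (e : R) : u n @[n --> \oo] --> 0%E ->
  0 < e -> exists N, forall n, (N <= n)%N -> (u n < e%:E)%E.
Proof.
move=> cu e0; have h : nbhs (0%E : \bar R) [set x | (x < e%:E)%E].
  by apply: open_ereal_lt'; rewrite lte_fin.
by have [N _ hN] := cu _ h; exists N => n Nn; exact: hN.
Qed.

Lemma ge0_cvge0_le (R : realType) (u v : nat -> \bar R) : (forall n, 0 <= u n)%E ->
  (forall n, u n <= v n)%E -> v n @[n --> \oo] --> 0%E -> u n @[n --> \oo] --> 0%E.
Proof.
move=> u0 uv cv; apply: (@squeeze_cvge _ _ _ _ (fun=> 0%E) _ v) => //; last exact: cvg_cst.
by apply: nearW => n; rewrite u0 uv.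
Qed.

Lemma cvge0Ml (R : realType) (u : nat -> \bar R) (c : R) : u n @[n --> \oo] --> 0%E ->
  (c%:E * u n)%E @[n --> \oo] --> 0%E.
Proof.
by move=> cu; rewrite -[X in _ --> X](mule0 c%:E); apply: cvgeZl.
Qed.

(** * The standard normal law *)

Section StandardNormal.
Context {R : realType}.
Local Notation mu := (@lebesgue_measure R).
Local Notation gam := (@normal_prob R 0 1).

Lemma normal_pdf0E (s x : R) : s != 0 ->
  normal_pdf 0 s x = normal_peak s * expR (- x ^+ 2 / (s ^+ 2 *+ 2)).
Proof. by move=> s0; rewrite normal_pdfE// /normal_fun subr0. Qed.

Lemma normal_peakM (s t : R) : 0 < s -> normal_peak (s * t) = s^-1 * normal_peak t.
Proof.
move=> s0; rewrite /normal_peak.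
have -> : (s * t) ^+ 2 * pi *+ 2 = s ^+ 2 * (t ^+ 2 * pi *+ 2) by ring.
by rewrite sqrtrM ?sqr_ge0// sqrtr_sqr (gtr0_norm s0) invfM.
Qed.

Lemma normal_pdf_scale (s z : R) : 0 < s -> normal_pdf 0 1 z = s * normal_pdf 0 s (s * z).
Proof.
move=> s0; rewrite !normal_pdf0E ?oner_neq0 ?gt_eqF// mulrA.
rewrite -[in normal_peak s](mulr1 s) normal_peakM// mulrA divff ?gt_eqF// mul1r.
congr (_ * expR _); rewrite expr1n exprMn; field.
by rewrite gt_eqF.
Qed.

Lemma normal_prob_scale (s : R) (B : set R) : 0 < s -> measurable B ->
  normal_prob 0 s B = gam ((fun z => s * z) @^-1` B).
Proof.
move=> s0 mB; rewrite /normal_prob integral_mkcond [RHS]integral_mkcond.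
have mf : measurable_fun setT ((fun x => (normal_pdf 0 s x)%:E) \_ B).
  have h : measurable_fun B (fun x => (normal_pdf 0 s x)%:E).
    by apply: measurable_funTS; apply/measurable_EFinP; exact: measurable_normal_pdf.
  exact: (measurable_restrictT _ mB).1 h.
have f0 x : (0 <= ((fun x => (normal_pdf 0 s x)%:E) \_ B) x)%E.
  by rewrite patchE; case: ifP => // _; rewrite lee_fin normal_pdf_ge0.
transitivity (\int[mu]_z (s%:E * ((fun x => (normal_pdf 0 s x)%:E) \_ B) (s * z + 0)%R))%E; last first.
  apply: eq_integral => z _; rewrite !patchE addr0.
  have -> : (z \in (fun z => s * z) @^-1` B) = (s * z \in B) by [].
  case: ifP => _; last by rewrite mule0.
  by rewrite -EFinM -normal_pdf_scale.
rewrite ge0_integralZl//; last 2 first.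
- apply: (measurableT_comp mf); apply: measurable_funD => //; exact: measurable_funM.
- by rewrite lee_fin ltW.
by rewrite (ge0_integral_affine 0 s0 mf f0) muleA -EFinM divff ?gt_eqF// mul1e.
Qed.

(** The Radon-Nikodym derivative of the normal law agrees almost everywhere with its density, since
    both have the same integrals over measurable sets. *)
Lemma ge0_integral_normal (f : R -> R) : measurable_fun setT f -> (forall x, 0 <= f x) ->
  (\int[gam]_x (f x)%:E = \int[mu]_x (f x * normal_pdf 0 1 x)%:E)%E.
Proof.
move=> mf f0.
have dom : gam `<< mu := @normal_prob_dominates R 0 1.
rewrite -(Radon_Nikodym_SigmaFinite.change_of_variables dom)//; last exact/measurable_EFinP.
have ri := Radon_Nikodym_SigmaFinite.f_integrable dom.
apply: ae_eq_integral => //.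
- apply: emeasurable_funM; first exact/measurable_EFinP.
  exact: measurable_int ri.
- apply/measurable_EFinP; apply: measurable_funM => //; exact: measurable_normal_pdf.
- have h : ae_eq mu setT (Radon_Nikodym_SigmaFinite.f gam mu) (fun x => (normal_pdf 0 1 x)%:E).
    apply: integral_ae_eq => //.
      by apply/measurable_EFinP; exact: measurable_normal_pdf.
    by move=> E _ mE; rewrite -(Radon_Nikodym_SigmaFinite.f_integral dom).
  by apply: filterS h => x h _; rewrite h// EFinM.
Qed.

(** Half of the exponent is kept as a factor and the other half belongs to the density of variance
    2, whose total mass 1 then bounds tails and second moment. The factor [sqrt 2] is rounded up to
    2. *)
Lemma normal_pdf_le_sqrt2 (x : R) :
  normal_pdf 0 1 x <= 2 * expR (- x ^+ 2 / 4) * normal_pdf 0 (Num.sqrt 2) x.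
Proof.
have s2 : 0 < Num.sqrt 2 :> R by rewrite sqrtr_gt0.
have s22 : Num.sqrt 2 ^+ 2 = 2 :> R by rewrite sqr_sqrtr.
have -> : normal_pdf 0 1 x = Num.sqrt 2 * (expR (- x ^+ 2 / 4) * normal_pdf 0 (Num.sqrt 2) x).
  rewrite !normal_pdf0E ?oner_neq0 ?gt_eqF// s22 expr1n.
  have -> : normal_peak 1 = Num.sqrt 2 * normal_peak (Num.sqrt 2) :> R.
    by rewrite -[in X in _ = _ * X](mulr1 (Num.sqrt 2)) normal_peakM// mulrA divff ?gt_eqF// mul1r.
  have -> : expR (- x ^+ 2 / (1 *+ 2)) = expR (- x ^+ 2 / 4) * expR (- x ^+ 2 / (2 *+ 2)).
    by rewrite -expRD; congr expR; field.
  by ring.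
rewrite -mulrA ler_wpM2r//; last first.
  by rewrite leNgt; apply/negP => h; move: s22; rewrite expr2; nra.
by rewrite mulr_ge0 ?expR_ge0 ?normal_pdf_ge0.
Qed.

Lemma normal_tail (l : R) : 0 <= l -> (gam [set z | (l < `|z|)%R] <= (2 * expR (- l ^+ 2 / 4))%:E)%E.
Proof.
move=> l0.
have mA : measurable [set z : R | l < `|z|] by exact: (measurable_gt_norm l (@measurable_id _ R setT)).
have mp s : measurable_fun setT (fun x => (normal_pdf 0 s x)%:E : \bar R).
  by apply/measurable_EFinP; exact: measurable_normal_pdf.
apply: (@le_trans _ _ (\int[mu]_(x in [set z : R | (l < `|z|)%R])
    ((2 * expR (- l ^+ 2 / 4))%:E * (normal_pdf 0 (Num.sqrt 2) x)%:E))%E).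
  apply: ge0_le_integral => //.
  - by move=> x _; rewrite lee_fin normal_pdf_ge0.
  - by apply: measurable_funTS; exact: mp.
  - by apply: measurable_funTS; apply: measurable_funeM; exact: mp.
  move=> x /= lx; rewrite -EFinM lee_fin (le_trans (normal_pdf_le_sqrt2 x))//.
  rewrite ler_wpM2r ?normal_pdf_ge0// ler_wpM2l// ler_expR !mulNr lerN2 ler_pM2r//.
  by apply: ltW; rewrite -[ltRHS]real_normK ?num_real// ltr_sqr ?nnegrE.
rewrite ge0_integralZl; [|exact: mA|by apply: measurable_funTS; exact: mp
  |by move=> x _; rewrite lee_fin normal_pdf_ge0|by rewrite lee_fin mulr_ge0 ?expR_ge0].
rewrite -[leRHS]mule1; apply: lee_wpmul2l; first by rewrite lee_fin mulr_ge0 ?expR_ge0.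
rewrite -(@integral_normal_pdf R 0 (Num.sqrt 2)); apply: ge0_subset_integral => //; first exact: mp.
by move=> x _; rewrite lee_fin normal_pdf_ge0.
Qed.

(** Enters as an abstract finite positive constant that relates the scale [s] of a Gaussian variable
    to its second moment. *)
Definition normal_var : \bar R := (\int[gam]_z (z ^+ 2)%:E)%E.

Lemma normal_var_fin : (normal_var < +oo)%E.
Proof.
have msq : measurable_fun setT (fun z : R => z ^+ 2) by exact: measurable_funX.
have mp s : measurable_fun setT (fun x => normal_pdf 0 s x : R).
  exact: measurable_normal_pdf.
rewrite /normal_var ge0_integral_normal//; last by move=> x; rewrite sqr_ge0.
(* Since [y exp(- y) <= 1] at [y = x^2 / 4], the product [x^2 * 2 exp(- x^2 / 4)] is at most 8. *)
apply: (@le_lt_trans _ _ (\int[mu]_x (8%:E * (normal_pdf 0 (Num.sqrt 2) x)%:E))%E).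
  apply: ge0_le_integral => //.
  - by move=> x _; rewrite lee_fin mulr_ge0 ?sqr_ge0 ?normal_pdf_ge0.
  - by apply/measurable_EFinP; apply: measurable_funM; [exact: msq|exact: mp].
  - by apply: measurable_funeM; apply/measurable_EFinP; exact: mp.
  move=> x _; rewrite -EFinM lee_fin.
  apply: (@le_trans _ _ (x ^+ 2 * (2 * expR (- x ^+ 2 / 4) * normal_pdf 0 (Num.sqrt 2) x))).
    by rewrite ler_wpM2l ?sqr_ge0 ?normal_pdf_le_sqrt2.
  rewrite mulrA ler_wpM2r ?normal_pdf_ge0//.
  have h : x ^+ 2 / 4 * expR (- x ^+ 2 / 4) <= 1.
    rewrite mulNr expRN ler_pdivrMr ?expR_gt0// mul1r.
    by rewrite (le_trans _ (expR_ge1Dx _))// lerDr.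
  by move: h; set e := expR _ => h; lra.
rewrite ge0_integralZl//; last 2 first.
- by apply/measurable_EFinP; exact: mp.
- by move=> x _; rewrite lee_fin normal_pdf_ge0.
by rewrite integral_normal_pdf mule1 ltry.
Qed.

(** A vanishing second moment would concentrate the law on [{0}], a null set for a law dominated by
    Lebesgue measure. *)
Lemma normal_var_gt0 : (0 < normal_var)%E.
Proof.
rewrite lt_neqAle eq_sym; apply/andP; split; last first.
  by apply: integral_ge0 => z _; rewrite lee_fin sqr_ge0.
apply/eqP => v0.
have [N [mN N0 NS]] := E2_eq0 (P := gam) (@measurable_id _ R setT) v0.
have h0 : gam [set 0] = 0%E.
  have : mu.-null_set [set (0 : R)].
    by apply/measure0_null_setP => //; exact: lebesgue_measure_set1.
  by move=> /(@normal_prob_dominates R 0 1); apply.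
have : gam setT = 1%E by exact: probability_setT.
have -> : setT = N `|` [set 0] :> set R.
  apply/esym/seteqP; split => // z _; have [/= Nz|Nz] := pselect (N z); [by left|right].
  by apply: contrapT => z0; apply: Nz; apply: NS.
have -> : gam (N `|` [set 0]) = 0%E by rewrite -N0; exact: measureU0.
move=> /eqP.
by rewrite eqe eq_sym oner_eq0.
Qed.

End StandardNormal.

(** * Tails and limits of Gaussian variables *)

Section GaussianVariable.
Context {R : realType} {d : measure_display} {Omega : measurableType d}.
Variable P : probability Omega R.
Local Notation gam := (@normal_prob R 0 1).
Implicit Types X : Omega -> R.

(** [X] has the law of [s] times a standard Gaussian; this form treats the degenerate case [s = 0]
    together with the others and passes to limits in [s]. *)
Definition gauss_std X (s : R) : Prop := measurable_fun setT X /\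
  forall B : set R, measurable B -> P (X @^-1` B) = gam ((fun z => s * z) @^-1` B).

Lemma centered_gaussianP X : centered_gaussian P X <-> exists2 s : R, 0 <= s & gauss_std X s.
Proof.
have E s B : 0 <= s -> measurable B ->
    (if s == 0 then \d_(0 : R) B else normal_prob 0 s B) = gam ((fun z => s * z) @^-1` B).
  move=> s0 mB; case: eqVneq => [->|sn0]; last by apply: normal_prob_scale => //; rewrite lt_neqAle eq_sym sn0.
  rewrite diracE; case: (boolP (0 \in B)) => [/set_mem B0|/negP B0].
    rewrite (_ : _ @^-1` _ = setT); first by rewrite probability_setT.
    by apply/seteqP; split => // z _ /=; rewrite mul0r.
  rewrite (_ : _ @^-1` _ = set0) ?measure0//.
  by apply/seteqP; split => // z /=; rewrite mul0r => B0'; apply: B0; exact/mem_set.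
split.
  move=> [mX [s s0 h]]; exists s => //; split => // B mB.
  by rewrite h// E.
move=> [s s0 [mX h]]; split => //; exists s => // B mB.
by rewrite h// E.
Qed.

Lemma measurable_mulz (s : R) : measurable_fun [set: R] (fun z : R => s * z).
Proof. exact: measurable_funM. Qed.

Lemma E2_gauss_std X s : gauss_std X s -> E2 P X = ((s ^+ 2)%:E * normal_var)%E.
Proof.
move=> [mX hX].
have msq : measurable_fun setT (fun z : R => (z ^+ 2)%:E).
  by apply/measurable_EFinP; exact: measurable_funX.
transitivity (\int[pushforward P X]_z (z ^+ 2)%:E)%E.
  by rewrite ge0_integral_pushforward// => z _; rewrite lee_fin sqr_ge0.
transitivity (\int[pushforward gam (fun z : R => s * z)%R]_z (z ^+ 2)%:E)%E.
  apply: eq_measure_integral; first exact: (measurable_mulz s).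
  by move=> ms A mA _; exact: hX.
rewrite ge0_integral_pushforward//; last by move=> z _; rewrite lee_fin sqr_ge0.
rewrite /normal_var -ge0_integralZl//; last 2 first.
- by move=> z _; rewrite lee_fin sqr_ge0.
- by rewrite lee_fin sqr_ge0.
  by apply: eq_integral => z _; rewrite /= -EFinM exprMn.
exact: (measurable_mulz s).
Qed.

Lemma gaussian_E2_fin X : centered_gaussian P X -> (E2 P X < +oo)%E.
Proof.
move=> /centered_gaussianP[s s0 /E2_gauss_std ->].
by apply: lte_mul_pinfty => //; [rewrite lee_fin sqr_ge0|exact: normal_var_fin].
Qed.

Lemma gaussian_tail : exists2 c : R, 0 < c & forall X (v l : R), centered_gaussian P X ->
  (E2 P X <= v%:E)%E -> 0 < v -> 0 <= l ->
  (P [set w | (l < `|X w|)%R] <= (2 * expR (- (c * l ^+ 2 / v)))%:E)%E.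
Proof.
pose M : R := fine normal_var.
have ME : normal_var = M%:E :> \bar R.
  by rewrite /M fineK// ge0_fin_numE ?ltW ?normal_var_gt0 ?normal_var_fin.
have M0 : 0 < M by rewrite -lte_fin -ME normal_var_gt0.
(* From [s^2 M <= v], the standard tail [exp(- l^2 / (4 s^2))] is at most [exp(- M l^2 / (4 v))]. *)
exists (M / 4); first by rewrite divr_gt0.
move=> X v l /centered_gaussianP[s s0 gX] Xv v0 l0.
have mA : measurable [set z : R | l < `|z|] by exact: (measurable_gt_norm l (@measurable_id _ R setT)).
have -> : P [set w | (l < `|X w|)%R] = gam [set z | (l < `|s * z|)%R].
  exact: (gX.2 _ mA).
move: Xv; rewrite (E2_gauss_std gX) ME -EFinM lee_fin => sv.
have [->|sn0] := eqVneq s 0.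
  rewrite (_ : [set _ | _] = set0); first by rewrite measure0 lee_fin mulr_ge0 ?expR_ge0.
  by apply/seteqP; split => // z /=; rewrite mul0r normr0 ltNge l0.
have s_gt0 : 0 < s by rewrite lt_neqAle eq_sym sn0.
have -> : [set z | l < `|s * z|] = [set z | l / s < `|z|].
  by apply/seteqP; split => z /=; rewrite normrM (gtr0_norm s_gt0) ltr_pdivrMr// mulrC.
apply: (le_trans (normal_tail _)); first by rewrite divr_ge0.
rewrite lee_fin ler_wpM2l// ler_expR mulNr lerN2 expr_div_n.
have s20 : 0 < s ^+ 2 by rewrite exprn_gt0.
rewrite ler_pdivrMr// mulrAC -mulrA mulrC mulrAC.
have -> : l ^+ 2 / s ^+ 2 / 4 * v = l ^+ 2 / 4 * (v / s ^+ 2) by field; rewrite gt_eqF.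
rewrite mulrAC ler_wpM2l//; first by rewrite divr_ge0 ?sqr_ge0.
by rewrite ler_pdivlMr// mulrC.
Qed.

(** Bounded second moments bound the scales, so a subsequence of them converges to some [s]. Along
    it, [cvg_same_law] compares the variables with [s_n z] for a standard Gaussian [z], which
    converges to [s z]. *)
Lemma gaussian_limit (Xn : nat -> Omega -> R) X : (forall n, centered_gaussian P (Xn n)) ->
  measurable_fun setT X -> E2 P (fun w => Xn n w - X w) @[n --> \oo] --> 0%E ->
  centered_gaussian P X.
Proof.
move=> gXn mX cX.
have mXn n : measurable_fun setT (Xn n) by case: (gXn n).
have mD n : measurable_fun setT (fun w => Xn n w - X w) by exact: measurable_funB.
pose M : R := fine normal_var.
have ME : normal_var = M%:E :> \bar R.
  by rewrite /M fineK// ge0_fin_numE ?ltW ?normal_var_gt0 ?normal_var_fin.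
have M0 : 0 < M by rewrite -lte_fin -ME normal_var_gt0.
have /choice[s_ hs] : forall n, exists s : R, 0 <= s /\ gauss_std (Xn n) s.
  by move=> n; have [s s0 h] := (centered_gaussianP _).1 (gXn n); exists s.
have [N hN] : exists N, forall n, (N <= n)%N -> (E2 P (fun w => Xn n w - X w)%R <= 1)%E.
  by have [N hN] := cvge0_lt cX ltr01; exists N => n /hN/ltW.
have X_fin : (E2 P X < +oo)%E.
  have h : (E2 P X <= 2%:E * E2 P (fun w => X w - Xn N w)%R + 2%:E * E2 P (Xn N))%E.
    apply: le_trans (E2D_le P _ (mXn N)); last exact: measurable_funB.
    by rewrite le_eqVlt; apply/orP; left; apply/eqP; apply: eq_integral => w _; rewrite subrK.
  apply: (le_lt_trans h); rewrite E2B_sym; apply: lte_add_pinfty.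
    by apply: lte_mul_pinfty => //; apply: le_lt_trans (hN N (leqnn N)) (ltry _).
  by apply: lte_mul_pinfty => //; exact: gaussian_E2_fin.
pose K : R := fine (E2 P X).
have KE : E2 P X = K%:E by rewrite /K fineK// ge0_fin_numE// E2_ge0.
have K0 : 0 <= K by rewrite -lee_fin -KE E2_ge0.
have sK n : s_ (n + N)%N ^+ 2 <= (2 + 2 * K) / M.
  have h : (E2 P (Xn (n + N)%N) <= 2%:E * E2 P (fun w => Xn (n + N)%N w - X w)%R + 2%:E * E2 P X)%E.
    apply: le_trans (E2D_le P _ mX); last exact: mD.
    by rewrite le_eqVlt; apply/orP; left; apply/eqP; apply: eq_integral => w _; rewrite subrK.
  rewrite ler_pdivlMr// -lee_fin EFinM -ME -(E2_gauss_std (hs _).2).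
  apply: (le_trans h); rewrite KE.
  rewrite (_ : (2 + 2 * K)%:E = 2%:E + 2%:E * K%:E)%E//; apply: leeD => //.
  rewrite -[leRHS]mule1; apply: lee_wpmul2l => //; apply: hN; exact: leq_addl.
have bs : bounded_fun (fun n => s_ (n + N)%N).
  exists ((2 + 2 * K) / M + 1); split; first exact: num_real.
  move=> x hx n _ /=; apply: le_trans (ltW hx).
  have := sK n; have := (hs (n + N)%N).1 => h0 h1; rewrite ger0_norm//.
  by have := sqr_ge0 (s_ (n + N)%N - 1); nra.
have [f fi /cvg_ex[/= s cs]] := bolzano_weierstrass bs.
have s0 : 0 <= s.
  by apply: (@ler_cvg _ (fun=> 0) _ _ _ _ cs); [exact: cvg_cst|move=> n; exact: (hs _).1].
apply/centered_gaussianP; exists s => //; split => //.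
have nf n : (n <= f n)%N.
  elim: n => // n IH; apply: (leq_ltn_trans IH).
  by have := fi n.+1 n; rewrite !leEnat ltnn => /negbT; rewrite -ltnNge.
have cf : (f n + N)%N @[n --> \oo] --> \oo.
  by apply/cvgnyPge => A; near=> n; rewrite (leq_trans _ (leq_addr _ _))// (leq_trans _ (nf n))//; near: n; exact: nbhs_infty_ge.
apply: (@cvg_same_law _ _ _ _ _ P gam (fun n => Xn (f n + N)%N) X (fun n z => s_ (f n + N)%N * z) (fun z => s * z)) => //.
- by move=> n; exact: measurable_mulz.
- exact: measurable_mulz.
- by move=> n B mB; exact: (hs _).2.2.
- move=> e e0; apply: (ge0_cvge0_le (v := fun n => ((e ^- 2)%:E * E2 P (fun w => Xn (f n + N)%N w - X w)%R)%E)).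
  + by [].
  + by move=> n; apply: chebyshev_E2.
  + by apply: cvge0Ml; exact: (cvg_comp _ _ cf cX).
- move=> e e0.
  have mz n : measurable_fun setT (fun z : R => s_ (f n + N)%N * z - s * z).
    by apply: measurable_funB; exact: measurable_mulz.
  apply: (ge0_cvge0_le (v := fun n => ((e ^- 2)%:E * (((s_ (f n + N)%N - s) ^+ 2 * M)%:E))%E)).
  + by [].
  + move=> n; apply: le_trans (@chebyshev_E2 _ _ _ gam (fun z : R => s_ (f n + N)%N * z - s * z) e _ e0) _; first exact: mz.
    apply: lee_wpmul2l; first by rewrite lee_fin invr_ge0 sqr_ge0.
    rewrite EFinM -ME /normal_var -ge0_integralZl//; last 3 first.
    * by apply/measurable_EFinP; exact: measurable_funX.
    * by move=> z _; rewrite lee_fin sqr_ge0.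
    * by rewrite lee_fin sqr_ge0.
    rewrite le_eqVlt; apply/orP; left; apply/eqP; apply: eq_integral => z _.
    by rewrite -EFinM -exprMn mulrBl.
  + apply: cvge0Ml; apply: cvg_EFin; first exact: nearW.
    rewrite -[X in _ --> X](mul0r M); apply: cvgM; last exact: cvg_cst.
    rewrite -[X in _ --> X](expr0n _ 2) -[X in X ^+ 2](subrr s).
    by apply: (@cvg_comp _ _ _ _ (fun x : R => x ^+ 2) _ (nbhs (s - s))); [apply: cvgB => //; exact: cvg_cst|exact: exprn_continuous].
Unshelve. all: by end_near.
Qed.

End GaussianVariable.

(** With [e n] the remaining geometric tail, [x + e] is nonincreasing and [x - e] is nondecreasing;
    they have the same limit and enclose the sequence, which yields convergence and the error bound
    together. *)
Lemma geometric_increments (R : realType) (x : nat -> R) (N : nat) (C r : R) :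
  0 <= C -> 0 < r < 1 ->
  (forall n, (N <= n)%N -> `|x n.+1 - x n| <= C * r ^+ n) ->
  exists2 l, x n @[n --> \oo] --> l &
    forall n, (N <= n)%N -> `|x n - l| <= C * r ^+ n / (1 - r).
Proof.
move=> C0 /andP[r0 r1] hx.
have r10 : 0 < 1 - r by rewrite subr_gt0.
pose e n : R := C * r ^+ (n + N) / (1 - r).
have e0 n : 0 <= e n by rewrite divr_ge0 ?mulr_ge0 ?exprn_ge0// ltW.
have eE n : e n - e n.+1 = C * r ^+ (n + N).
  by rewrite /e addSn exprS; field; rewrite gt_eqF.
have ce : e n @[n --> \oo] --> 0.
  rewrite (_ : e = fun n => (C * r ^+ N / (1 - r)) * r ^+ n); last first.
    by apply/funext => n; rewrite /e exprD; ring.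
  rewrite -[X in _ --> X](mulr0 (C * r ^+ N / (1 - r))).
  by apply: cvgM; [exact: cvg_cst|apply: cvg_expr; rewrite gtr0_norm].
pose y n := x (n + N)%N + e n; pose z n := x (n + N)%N - e n.
have hS n : `|x (n.+1 + N)%N - x (n + N)%N| <= e n - e n.+1.
  by rewrite eE addSn; apply: hx; exact: leq_addl.
have dy : {homo y : n m / (n <= m)%N >-> m <= n}.
  apply: (@homo_leq _ _ (fun a b => b <= a)) => //.
    by move=> a b c h1 h2; exact: le_trans h2 h1.
  by move=> n; have := hS n; rewrite ler_norml /y => /andP[h1 h2]; lra.
have iz : {homo z : n m / (n <= m)%N >-> n <= m}.
  apply: (@homo_leq _ _ (fun a b => a <= b)) => //.
    by move=> a b c h1 h2; exact: le_trans h1 h2.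
  by move=> n; have := hS n; rewrite ler_norml /z => /andP[h1 h2]; lra.
have cy : cvgn y.
  apply: nonincreasing_is_cvgn => //; exists (z 0%N) => _ [n _ <-].
  by apply: (le_trans (iz 0%N n (leq0n n))); rewrite /y /z; have := e0 n; lra.
have zE : z = fun n => y n - 2 * e n by apply/funext => n; rewrite /y /z; ring.
have cz : z n @[n --> \oo] --> limn y.
  rewrite zE -(subr0 (limn y)) -[X in _ - X](mulr0 2).
  by apply: cvgB => //; apply: cvgM => //; exact: cvg_cst.
exists (limn y).
  rewrite -(cvg_shiftn N) (_ : (fun n => x (n + N)%N) = fun n => y n - e n); last first.
    by apply/funext => n; rewrite /y; ring.
  by rewrite -(subr0 (limn y)); apply: cvgB.
move=> n Nn; have h1 := nonincreasing_cvgn_ge dy cy (n - N).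
have h2 : z (n - N)%N <= limn z.
  by apply: nondecreasing_cvgn_le => //; apply/cvg_ex; exists (limn y).
move: h2; rewrite (cvg_lim _ cz)// => h2.
move: h1 h2; rewrite /y /z /e subnK// => h1 h2.
by rewrite ler_norml; apply/andP; split; lra.
Qed.

(** * Almost sure limits and completeness in mean square *)

Section AlmostSure.
Context {R : realType} {d : measure_display} {Omega : measurableType d}.
Variable P : probability Omega R.

Lemma borel_cantelli (A : nat -> set Omega) (C r : R) :
  (forall n, measurable (A n)) -> 0 <= C -> 0 < r < 1 ->
  (forall n, P (A n) <= (C * r ^+ n)%:E)%E -> P (lim_sup_set A) = 0%E.
Proof.
move=> mA C0 /andP[r0 r1] hA; apply: lim_sup_set_cvg0 => //.
have r10 : 0 < 1 - r by rewrite subr_gt0.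
apply: (@le_lt_trans _ _ (C / (1 - r))%:E); last exact: ltry.
apply: lime_le; first by apply: is_cvg_nneseries => n _ _; exact: measure_ge0.
apply: nearW => n; apply: (@le_trans _ _ (C / (1 - r) * (1 - r ^+ n))%:E).
  elim: n => [|n IH]; first by rewrite big_nil expr0 subrr mulr0.
  rewrite big_nat_recr//=; apply: (le_trans (leeD IH (hA n))).
  rewrite -EFinD lee_fin exprS le_eqVlt; apply/orP; left; apply/eqP; field.
  by rewrite gt_eqF.
rewrite lee_fin; apply: ler_piMr; first by rewrite divr_ge0// ltW.
by rewrite lerBlDr lerDl exprn_ge0// ltW.
Qed.

Lemma not_lim_sup_set (A : nat -> set Omega) w : ~ lim_sup_set A w ->
  exists N, forall n, (N <= n)%N -> ~ A n w.
Proof.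
move=> h; apply: contrapT => h1; apply: h => N _.
apply: contrapT => h2; apply: h1; exists N => n Nn An; apply: h2.
by exists n.
Qed.

(** An upper limit is defined everywhere, so it is measurable for whichever sigma-algebra makes the
    [X n] measurable: that of the filtration, or that of a product space. *)
Definition lim_version (X : nat -> Omega -> R) (w : Omega) : R :=
  fine (limn_esup (fun n => (X n w)%:E)).

Lemma limn_einf_le (u : nat -> \bar R) (c : \bar R) : (forall n, u n <= c)%E -> (limn_einf u <= c)%E.
Proof.
move=> uc; rewrite limn_einf_lim; apply: lime_le; first exact: is_cvg_einfs.
by apply: nearW => n; apply: le_trans (uc n); apply: ereal_inf_lbound; exists n => /=.
Qed.

Lemma lim_versionE (X : nat -> Omega -> R) w l : X n w @[n --> \oo] --> l ->
  lim_version X w = l.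
Proof.
move=> cX; have c : (X n w)%:E @[n --> \oo] --> l%:E by apply: cvg_EFin => //; exact: nearW.
rewrite /lim_version is_cvg_limn_esupE; last by apply/cvg_ex; exists l%:E.
by rewrite (cvg_lim _ c).
Qed.

Lemma measurable_lim_version (X : nat -> Omega -> R) : (forall n, measurable_fun setT (X n)) ->
  measurable_fun setT (lim_version X).
Proof.
move=> mX; rewrite /lim_version.
apply: (measurableT_comp (@fine_measurable R setT measurableT)).
by apply: measurable_fun_limn_esup => n; apply/measurable_EFinP.
Qed.

(** Chebyshev at threshold [2 ^ - n] gives probabilities at most [4 ^ n * 8 ^ - n = 2 ^ - n], so
    Borel-Cantelli yields almost sure convergence; Fatou then transfers the Cauchy bound to the
    limit. *)
Lemma E2_complete (X : nat -> Omega -> R) : (forall n, measurable_fun setT (X n)) ->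
  (forall n, E2 P (fun w => X n.+1 w - X n w)%R <= ((8^-1) ^+ n)%:E)%E ->
  E2 P (fun w => X n w - lim_version X w) @[n --> \oo] --> 0%E.
Proof.
move=> mX hX.
have mD n m : measurable_fun setT (fun w => X n w - X m w) by exact: measurable_funB.
have mL := measurable_lim_version mX.
pose A n := [set w | (2^-1) ^+ n < `|X n.+1 w - X n w|].
have mA n : measurable (A n) by exact: measurable_gt_norm.
have h2 n : 0 < (2^-1 : R) ^+ n by rewrite exprn_gt0// invr_gt0.
have r2 : 0 < (2^-1 : R) < 1 by rewrite invr_gt0 invf_lt1 ?ltr1n ?ltr0n.
have PA : P (lim_sup_set A) = 0%E.
  apply: (@borel_cantelli A 1 2^-1) => // n.
  apply: (le_trans (chebyshev_E2 P (mD n.+1 n) (h2 n))).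
  apply: (le_trans (lee_wpmul2l _ (hX n))); first by rewrite lee_fin invr_ge0 sqr_ge0.
  rewrite -EFinM lee_fin mul1r (_ : (8 : R)^-1 = 2^-1 ^+ 2 * 2^-1); last by field.
  by rewrite exprMn -exprM mulnC exprM mulKf// expf_neq0// gt_eqF.
have aecvg : {ae P, forall w, X n w @[n --> \oo] --> lim_version X w}.
  exists (lim_sup_set A); split => //.
    apply: bigcapT_measurable => n; apply: bigcup_measurable => k _; exact: mA.
  move=> w /= hw; apply: contrapT => /not_lim_sup_set[N hN]; apply: hw.
  have hN' n : (N <= n)%N -> `|X n.+1 w - X n w| <= 1 * 2^-1 ^+ n.
    by move=> /hN; rewrite /A /= mul1r => /negP; rewrite -leNgt.
  have [l cl _] := @geometric_increments R (fun n => X n w) N 1 2^-1 ler01 r2 hN'.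
  by rewrite (lim_versionE cl).
(* The constant 4 is stable under the induction: [(a + b)^2 <= 2 a^2 + 2 b^2] leads to
   [2 + 2 * 4 / 8 <= 4]. *)
have hnm n m : (E2 P (fun w => X n w - X (n + m)%N w)%R <= (4 * (8^-1) ^+ n)%:E)%E.
  elim: m n => [|m IH] n.
    rewrite addn0 (_ : E2 _ _ = 0%E) ?lee_fin ?mulr_ge0 ?exprn_ge0//.
    by apply: integral0_eq => w _; rewrite subrr expr0n.
  apply: (le_trans (E2_triangle _ (mX n) (mX n.+1) (mX _))).
  have h := IH n.+1; rewrite addSnnS in h.
  apply: (@le_trans _ _ (2%:E * ((8^-1) ^+ n)%:E + 2%:E * (4 * (8^-1) ^+ n.+1)%:E)%E).
    by apply: leeD; apply: lee_wpmul2l => //; rewrite E2B_sym.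
  rewrite -!EFinM -EFinD lee_fin exprS.
  have : 0 <= (8^-1 : R) ^+ n by rewrite exprn_ge0.
  by set q := _ ^+ n => q0; lra.
have hn n : (E2 P (fun w => X n w - lim_version X w)%R <= (4 * (8^-1) ^+ n)%:E)%E.
  have -> : E2 P (fun w => X n w - lim_version X w) =
      (\int[P]_w limn_einf (fun m => ((X n w - X (n + m)%N w) ^+ 2)%:E))%E.
    apply: ae_eq_integral => //.
    - by apply/measurable_sqE/measurable_funB.
    - apply: (measurableT_comp (@oppe_measurable R setT)).
      by apply: measurable_fun_limn_esup => m; apply: (measurableT_comp (@oppe_measurable R setT)); exact: measurable_sqE.
    - apply: filterS aecvg => w cw _.
      have c : ((X n w - X (n + m)%N w) ^+ 2)%:E @[m --> \oo] --> ((X n w - lim_version X w) ^+ 2)%:E.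
        apply: cvg_EFin; first exact: nearW.
        apply: (@cvg_comp _ _ _ (fun m => X n w - X (n + m)%N w) (fun x : R => x ^+ 2) _ (nbhs (X n w - lim_version X w))).
          apply: cvgB; first exact: cvg_cst.
          rewrite (_ : (fun m => X (n + m)%N w) = fun m => X (m + n)%N w); last by apply/funext => m; rewrite addnC.
          by move: cw; rewrite -(cvg_shiftn n).
        exact: exprn_continuous.
      by rewrite is_cvg_limn_einfE; [rewrite (cvg_lim _ c)|apply/cvg_ex; eexists; exact: c].
  apply: (le_trans (fatou P _ _ _)) => //.
  - by move=> m; exact: measurable_sqE.
  - by move=> m w _; rewrite lee_fin sqr_ge0.
  - by apply: limn_einf_le => m; exact: hnm.
apply: (@ge0_cvge0_le _ _ (fun n => (4 : R)%:E * ((8^-1) ^+ n)%:E)%E).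
- by move=> n; exact: E2_ge0.
- by move=> n; rewrite -EFinM.
- apply: cvge0Ml; apply: cvg_EFin; first exact: nearW.
  by apply: cvg_expr; rewrite gtr0_norm ?invr_gt0// invf_lt1 ?ltr1n.
Qed.

End AlmostSure.

Section SubSigmaAlgebra.
Context {R : realType} {d : measure_display} {Omega : measurableType d}.

Lemma lim_version_sub (G : set (set Omega)) (X : nat -> Omega -> R) :
  (forall n, measurable_fun setT (X n : g_sigma_algebraType G -> R)) ->
  measurable_fun setT (lim_version X : g_sigma_algebraType G -> R).
Proof.
move=> mX.
exact: (@measurable_lim_version R _ (g_sigma_algebraType G : measurableType _) X mX).
Qed.

End SubSigmaAlgebra.

(** * Kolmogorov's continuity theorem *)

Section DyadicGrid.
Context {R : realType}.

Definition grid_index (n : nat) (t : R) : int := Num.floor (2 ^+ n * t).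

Definition grid (n : nat) (k : int) : R := k%:~R / 2 ^+ n.

Definition grid_floor (n : nat) (t : R) : R := grid n (grid_index n t).

Lemma gridB n k l : grid n k - grid n l = (k - l)%:~R / 2 ^+ n.
Proof. by rewrite /grid -mulrBl -intrB. Qed.

Lemma grid_floor_le n t : `|grid_floor n t - t| <= 2^-1 ^+ n.
Proof.
have h2 : 0 < 2 ^+ n :> R by rewrite exprn_gt0.
rewrite /grid_floor /grid /grid_index exprVn.
have /andP[h h'] := floor_itv (2 ^+ n * t); rewrite intrD in h'.
have -> : (Num.floor (2 ^+ n * t))%:~R / 2 ^+ n - t =
    ((Num.floor (2 ^+ n * t))%:~R - 2 ^+ n * t) / 2 ^+ n by field; rewrite gt_eqF.
rewrite normrM (gtr0_norm (_ : 0 < (2 ^+ n)^-1)) ?invr_gt0//.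
apply: ler_piMl; first by rewrite invr_ge0 ltW.
by rewrite ler_norml; apply/andP; split; lra.
Qed.

(** The displacements that occur both between the indices of close points at one level and between
    twice an index and its refinement at the next level. *)
Definition steps : seq int := [:: -1; 0; 1].

Lemma stepsP (a : int) : -1 <= a <= 1 -> a \in steps.
Proof. by move=> h; rewrite /steps !inE; lia. Qed.

Lemma grid_index_close n (t t' : R) : `|t - t'| <= 2^-1 ^+ n ->
  grid_index n t - grid_index n t' \in steps.
Proof.
have h2 : 0 < 2 ^+ n :> R by rewrite exprn_gt0.
rewrite exprVn ler_norml => /andP[h h'].
have e1 : 2 ^+ n * (2 ^+ n)^-1 = 1 :> R by rewrite divff// gt_eqF.
have k1 : 2 ^+ n * t <= 2 ^+ n * t' + 1.
  by rewrite -[X in _ + X]e1 -mulrDr ler_pM2l//; lra.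
have k2 : 2 ^+ n * t' <= 2 ^+ n * t + 1.
  by rewrite -[X in _ + X]e1 -mulrDr ler_pM2l//; lra.
have /andP[a1 a2] := floor_itv (2 ^+ n * t); rewrite intrD in a2.
have /andP[b1 b2] := floor_itv (2 ^+ n * t'); rewrite intrD in b2.
apply: stepsP; rewrite /grid_index.
set k := Num.floor _ in a1 a2 *; set l := Num.floor _ in b1 b2 *.
have c1 : (k%:~R : R) < (l + 2)%:~R by rewrite intrD; lra.
have c2 : (l%:~R : R) < (k + 2)%:~R by rewrite intrD; lra.
by rewrite !ltr_int in c1 c2; clear -c1 c2; lia.
Qed.

Lemma grid_indexS n (t : R) : grid_index n.+1 t - 2 * grid_index n t \in steps.
Proof.
apply: stepsP; rewrite /grid_index exprS -mulrA.
have /andP[a1 a2] := floor_itv (2 ^+ n * t); rewrite intrD in a2.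
have /andP[b1 b2] := floor_itv (2 * (2 ^+ n * t)); rewrite intrD in b2.
set k := Num.floor _ in a1 a2 b1 b2 *; set l := Num.floor _ in a1 a2 b1 b2 *.
have c1 : (l%:~R : R) < (2 * k + 2)%:~R by rewrite intrD intrM; lra.
have c2 : ((2 * k)%:~R : R) < (l + 1)%:~R by rewrite intrM intrD; lra.
by rewrite !ltr_int in c1 c2; clear -c1 c2; lia.
Qed.

Lemma gridS n k : grid n.+1 (2 * k) = grid n k.
Proof. by rewrite /grid exprS intrM; field; rewrite expf_neq0. Qed.

(** [B < n] gives [B + 1 <= 2 ^ n]. A box that grows with the level lets a single Borel-Cantelli
    argument cover the whole plane. *)
Lemma grid_index_le n (B : nat) (t : R) : `|t| <= B%:R -> (B < n)%N ->
  `|grid_index n t| <= 4 ^+ n.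
Proof.
rewrite ler_norml => /andP[h h'] Bn.
have B2 : B%:R + 1 <= 2 ^+ n :> R.
  by rewrite -natrX natr1 ler_nat (leq_trans Bn)// ltnW// ltn_expl.
have h2 : 1 <= 2 ^+ n :> R by rewrite exprn_ege1// ler1n.
have B0 : 0 <= B%:R :> R by [].
have k1 : 2 ^+ n * t <= 2 ^+ n * 2 ^+ n - 1 by nra.
have k2 : - (2 ^+ n * 2 ^+ n - 1) <= 2 ^+ n * t by nra.
have /andP[a1 a2] := floor_itv (2 ^+ n * t); rewrite intrD in a2.
rewrite /grid_index; set k := Num.floor _ in a1 a2 *.
have E : ((4 ^+ n : int)%:~R : R) = 2 ^+ n * 2 ^+ n.
  by rewrite rmorphXn/= -exprMn; congr (_ ^+ n); rewrite -natrM.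
have c1 : (k%:~R : R) <= (4 ^+ n : int)%:~R by rewrite E; lra.
have c2 : ((- (4 ^+ n : int))%:~R : R) < (k + 1)%:~R by rewrite intrD mulrNz E; lra.
rewrite ler_int in c1; rewrite ltr_int in c2.
by clear -c1 c2; rewrite ler_norml; apply/andP; split; lia.
Qed.

(* Level [n] of the grid covers [-2^n, 2^n]. *)
Definition small_steps (x : R -> R -> R) (r : R) (n : nat) := forall i j a b : int,
  `|i| <= 4 ^+ n -> `|j| <= 4 ^+ n -> a \in steps -> b \in steps ->
  `|x (grid n (i + a)) (grid n (j + b)) - x (grid n i) (grid n j)| <= r ^+ n.

(** On a bounded set all indices eventually fall in the box, so each refinement moves the value by
    at most [r ^ n] and the values along the grid converge uniformly there. Points at distance at
    most [2 ^ - n] have indices that differ by [steps], whence continuity of the limit. *)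
Lemma grid_limit (x : R -> R -> R) (r : R) N : 0 < r < 1 ->
  (forall n, (N <= n)%N -> small_steps x r n) ->
  exists u : R -> R -> R,
    (forall t s, x (grid_floor n t) (grid_floor n s) @[n --> \oo] --> u t s) /\
    continuous (fun z : R * R => u z.1 z.2).
Proof.
move=> r01 hN; have /andP[r0 r1] := r01.
have r10 : 0 < 1 - r by rewrite subr_gt0.
pose y n t s := x (grid_floor n t) (grid_floor n s).
have dy B n t s : `|t| <= B%:R -> `|s| <= B%:R -> (B < n)%N -> (N <= n)%N ->
    `|y n.+1 t s - y n t s| <= 1 * r ^+ n.
  move=> tB sB Bn Nn.
  have key (v : R) : `|v| <= B%:R -> `|2 * grid_index n v| <= 4 ^+ n.+1.
    move=> vB; have := grid_index_le vB Bn; rewrite exprS normrM.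
    by have := @exprn_ge0 int n 4; lia.
  have := hN n.+1 (leqW Nn) _ _ _ _ (key t tB) (key s sB) (grid_indexS n t) (grid_indexS n s).
  rewrite !gridS !(addrC (2 * _)) !subrK => h; apply: (le_trans h).
  by rewrite mul1r exprS ler_piMl ?exprn_ge0// ltW.
pose u t s : R := lim (y n t s @[n --> \oo]).
have cy B t s : `|t| <= B%:R -> `|s| <= B%:R -> y n t s @[n --> \oo] --> u t s /\
    forall n, (maxn B.+1 N <= n)%N -> `|y n t s - u t s| <= r ^+ n / (1 - r).
  move=> tB sB.
  have dy' n : (maxn B.+1 N <= n)%N -> `|y n.+1 t s - y n t s| <= 1 * r ^+ n.
    by rewrite geq_max => /andP[Bn Nn]; exact: (dy B).
  have [l cl hl] := geometric_increments ler01 r01 dy'.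
  rewrite /u (cvg_lim _ cl)//; split => // n /hl; by rewrite mul1r.
have bnd (t : R) : exists B : nat, `|t| <= B%:R.
  by exists (Num.bound `|t|); apply/ltW/archi_boundP.
exists u; split.
  move=> t s; have [B hB] := bnd (`|t| + `|s|).
  move: hB; rewrite ger0_norm ?addr_ge0// => hB.
  by apply: (cy B t s _ _).1; apply: le_trans hB; rewrite ?lerDl ?lerDr.
move=> [t s]; apply/cvgrPdist_lt => e e0 /=.
have [B hB] := bnd (`|t| + `|s| + 1).
move: hB; rewrite ger0_norm ?addr_ge0// => hB.
(* Three errors: two distances to the limit, at most [r ^ n / (1 - r)] each, and one increment
   between neighbours, at most [r ^ n]. *)
have cr : (3 / (1 - r)) * r ^+ n @[n --> \oo] --> 0.
  rewrite -[X in _ --> X](mulr0 (3 / (1 - r))).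
  by apply: cvgM; [exact: cvg_cst|apply: cvg_expr; rewrite gtr0_norm].
have : \forall n \near \oo, (3 / (1 - r)) * r ^+ n < e /\ (maxn B.+1 N <= n)%N.
  near=> n; split; last by near: n; exact: nbhs_infty_ge.
  near: n; move/cvgrPdist_lt : cr => /(_ e e0); apply: filterS => n.
  by rewrite sub0r normrN ger0_norm// mulr_ge0 ?exprn_ge0 ?divr_ge0// ltW.
move=> [n _ /(_ n (leqnn n))[ne nN]].
have nN' : (B < n)%N /\ (N <= n)%N by move: nN; rewrite geq_max => /andP.
have h2 : 0 < 2^-1 ^+ n :> R by rewrite exprn_gt0// invr_gt0.
have h2' : 2^-1 ^+ n <= 1 :> R by rewrite exprn_ile1// ?invr_ge0// invf_le1// ler1n.
exists (ball (t : R) (2^-1 ^+ n), ball (s : R) (2^-1 ^+ n)); first by split; exact: nbhsx_ballx.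
move=> [t' s'] [/= tt' ss'].
rewrite /ball/= in tt' ss'.
have tB : `|t| <= B%:R by apply: le_trans hB; have := normr_ge0 s; lra.
have sB : `|s| <= B%:R by apply: le_trans hB; have := normr_ge0 t; lra.
have tB' : `|t'| <= B%:R.
  apply: le_trans hB; have := normr_ge0 s; have := ler_normB t (t - t'); rewrite subKr; lra.
have sB' : `|s'| <= B%:R.
  apply: le_trans hB; have := normr_ge0 t; have := ler_normB s (s - s'); rewrite subKr; lra.
have [_ /(_ n nN) k1] := cy B t s tB sB.
have [_ /(_ n nN) k2] := cy B t' s' tB' sB'.
have k3 : `|y n t s - y n t' s'| <= r ^+ n.
  have := hN n nN'.2 _ _ _ _ (grid_index_le tB' nN'.1) (grid_index_le sB' nN'.1)
    (grid_index_close (ltW tt')) (grid_index_close (ltW ss')).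
  by rewrite (addrC (grid_index n t')) (addrC (grid_index n s')) !subrK.
have k4 : r ^+ n <= r ^+ n / (1 - r).
  rewrite ler_pdivlMr// ler_piMr ?exprn_ge0// 1?ltW//; lra.
apply: le_lt_trans ne.
have -> : 3 / (1 - r) * r ^+ n = 3 * (r ^+ n / (1 - r)) by ring.
move: k1 k2 k3; rewrite !ler_norml => /andP[? ?] /andP[? ?] /andP[? ?].
by apply/andP; split; lra.
Unshelve. all: by end_near.
Qed.

Lemma measurable_grid_index n (k : int) : measurable [set t : R | grid_index n t = k].
Proof.
rewrite (_ : [set t | _] = (fun t => 2 ^+ n * t) @^-1` [set` `[k%:~R, (k + 1)%:~R[]).
  have h : measurable_fun setT (fun t : R => 2 ^+ n * t) by apply: measurable_funM.
  by rewrite -[X in measurable X]setTI; apply: h.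
apply/seteqP; split => t /=; rewrite in_itv/= /grid_index.
  by move=> <-; exact: floor_itv.
by move=> h; apply/eqP; rewrite floor_eq.
Qed.

Lemma measurable_countable_pieces {d : measure_display} {O : measurableType d} (I : countType)
    (i : O -> I) (f : I -> O -> R) : (forall k, measurable [set w | i w = k]) ->
  (forall k, measurable_fun setT (f k)) -> measurable_fun setT (fun w => f (i w) w).
Proof.
move=> mi mf _ B mB; rewrite setTI.
rewrite (_ : _ @^-1` B = \bigcup_k ([set w | i w = k] `&` (f k @^-1` B))).
  apply: countable_bigcupT_measurable => [|k]; first exact: countableP.
  by apply: measurableI => //; rewrite -[X in measurable X]setTI; exact: mf.
apply/seteqP; split => [w /= h|w [k _ [/= <-]]]; last by [].
by exists (i w).
Qed.

(** Pointwise limit of the functions whose first variable is frozen on the grid; these are countably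
    many measurable pieces for the product sigma-algebra. *)
Lemma continuous2_measurable (f : R * R -> R) : continuous f -> measurable_fun setT f.
Proof.
move=> cf; pose g n (z : R * R) := f (grid_floor n z.1, z.2).
apply: (@measurable_fun_cvg _ _ _ _ (fun n => g n)) => [n|z _].
- apply: (@measurable_countable_pieces _ _ int (fun z : R * R => grid_index n z.1)
    (fun k z => f (grid n k, z.2))) => k.
    rewrite -[X in measurable X]setTI.
    rewrite (_ : [set w : R * R | _] = fst @^-1` [set t | grid_index n t = k])//.
    exact: measurable_fst (measurable_grid_index n k).
  apply: (measurableT_comp (f := fun x => f (grid n k, x)) _ measurable_snd).
  apply: continuous_measurable_fun => x.
  apply: (@continuous_comp _ _ _ (fun y : R => (grid n k, y)) f); last exact: cf.
  by move=> A [[B C] [/= hB hC] BC]; apply: filterS hC => y Cy; apply: BC; split => //=; exact: nbhs_singleton hB.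
- case: z => t s; apply: (cvg_comp (fun n => (grid_floor n t, s)) f _ (cf (t, s))).
  apply: (@cvg_pair _ _ _ _ (nbhs t) (nbhs s) _ _ _ (fun n => grid_floor n t) (fun=> s)); last exact: cvg_cst.
  apply/cvgrPdist_le => e e0.
  have cr : 2^-1 ^+ n @[n --> \oo] --> (0 : R) by apply: cvg_expr; rewrite gtr0_norm ?invr_gt0// invf_lt1 ?ltr1n.
  move/cvgrPdist_le : cr => /(_ e e0); apply: filterS => n; rewrite sub0r normrN => h.
  rewrite distrC; apply: le_trans (grid_floor_le _ _) _; apply: le_trans h; exact: ler_norm.
Qed.

End DyadicGrid.

(** * Chaining for a random field with small tails of increments *)

Section Kolmogorov.
Context {R : realType} {d : measure_display} {Omega : measurableType d}.
Variable P : probability Omega R.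

Lemma union_bound (I : eqType) (s : seq I) (A : I -> set Omega) (c : R) :
  (forall i, measurable (A i)) -> (forall i, i \in s -> P (A i) <= c%:E)%E ->
  (P (\big[setU/set0]_(i <- s) A i) <= ((size s)%:R * c)%:E)%E.
Proof.
move=> mA; elim: s => [_|i s IH h]; first by rewrite big_nil measure0 mul0r.
rewrite big_cons; apply: (@le_trans _ _ (P (A i) + P (\big[setU/set0]_(i <- s) A i)))%E.
  by apply: measureU2 => //; apply: bigsetU_measurable.
rewrite /= -natr1 mulrDl mul1r addrC EFinD; apply: leeD.
  by apply: IH => k ks; apply: h; rewrite inE ks orbT.
by apply: h; rewrite inE eqxx.
Qed.

Let ints (n : nat) : seq int := [seq (k%:Z - 4 ^+ n) | k <- iota 0 (2 * 4 ^ n).+1].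

Let ints_mem n (k : int) : `|k| <= 4 ^+ n -> k \in ints n.
Proof.
rewrite ler_norml => /andP[h h'].
have E : (4 ^+ n : int) = (4 ^ n)%N by rewrite -natrX natz.
rewrite E in h h'; have [m mE] : exists m : nat, k + 4 ^+ n = m%:Z.
  by exists (absz (k + 4 ^+ n)); rewrite gez0_abs// E -lerBlDr sub0r.
apply/mapP; exists m; last by rewrite -mE addrK.
rewrite mem_iota add0n /= ltnS; rewrite E in mE; clear E; lia.
Qed.

Let idx n : seq ((int * int) * (int * int)) :=
  [seq (p, q) | p <- [seq (i, j) | i <- ints n, j <- ints n],
                q <- [seq (a, b) | a <- steps, b <- steps]].

Let idx_steps n p : p \in idx n -> p.2.1 \in steps /\ p.2.2 \in steps.
Proof. by move=> /allpairsP[q [_ /allpairsP[[a b] [ha hb E]] ->]]; rewrite E. Qed.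

Let size_idx n : (size (idx n))%:R <= 81 * 16 ^+ n :> R.
Proof.
rewrite !size_allpairs size_map size_iota /=.
have h : ((2 * 4 ^ n).+1 <= 3 * 4 ^ n)%N.
  by rewrite ltn_pmul2r// expn_gt0.
rewrite -natrX -natrM ler_nat.
have -> : (81 * 16 ^ n = (3 * 4 ^ n) * (3 * 4 ^ n) * (3 * 3))%N.
  by rewrite (_ : 16 = 4 * 4)%N// expnMn; ring.
by rewrite leq_mul2r leq_mul ?orbT.
Qed.

Let steps_le (a : int) : a \in steps -> `|a%:~R : R| <= 1.
Proof. by rewrite /steps !inE => /or3P[] /eqP->; rewrite ?normrN ?normr0 ?normr1. Qed.

Variables (X : R -> R -> Omega -> R) (C r : R).
Hypothesis mX : forall t s, measurable_fun setT (X t s).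
Hypothesis C0 : 0 <= C.
Hypothesis r01 : 0 < r < 1.
Hypothesis X_incr : forall n t s t' s', `|t - t'| <= 2^-1 ^+ n -> `|s - s'| <= 2^-1 ^+ n ->
  (P [set w | (r ^+ n < `|X t s w - X t' s' w|)%R] <= (C * 32^-1 ^+ n)%:E)%E.

Let bad n (p : (int * int) * (int * int)) : set Omega :=
  [set w | r ^+ n < `|X (grid n (p.1.1 + p.2.1)) (grid n (p.1.2 + p.2.2)) w -
                     X (grid n p.1.1) (grid n p.1.2) w|].

Let bads n := \big[setU/set0]_(p <- idx n) bad n p.

Let mbad n p : measurable (bad n p).
Proof. by apply: measurable_gt_norm; exact: measurable_funB. Qed.

Let mbads n : measurable (bads n).
Proof. by apply: bigsetU_measurable => i _; exact: mbad. Qed.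

(** At level [n] there are at most [(3 * 4 ^ n) ^ 2] base points with 9 displacements each, so the
    rate [32 ^ - n] leaves the summable [2 ^ - n]. *)
Let Pbads n : (P (bads n) <= ((81 * C) * 2^-1 ^+ n)%:E)%E.
Proof.
apply: (@le_trans _ _ ((size (idx n))%:R * (C * 32^-1 ^+ n))%:E).
  apply: union_bound => [p|[[i j] [a b]] /idx_steps[ha hb]]; first exact: mbad.
  have h2 : 0 < (2 ^+ n)^-1 :> R by rewrite invr_gt0 exprn_gt0.
  by apply: X_incr; rewrite gridB addrC addKr exprVn normrM (gtr0_norm h2) ler_piMl ?steps_le// ltW.
rewrite lee_fin; apply: (@le_trans _ _ (81 * 16 ^+ n * (C * 32^-1 ^+ n))).
  by apply: ler_wpM2r (size_idx n); rewrite mulr_ge0// exprn_ge0// invr_ge0.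
have -> : 81 * C * 2^-1 ^+ n = 81 * 16 ^+ n * (C * 32^-1 ^+ n); last by [].
have -> : 2^-1 ^+ n = 16 ^+ n * 32^-1 ^+ n :> R by rewrite -exprMn; congr (_ ^+ n); field.
by ring.
Qed.

Let P_bad : P (lim_sup_set bads) = 0%E.
Proof.
apply: (@borel_cantelli _ _ _ P bads (81 * C) 2^-1) => //; first by rewrite mulr_ge0.
by rewrite invr_gt0 invf_lt1 ?ltr1n ?ltr0n.
Qed.

Let mbadlim : measurable (lim_sup_set bads).
Proof. by apply: bigcapT_measurable => n; apply: bigcup_measurable => k _; exact: mbads. Qed.

(** The value 0 on the exceptional event makes every path continuous, not only almost every one. *)
Let u (t s : R) (w : Omega) : R :=
  if `[< lim_sup_set bads w >] then 0
  else lim_version (fun n => X (grid_floor n t) (grid_floor n s)) w.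

Let good w : ~ lim_sup_set bads w -> exists v : R -> R -> R,
  (forall t s, X (grid_floor n t) (grid_floor n s) w @[n --> \oo] --> v t s) /\
    continuous (fun z : R * R => v z.1 z.2).
Proof.
move=> /not_lim_sup_set[N hN]; apply: (@grid_limit _ (fun t s => X t s w) r N r01) => n Nn.
move=> i j a b hi hj ha hb; rewrite leNgt; apply/negP => h; apply: (hN n Nn).
rewrite /bads -bigcup_seq; exists ((i, j), (a, b)) => //=.
by rewrite !allpairs_f// ?ints_mem.
Qed.

Let u_continuous w : continuous (fun z : R * R => u z.1 z.2 w).
Proof.
rewrite /u; case: asboolP => [_ z|/good[v [cv hv]]]; first exact: cvg_cst.
rewrite (_ : (fun z : R * R => _) = fun z => v z.1 z.2)//.
by apply/funext => z; apply: lim_versionE.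
Qed.

(** The increment bound between a point and its grid approximation, at distance at most [2 ^ - n],
    makes the values along the grid converge almost surely to [X t s] as well. *)
Let u_version t s : {ae P, forall w, u t s w = X t s w}.
Proof.
pose A n := [set w | r ^+ n < `|X (grid_floor n t) (grid_floor n s) w - X t s w|].
have mA n : measurable (A n) by apply: measurable_gt_norm; exact: measurable_funB.
have PA : P (lim_sup_set A) = 0%E.
  apply: (@borel_cantelli _ _ _ P A C 32^-1) => //.
    by rewrite invr_gt0 invf_lt1 ?ltr1n ?ltr0n.
  by move=> n; apply: X_incr; exact: grid_floor_le.
have mA' : measurable (lim_sup_set A).
  by apply: bigcapT_measurable => n; apply: bigcup_measurable => k _; exact: mA.
exists (lim_sup_set bads `|` lim_sup_set A); split; first exact: measurableU.
  by apply/eqP; rewrite eq_le measure_ge0 andbT -[leRHS]adde0 -{1}P_bad -PA; apply: measureU2.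
move=> w /= h; apply: contrapT => /not_orP[h1 /not_lim_sup_set[N hN]]; apply: h.
rewrite /u asboolF//; apply: lim_versionE; apply/cvgrPdist_le => e e0.
have cr : r ^+ n @[n --> \oo] --> 0 by apply: cvg_expr; case/andP: r01 => ? ?; rewrite gtr0_norm.
near=> n; rewrite distrC; apply: (@le_trans _ _ (r ^+ n)).
  by rewrite leNgt; apply/negP; apply: hN; near: n; exact: nbhs_infty_ge.
near: n; move/cvgrPdist_le : cr => /(_ e e0); apply: filterS => n.
by rewrite sub0r normrN; apply: le_trans; exact: ler_norm.
Unshelve. all: by end_near.
Qed.

Let measurable_grid n :
  measurable_fun setT (fun z : R * R * Omega => X (grid_floor n z.1.1) (grid_floor n z.1.2) z.2).
Proof.
apply: (@measurable_countable_pieces _ _ _ (int * int)%type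
  (fun z : R * R * Omega => (grid_index n z.1.1, grid_index n z.1.2))
  (fun k z => X (grid n k.1) (grid n k.2) z.2)) => -[k l].
  rewrite (_ : [set w | _] = ([set t | grid_index n t = k] `*` [set t | grid_index n t = l]) `*` setT).
    by apply: measurableX => //; apply: measurableX; exact: measurable_grid_index.
  by apply/seteqP; split => [[[t s] w] /= [-> ->]|[[t s] w] /= [[-> ->] _]].
exact: (measurableT_comp (mX _ _) measurable_snd).
Qed.

Let u_measurable : measurable_fun setT (fun z : R * R * Omega => u z.1.1 z.1.2 z.2).
Proof.
apply: measurable_fun_ifT => //.
- rewrite (_ : (fun z : R * R * Omega => _) = (fun w => `[< lim_sup_set bads w >]) \o snd)//.
  apply: (measurableT_comp _ measurable_snd) => //.
  by apply: (measurable_fun_bool true); rewrite setTI (_ : _ @^-1` _ = lim_sup_set bads)//; apply/seteqP; split => w /= /asboolP.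
- exact: (@measurable_lim_version _ _ (R * R * Omega)%type (fun n z => X (grid_floor n z.1.1) (grid_floor n z.1.2) z.2) measurable_grid).
Qed.

Theorem kolmogorov_continuity : exists v : R -> R -> Omega -> R,
  [/\ forall w, continuous (fun z : R * R => v z.1 z.2 w),
      measurable_fun setT (fun z : R * R * Omega => v z.1.1 z.1.2 z.2) &
      forall t s, {ae P, forall w, v t s w = X t s w}].
Proof. by exists u; split. Qed.

End Kolmogorov.

(** * The Wiener integral and adaptedness *)

Section TestFunctions.
Context {R : realType}.
Local Notation mu := (@lebesgue_measure R).
Implicit Types (phi psi : R * R -> R) (f : R -> R).

Lemma indic_L1 (D : set R) : measurable D -> (mu D < +oo)%E -> L1 (\1_D : R -> R).
Proof.
move=> mD fD; apply/integrableP; split; first exact/measurable_EFinP/measurable_indic.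
apply: le_lt_trans fD; have <- : (\int[mu]_x (\1_D x)%:E = mu D)%E by rewrite integral_indic// setIT.
by rewrite le_eqVlt; apply/orP; left; apply/eqP; apply: eq_integral => x _; rewrite /= ger0_norm// indicE.
Qed.

Lemma Rintegral_indic (D : set R) : measurable D ->
  \int[mu]_x (\1_D x : R) = fine (mu D).
Proof. by move=> mD; rewrite /Rintegral integral_indic// setIT. Qed.

Lemma mu_segment (a b : R) : a <= b -> mu `[a, b]%classic = (b - a)%:E.
Proof.
rewrite le_eqVlt => /predU1P[->|ab]; rewrite lebesgue_measure_itv/= lte_fin.
  by rewrite ltxx subrr.
by rewrite ab EFinN.
Qed.

Lemma C0_infty_box psi : C0_infty psi -> exists2 L : R, 0 < L &
  forall t x, psi (t, x) != 0 -> `|t| <= L /\ `|x| <= L.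
Proof.
move=> [_ cK]; have [M [_ hM]] := compact_bounded cK.
exists (`|M| + 1) => [|t x hz]; first by rewrite ltr_wpDl.
have : `|(t, x)| <= `|M| + 1.
  by apply: hM; [rewrite ltr_pwDr// ler_norm|exact: subset_closure].
by rewrite prod_normE /= ge_max => /andP.
Qed.

Lemma C0_infty_slice_derive psi t (x : R) : C0_infty psi ->
  is_derive x (1 : R) (fun y => psi (t, y)) ('D_((0, 1) : R * R) psi (t, x)).
Proof.
move=> [sp _].
have E : (fun h : R => h^-1 *: (((fun y => psi (t, y)) \o shift x) (h *: 1) - psi (t, x))) =
    (fun h : R => h^-1 *: ((psi \o shift (t, x)) (h *: ((0, 1) : R * R)) - psi (t, x))).
  by apply/funext => h /=; congr (_ *: (psi _ - _)); congr pair; rewrite /= scaler0 add0r.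
have dpsi : derivable psi (t, x) ((0, 1) : R * R) by apply: diff_derivable; exact: (sp [::] (t, x)).
by split; [rewrite /derivable E|rewrite /derive E].
Qed.

(** Mean value theorem along the slice: the spatial derivative is continuous, hence bounded on a
    compact box. *)
Lemma C0_infty_lipschitz psi (L L' : R) : C0_infty psi -> exists2 M : R, 0 <= M &
  forall t x y, `|t| <= L -> `|x| <= L' -> `|y| <= L' ->
    `|psi (t, x) - psi (t, y)| <= M * `|x - y|.
Proof.
move=> sp; have [smp _] := sp.
pose v : R * R := (0, 1).
have cD : continuous ('D_v psi).
  by move=> z; apply: differentiable_continuous; exact: (smp [:: v] z).
have cK : compact (`[- L, L]%classic `*` `[- L', L']%classic).
  by apply: compact_setX; exact: segment_compact.
have cI := continuous_compact (continuous_subspaceT cD) cK.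
have [M [_ hM]] := compact_bounded cI.
exists (`|M| + 1) => [|t]; first by rewrite addr_ge0.
have key x y : x <= y -> `|t| <= L -> `|x| <= L' -> `|y| <= L' ->
    `|psi (t, x) - psi (t, y)| <= (`|M| + 1) * `|x - y|.
  move=> xy tL xL yL.
  have dx u : is_derive u (1 : R) (fun y => psi (t, y)) ('D_v psi (t, u)).
    exact: C0_infty_slice_derive.
  have cw : {within `[x, y], continuous (fun y => psi (t, y))}.
    by apply: derivable_within_continuous => u _; case: (dx u).
  have [c] := MVT_segment xy (fun u _ => dx u) cw.
  rewrite in_itv/= => /andP[xc cy] E.
  rewrite distrC E normrM (distrC x) ler_wpM2r//.
  apply: hM; first by rewrite ltr_pwDr// ler_norm.
  exists (t, c) => //; split => /=; rewrite in_itv/=; first by rewrite -ler_norml.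
  move: xL yL; rewrite !ler_norml => /andP[? ?] /andP[? ?].
  by apply/andP; split; lra.
move=> x y tL xL yL; have [xy|/ltW yx] := leP x y; first exact: key.
by rewrite distrC (distrC x); exact: key.
Qed.

(** A shift by the half period [h = pi / |xi|] reverses the sign of the wave, so [4 * Fsq f xi] is
    the squared transform of [f - f(. - h)], at most [2 (A h)^2]. A Lipschitz bound in L1 thus
    replaces integration by parts. *)
Lemma Fsq_increment f (A : R) xi : L1 f -> 0 <= A ->
  (forall h, 0 <= h <= 4 -> \int[mu]_x `|f x - f (x - h)| <= A * h) ->
  1 <= `|xi| -> Fsq f xi <= 8 * A ^+ 2 / xi ^+ 2.
Proof.
move=> lf A0 hA xi1; have xi0 : 0 < `|xi| by apply: lt_le_trans xi1.
(* The crude bound [pi <= 4] keeps [h] in the range of the hypothesis and yields the constant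
   [2 * 16 / 4 = 8]. *)
pose h := pi / `|xi|.
have pi4 : pi <= 4 :> R by have := pihalf_lt2 R; lra.
have h4 : 0 <= h <= 4.
  rewrite divr_ge0 ?pi_ge0//= ler_pdivrMr//; apply: (le_trans pi4).
  by rewrite ler_peMr.
have := Fsq_shiftB 0 h xi lf.
have -> : cos (xi * (0 - h)) = -1.
  rewrite sub0r mulrN cosN /h.
  have [x0|x0] := leP 0 xi.
    by rewrite (ger0_norm x0) mulrCA divff ?mulr1 ?cospi// -normr_gt0.
  by rewrite (ltr0_norm x0) invrN mulrN mulrN cosN mulrCA divff ?mulr1 ?cospi// -normr_gt0.
move=> E.
have lB : L1 (fun x => f (x - 0) - f (x - h)).
  by apply: L1B; exact: L1_shift.
have := Fsq_le_L1 xi lB; rewrite E.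
have -> : \int[mu]_x `|f (x - 0) - f (x - h)| = \int[mu]_x `|f x - f (x - h)|.
  by apply: eq_Rintegral => x _; rewrite subr0.
have I0 : 0 <= \int[mu]_x `|f x - f (x - h)| by apply: Rintegral_ge0.
have := hA h h4; set I := \int[mu]_x _ in I0 *; move=> hI hF.
have hI2 : I ^+ 2 <= (A * h) ^+ 2 by rewrite ler_sqr ?nnegrE// mulr_ge0//; case/andP: h4.
have hh : (A * h) ^+ 2 <= A ^+ 2 * 16 / xi ^+ 2.
  rewrite exprMn -mulrA ler_wpM2l ?sqr_ge0// /h exprMn exprVn real_normK ?num_real//.
  rewrite ler_wpM2r ?invr_ge0 ?sqr_ge0//.
  by have := pi_ge0 R; nra.
have -> : 8 * A ^+ 2 / xi ^+ 2 = (A ^+ 2 * 16 / xi ^+ 2) / 2 by field; rewrite -normr_gt0.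
lra.
Qed.

Lemma half_cases psi phi t : phi = (fun z => if 0 <= z.1 then psi z else 0) ->
  (fun x => phi (t, x)) = (fun x => (0 <= t)%R%:R * psi (t, x)).
Proof. by move=> ->; apply/funext => x /=; case: ifP => _; rewrite ?mul1r ?mul0r. Qed.

Lemma C0_infty_slice_cont psi t : C0_infty psi -> continuous (fun x => psi (t, x)).
Proof.
by move=> sp x; apply: differentiable_continuous; apply/derivable1_diffP; case: (C0_infty_slice_derive t x sp).
Qed.

Lemma C0_infty_slice psi : C0_infty psi -> exists A L : R, [/\ 0 <= A /\ 0 < L,
  forall t, L1 (fun x => psi (t, x)),
  forall t x, L < `|t| -> psi (t, x) = 0,
  forall t, \int[mu]_x `|psi (t, x)| <= A &
  forall t h, 0 <= h <= 4 -> \int[mu]_x `|psi (t, x) - psi (t, x - h)| <= A * h].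
Proof.
move=> sp; have [L L0 hL] := C0_infty_box sp.
(* The difference with a shift [h <= 4] is supported in [[- (L + 4), L + 4]], and the shifted point
   then reaches [L + 8] at most. *)
have [M M0 hM] := C0_infty_lipschitz L (L + 8) sp.
have z1 t x : L < `|t| -> psi (t, x) = 0.
  by move=> h; apply/eqP; apply: contraTT h => /hL[h _]; rewrite -leNgt.
have z2 t x : L < `|x| -> psi (t, x) = 0.
  by move=> h; apply/eqP; apply: contraTT h => /hL[_ h]; rewrite -leNgt.
have mI (c : R) : measurable (`[- c, c]%classic : set R) by exact: measurable_itv.
have muI (c : R) : 0 < c -> mu `[- c, c]%classic = (2 * c)%:E.
  by move=> c0; rewrite mu_segment; [congr EFin; ring|lra].
have lI1 (c : R) : 0 < c -> L1 (\1_(`[- c, c]%classic) : R -> R).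
  move=> c0; apply: indic_L1 => //.
  by apply: (@le_lt_trans _ _ (2 * c)%:E); [rewrite -muI|exact: ltry].
have lI (K c : R) : 0 < c -> L1 (fun x => K * \1_(`[- c, c]%classic) x).
  by move=> c0; apply: L1Z; exact: lI1.
have IE (K c : R) : 0 < c -> \int[mu]_x (K * \1_(`[- c, c]%classic) x) = K * (2 * c).
  move=> c0; rewrite RintegralZl//; last exact: lI1.
  by rewrite Rintegral_indic//; congr (_ * _); transitivity (fine (2 * c)%:E) => //; congr fine; exact: muI.
have bd (K c : R) (f : R -> R) : 0 < c -> L1 f -> (forall x, `|f x| <= K * \1_(`[- c, c]%classic) x) ->
    \int[mu]_x `|f x| <= K * (2 * c).
  move=> c0 lf fK; rewrite -IE//; apply: le_Rintegral => //; last exact: lI.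
  exact: L1_norm.
have ind1 (c x : R) : `|x| <= c -> \1_(`[- c, c]%classic) x = 1 :> R.
  by move=> xc; rewrite indicE mem_set//= in_itv/= -ler_norml.
(* The Lipschitz bound also gives the supremum: compare [x] with [L + 1], where the slice vanishes,
   at distance at most [2 L + 1]. *)
have b1 t x : `|psi (t, x)| <= (M * (2 * L + 1)) * \1_(`[- L, L]%classic) x.
  have K0 : 0 <= M * (2 * L + 1) by rewrite mulr_ge0// addr_ge0// mulr_ge0// ltW.
  have [tL|tL] := leP `|t| L; last by rewrite z1// normr0 mulr_ge0.
  have [xL|xL] := leP `|x| L; last by rewrite z2// normr0 mulr_ge0.
  rewrite ind1// mulr1.
  have h8 : `|L + 1| <= L + 8 by rewrite ger0_norm; lra.
  have := hM t x (L + 1) tL (le_trans xL _) h8; rewrite (z2 t (L + 1)) ?subr0; last by rewrite ger0_norm; lra.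
  move=> h; apply: (le_trans (h _)); first by lra.
  rewrite ler_wpM2l// (le_trans (ler_normB _ _))// (@ger0_norm _ (L + 1)); lra.
have ls t : L1 (fun x => psi (t, x)).
  apply: (L1_le _ (b1 t)); last exact: lI.
  by apply: continuous_measurable_fun; exact: C0_infty_slice_cont.
have b2 t x h : 0 <= h <= 4 -> `|psi (t, x) - psi (t, x - h)| <= (M * h) * \1_(`[- (L + 4), L + 4]%classic) x.
  move=> /andP[h0 h4]; have K0 : 0 <= M * h by rewrite mulr_ge0.
  have [tL|tL] := leP `|t| L; last by rewrite !z1// subr0 normr0 mulr_ge0.
  have [xL|xL] := leP `|x| (L + 4); last first.
    have e1 : psi (t, x) = 0 by apply: z2; lra.
    have e2 : psi (t, x - h) = 0.
      by apply: z2; have := lerB_dist x h; rewrite (ger0_norm h0); lra.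
    by rewrite e1 e2 subr0 normr0 mulr_ge0.
  rewrite ind1// mulr1.
  have := hM t x (x - h) tL; rewrite subKr (ger0_norm h0); apply; first lra.
  by apply: (le_trans (ler_normB _ _)); rewrite (ger0_norm h0); lra.
pose A := M * (2 * L + 1) * (2 * L) + M * (2 * (L + 4)).
have a1 : 0 <= M * (2 * L + 1) * (2 * L) by rewrite !mulr_ge0//; lra.
have a2 : 0 <= M * (2 * (L + 4)) by rewrite !mulr_ge0//; lra.
exists A, L; split => //.
- by split => //; rewrite addr_ge0.
- by move=> t; apply: (le_trans (bd _ _ _ L0 (ls t) (b1 t))); rewrite lerDl.
- move=> t h h04; have /andP[h0 h4] := h04; apply: (le_trans (bd _ _ _ _ _ (fun x => b2 t x h h04))).
  + by rewrite addr_gt0.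
  + exact: L1B (ls t) (L1_shift h (ls t)).
  + by rewrite mulrAC ler_wpM2r// lerDr.
Qed.

Lemma test_measurable phi : C0_infty_half phi -> measurable_fun setT phi.
Proof.
move=> [psi sp ->]; apply: measurable_fun_ifT => //.
  by apply: measurable_fun_ler => //; exact: measurable_fst.
by apply: continuous2_measurable; exact: C0_infty_continuous.
Qed.

Lemma test_slice phi : C0_infty_half phi -> exists A L : R, [/\ 0 <= A, 0 < L, nice phi,
  forall t xi, Fsq (fun x => phi (t, x)) xi <= A * (0 <= t <= L)%R%:R &
  forall t xi, 1 <= `|xi| -> Fsq (fun x => phi (t, x)) xi <= A * (0 <= t <= L)%R%:R / xi ^+ 2].
Proof.
move=> tp; have mp := test_measurable tp; case: tp mp => psi sp pE mp.
have [A [L [[A0 L0] ls z1 b1 b2]]] := C0_infty_slice sp.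
have Fsq0 xi : Fsq (fun=> 0) xi = 0 by rewrite /Fsq /FC /FS !wint0 expr0n addr0.
have slice0 t : (fun x => phi (t, x)) = (fun=> 0) \/
    ((0 <= t <= L)%R%:R = 1 :> R /\ (fun x => phi (t, x)) = (fun x => psi (t, x))).
  rewrite (half_cases t pE); have [t0|t0] := leP 0 t; last first.
    by left; apply/funext => x; rewrite mul0r.
  have [tL|tL] := leP t L; last first.
    by left; apply/funext => x; rewrite z1 ?mulr0// ger0_norm.
  by right; split => //; apply/funext => x; rewrite mul1r.
exists (8 * A ^+ 2), L; split => //.
- by rewrite mulr_ge0// sqr_ge0.
- split => //; first by move=> t x t0; rewrite pE/= ifF// lt_geF.
  by move=> t; rewrite (half_cases t pE); apply: L1Z.
- move=> t xi; have [->|h] := slice0 t; first by rewrite Fsq0 mulr_ge0// mulr_ge0// sqr_ge0.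
  rewrite h.1 mulr1 h.2; apply: (le_trans (Fsq_le_L1 _ (ls t))).
  have I0 : 0 <= \int[mu]_x `|psi (t, x)| by apply: Rintegral_ge0.
  by have := b1 t; set I := \int[mu]_x _ in I0 *; nra.
- move=> t xi x1; have [->|h] := slice0 t.
    by rewrite Fsq0 divr_ge0 ?sqr_ge0// mulr_ge0// mulr_ge0// sqr_ge0.
  by rewrite h.1 mulr1 h.2; exact: Fsq_increment (ls t) A0 (b2 t) x1.
Qed.

End TestFunctions.

(** * The inner product of test functions *)

Section TestInner.
Context {R : realType}.
Local Notation mu := (@lebesgue_measure R).
Local Notation mu2 := (mu \x mu)%E.
Variable H : R.
Hypothesis H01 : 0 < H < 1.
Implicit Types (phi psi : R * R -> R).

Lemma test_nice phi : C0_infty_half phi -> nice phi.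
Proof. by move=> /test_slice[A [L []]]. Qed.

Lemma freq_weight_ge (xi : R) : 1 <= `|xi| -> (xi ^+ 2)^-1 <= freq_weight H xi.
Proof.
have /andP[H0 H1] := H01; move=> x1; have x0 : 0 < `|xi| by apply: lt_le_trans x1.
have E : (xi ^+ 2)^-1 = `|xi| `^ (- 2%:R).
  by rewrite powRN powR_mulrn// real_normK ?num_real.
rewrite /freq_weight le_min; apply/andP; split.
  by rewrite invf_le1 -1?real_normK ?num_real ?exprn_gt0// exprn_ege1.
by rewrite E ler_powR//; lra.
Qed.

Lemma freq_weight_lt1 (xi : R) : xi != 0 -> `|xi| < 1 -> freq_weight H xi = 1.
Proof.
have /andP[H0 H1] := H01; move=> xi0 x1; have x0 : 0 < `|xi| by rewrite normr_gt0.
have h : `|xi| `^ 0 <= `|xi| `^ (H - 2) by apply: ger_powR; [rewrite x0 ltW|lra].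
by apply/min_idPl; rewrite powRr0 in h.
Qed.

Lemma test_sqnorm_fin phi : C0_infty_half phi -> (sqnorm H phi < +oo)%E.
Proof.
move=> tp; have [A [L [A0 L0 np b1 b2]]] := test_slice tp.
have [K K0 hK] := sqnorm_weight H01.
pose tau (s : R) := A * \1_(`[0, L]%classic) s.
have mt : measurable_fun setT tau by apply: measurable_funM => //; exact: measurable_indic.
have tau0 s : 0 <= tau s by rewrite mulr_ge0.
have tauI : (\int[mu]_s (tau s)%:E <= (A * L)%:E)%E.
  under eq_integral do rewrite EFinM.
  rewrite ge0_integralZl//; last exact/measurable_EFinP/measurable_indic.
  rewrite integral_indic// setIT EFinM; apply: lee_wpmul2l => //.
  by apply: (@le_trans _ _ (L - 0)%:E); [rewrite -mu_segment// ltW|rewrite subr0].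
have AL : 0 <= A * L by rewrite mulr_ge0// ltW.
apply: le_lt_trans (ltry (A * L * K)).
apply: (le_trans _ (hK tau (A * L) mt tau0 AL tauI)).
apply: (@sqnorm_le _ _ H01 [::] phi (fun z => tau z.1 * freq_weight H z.2)) => //.
- apply: measurable_funM; first exact: (measurableT_comp mt measurable_fst).
  exact: (measurableT_comp (measurable_freq_weight H) measurable_snd).
- move=> [t xi] [_ /= xi0]; rewrite /slice_sq /tau /= indicE.
  have -> : (t \in `[0, L]%classic) = (0 <= t <= L) by rewrite mem_setE.
  have [x1|x1] := leP 1 `|xi|.
    by apply: (le_trans (b2 t xi x1)); rewrite ler_wpM2l ?mulr_ge0// freq_weight_ge.
  by apply: (le_trans (b1 t xi)); rewrite freq_weight_lt1// mulr1.
Qed.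

(** The real part of the integrand of [inner_H]; since the covariance is real, this part determines
    it. *)
Definition cross_density phi psi (z : R * R) : R :=
  (FC (fun x => phi (z.1, x)) z.2 * FC (fun x => psi (z.1, x)) z.2 +
   FS (fun x => phi (z.1, x)) z.2 * FS (fun x => psi (z.1, x)) z.2) * spectral_density H z.2.

Lemma cross_density_lin phi psi chi c z : nice phi -> nice psi ->
  cross_density (fun z => phi z + c * psi z) chi z =
  cross_density phi chi z + c * cross_density psi chi z.
Proof.
move=> [_ _ lp] [_ _ ls]; rewrite /cross_density /FC /FS !wint_lin//; try exact: osc_sin; try exact: osc_cos.
set a := wint _ _; set b := wint _ _; set e := wint _ _; set f := wint _ _; set g := wint _ _; set h := wint _ _.
by ring.
Qed.

Lemma cross_density_diag phi z : cross_density phi phi z = slice_sq phi z * spectral_density H z.2.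
Proof. by rewrite /cross_density /slice_sq /Fsq !expr2. Qed.

Lemma cross_density_measurable phi psi : nice phi -> nice psi -> measurable_fun setT (cross_density phi psi).
Proof.
move=> [mp _ _] [ms _ _]; apply: measurable_funM; last first.
  exact: (measurableT_comp (measurable_spectral_density H) measurable_snd).
apply: measurable_funD; apply: measurable_funM.
- exact: measurable_slice_FC.
- exact: measurable_slice_FC.
- exact: measurable_slice_FS.
- exact: measurable_slice_FS.
Qed.

Lemma cross_density_integrable phi psi : nice phi -> nice psi ->
  (sqnorm H phi < +oo)%E -> (sqnorm H psi < +oo)%E ->
  mu2.-integrable setT (EFin \o cross_density phi psi).
Proof.
move=> np ns fp fs; have [mp _ _] := np; have [ms _ _] := ns.
have I chi : nice chi -> (sqnorm H chi < +oo)%E ->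
    mu2.-integrable setT (fun z => (slice_sq chi z * spectral_density H z.2)%:E).
  move=> [mc _ _] fc; apply/integrableP; split; first exact: measurable_sq_density.
  apply: le_lt_trans fc; rewrite le_eqVlt; apply/orP; left; apply/eqP; apply: eq_integral => z _.
  by rewrite gee0_abs// sq_density_ge0.
have := integrableD measurableT (I _ np fp) (I _ ns fs).
apply: le_integrable => //; first by apply/measurable_EFinP; exact: cross_density_measurable.
move=> z _ /=; rewrite lee_fin -mulrDl /cross_density !normrM ler_wpM2r//.
rewrite [leRHS]ger0_norm; last by apply: addr_ge0; exact: Fsq_ge0.
rewrite /slice_sq /Fsq.
set a := FC _ _; set b := FC _ _; set c := FS _ _; set e := FS _ _.
rewrite ler_norml; apply/andP; split.
  by have := sqr_ge0 (a + b); have := sqr_ge0 (c + e); have := sqr_ge0 a; have := sqr_ge0 b; have := sqr_ge0 c; have := sqr_ge0 e; nra.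
by have := sqr_ge0 (a - b); have := sqr_ge0 (c - e); have := sqr_ge0 a; have := sqr_ge0 b; have := sqr_ge0 c; have := sqr_ge0 e; nra.
Qed.

Lemma inner_H_iterated phi psi : nice phi -> nice psi -> complex.Re (inner_H H phi psi) =
  \int[mu]_(t in `[0, +oo[) \int[mu]_xi cross_density phi psi (t, xi).
Proof.
move=> [_ _ lp] [_ _ ls].
transitivity (\int[mu]_(t in `[0, +oo[) \int[mu]_xi complex.Re
  (fourier (fun x => phi (t, x)) xi * (fourier (fun x => psi (t, x)) xi)^*%C
      * (spectral_density H xi)%:C%C)); first by [].
apply: eq_Rintegral => t _; apply: eq_Rintegral => xi _.
by rewrite !fourierE//= /cross_density /=; ring.
Qed.

Lemma cross_density_neg phi psi t xi : nice phi -> t < 0 -> cross_density phi psi (t, xi) = 0.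
Proof.
move=> [_ zp _] t0; rewrite /cross_density /=.
rewrite (_ : (fun x => phi (t, x)) = (fun=> 0)); last by apply/funext => x; rewrite zp.
by rewrite /FC /FS !wint0 !mul0r addr0 mul0r.
Qed.

(** Fubini, up to the null set of times whose inner integral is not finite and which [fine] sends to
    0. *)
Lemma inner_H_Re phi psi : C0_infty_half phi -> C0_infty_half psi ->
  complex.Re (inner_H H phi psi) = \int[mu2]_z cross_density phi psi z.
Proof.
move=> tp ts; have np := test_nice tp; have ns := test_nice ts.
have ci := cross_density_integrable np ns (test_sqnorm_fin tp) (test_sqnorm_fin ts).
pose F := fubini_F mu (EFin \o cross_density phi psi).
have mF := measurable_fubini_F ci.
rewrite inner_H_iterated// /Rintegral -(integral12_prod_meas1 ci) integral_mkcond.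
have E t : ((fun t => (fine (F t))%:E) \_ `[0, +oo[) t = (fine (F t))%:E.
  rewrite patchE; case: ifPn => //.
  rewrite notin_setE/= in_itv/= andbT => /negP; rewrite -ltNge => t0.
  by rewrite /F /fubini_F integral0_eq// => xi _; rewrite /= cross_density_neg.
congr fine; transitivity (\int[mu]_t (fine (F t))%:E)%E; first by apply: eq_integral => t _; exact: E.
apply: ae_eq_integral => //.
- by apply/measurable_EFinP; exact: (measurableT_comp (@fine_measurable R setT measurableT) mF).
- have := integrable_ae measurableT (integrable_fubini_F ci); apply: filterS => t ft _.
  by rewrite fineK// ft.
Qed.

End TestInner.

(** * Almost sure linearity and isometry of the noise on test functions *)

Section NoiseIsometry.
Context {R : realType} {d : measure_display} {Omega : measurableType d}.
Variable P : probability Omega R.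
Variable H : R.
Hypothesis H01 : 0 < H < 1.
Variable W : (R * R -> R) -> Omega -> R.
Hypothesis W_noise : is_noise P H W.
Implicit Types (phi psi chi g h : R * R -> R) (U V X Y : Omega -> R).

Lemma noise_gaussian phi : C0_infty_half phi -> centered_gaussian P (W phi).
Proof.
move=> tp; have := W_noise.1 1%N (fun=> phi) (fun=> 1) (fun=> tp).
by congr (centered_gaussian P _); apply/funext => w; rewrite big_ord1 mul1r.
Qed.

Lemma noise_measurable phi : C0_infty_half phi -> measurable_fun setT (W phi).
Proof. by move=> /noise_gaussian[]. Qed.

Lemma mul_integrable U V : measurable_fun setT U -> measurable_fun setT V ->
  (E2 P U < +oo)%E -> (E2 P V < +oo)%E -> P.-integrable setT (fun w => (U w * V w)%:E).
Proof.
move=> mU mV fU fV.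
have I X : measurable_fun setT X -> (E2 P X < +oo)%E ->
    P.-integrable setT (fun w => (X w ^+ 2)%:E).
  move=> mX fX; apply/integrableP; split; first exact: measurable_sqE.
  apply: le_lt_trans fX; rewrite le_eqVlt; apply/orP; left; apply/eqP; apply: eq_integral => w _.
  by rewrite gee0_abs// lee_fin sqr_ge0.
have := integrableD measurableT (I _ mU fU) (I _ mV fV).
apply: le_integrable => //; first by apply/measurable_EFinP; exact: measurable_funM.
move=> w _ /=; rewrite lee_fin [leRHS]ger0_norm; last by rewrite addr_ge0 ?sqr_ge0.
rewrite ler_norml; apply/andP; split.
  by have := sqr_ge0 (U w + V w); have := sqr_ge0 (U w); have := sqr_ge0 (V w); nra.
by have := sqr_ge0 (U w - V w); have := sqr_ge0 (U w); have := sqr_ge0 (V w); nra.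
Qed.

Lemma noise_E2_fin phi : C0_infty_half phi -> (E2 P (W phi) < +oo)%E.
Proof. by move=> /noise_gaussian/gaussian_E2_fin. Qed.

Lemma noise_cov phi psi : C0_infty_half phi -> C0_infty_half psi ->
  \int[P]_w (W phi w * W psi w) = \int[(@lebesgue_measure R \x @lebesgue_measure R)%E]_z cross_density H phi psi z.
Proof.
by move=> tp ts; rewrite -(inner_H_Re H01 tp ts) -(W_noise.2 phi psi tp ts).
Qed.

Lemma noise_lin_cov phi psi chi c : C0_infty_half phi -> C0_infty_half psi -> C0_infty_half chi ->
  \int[P]_w (W (fun z => phi z + c * psi z) w * W chi w) =
  \int[P]_w (W phi w * W chi w) + c * \int[P]_w (W psi w * W chi w).
Proof.
move=> tp ts tc; rewrite !noise_cov//; last exact: C0_infty_half_lin.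
have np := test_nice tp; have ns := test_nice ts; have nc := test_nice tc.
have fc := test_sqnorm_fin H01 tc.
have i1 := cross_density_integrable H01 np nc (test_sqnorm_fin H01 tp) fc.
have i2 := cross_density_integrable H01 ns nc (test_sqnorm_fin H01 ts) fc.
have i3 : (@lebesgue_measure R \x @lebesgue_measure R)%E.-integrable setT
    (EFin \o (fun z => c * cross_density H psi chi z)) by exact: (integrableZl measurableT c i2).
rewrite -RintegralZl// -RintegralD//.
by apply: eq_Rintegral => z _; rewrite cross_density_lin.
Qed.

(** The covariance is bilinear, so the defect [D] is orthogonal to every [W zeta]. As [D] is itself
    a combination of three such variables, its second moment vanishes. *)
Lemma noise_lin phi psi c : C0_infty_half phi -> C0_infty_half psi ->
  {ae P, forall w, W (fun z => phi z + c * psi z) w = W phi w + c * W psi w}.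
Proof.
move=> tp ts; pose chi z := phi z + c * psi z.
have tc : C0_infty_half chi by exact: C0_infty_half_lin.
pose D w := W chi w - (W phi w + c * W psi w).
have mp := noise_measurable tp; have ms := noise_measurable ts; have mc := noise_measurable tc.
have I ph ps : C0_infty_half ph -> C0_infty_half ps -> P.-integrable setT (EFin \o (fun w => W ph w * W ps w)).
  by move=> t1 t2; apply: mul_integrable; [exact: noise_measurable|exact: noise_measurable|exact: noise_E2_fin|exact: noise_E2_fin].
have Z ph ps e : C0_infty_half ph -> C0_infty_half ps -> P.-integrable setT (EFin \o (fun w => e * (W ph w * W ps w))).
  by move=> t1 t2; exact: (integrableZl measurableT e (I _ _ t1 t2)).
have S ph : C0_infty_half ph -> P.-integrable setT (EFin \o (fun w => W phi w * W ph w + c * (W psi w * W ph w))).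
  by move=> t1; exact: (integrableD measurableT (I _ _ tp t1) (Z _ _ c ts t1)).
have DZ zeta : C0_infty_half zeta ->
    P.-integrable setT (EFin \o (fun w => D w * W zeta w)) /\ \int[P]_w (D w * W zeta w) = 0.
  move=> tz; have E : (fun w => D w * W zeta w) = (fun w => W chi w * W zeta w -
      (W phi w * W zeta w + c * (W psi w * W zeta w))).
    by apply/funext => w; rewrite /D; ring.
  rewrite E; split; first exact: (integrableB measurableT (I _ _ tc tz) (S _ tz)).
  rewrite (RintegralB _ (I _ _ tc tz) (S _ tz))// (RintegralD _ (I _ _ tp tz) (Z _ _ c ts tz))//.
  by rewrite (RintegralZl _ _ (I _ _ ts tz))// noise_lin_cov// subrr.
have mD : measurable_fun setT D.
  by apply: measurable_funB => //; apply: measurable_funD => //; exact: measurable_funM.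
have E : (fun w => D w ^+ 2) = (fun w => D w * W chi w - (D w * W phi w + c * (D w * W psi w))).
  by apply/funext => w; rewrite /D; ring.
have [i1 j1] := DZ _ tc; have [i2 j2] := DZ _ tp; have [i3 j3] := DZ _ ts.
have i3' : P.-integrable setT (EFin \o (fun w => c * (D w * W psi w))) by exact: (integrableZl measurableT c i3).
have i4 : P.-integrable setT (EFin \o (fun w => D w * W phi w + c * (D w * W psi w))) by exact: (integrableD measurableT i2 i3').
have D0 : \int[P]_w (D w ^+ 2) = 0.
  by rewrite E (RintegralB _ i1 i4)// (RintegralD _ i2 i3')// (RintegralZl _ _ i3)// j1 j2 j3 mulr0 addr0 subrr.
have ED : E2 P D = 0%E.
  have : (E2 P D < +oo)%E.
    rewrite /E2 (_ : (fun w => (D w ^+ 2)%:E) = EFin \o (fun w => D w ^+ 2))// E.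
    by apply: integrable_lty => //; exact: (integrableB measurableT i1 i4).
  rewrite -ge0_fin_numE ?E2_ge0// => /fineK <-.
  by move: D0; rewrite /Rintegral => ->.
have := E2_eq0 mD ED; apply: filterS => w /eqP.
by rewrite subr_eq0 => /eqP.
Qed.

Lemma noise_E2 phi : C0_infty_half phi -> E2 P (W phi) = sqnorm H phi.
Proof.
move=> tp; have fp := noise_E2_fin tp; have fs := test_sqnorm_fin H01 tp.
rewrite -[LHS]fineK ?ge0_fin_numE ?E2_ge0// -[RHS]fineK ?ge0_fin_numE ?sqnorm_ge0//.
congr EFin; have := noise_cov tp tp; rewrite /Rintegral => h.
transitivity (fine (\int[P]_w (W phi w * W phi w)%:E)).
  by congr fine; apply: eq_integral => w _; rewrite expr2.
by rewrite h; congr fine; apply: eq_integral => z _; rewrite cross_density_diag.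
Qed.

End NoiseIsometry.

(** * Wiener integrals as mean-square limits *)

Section WienerIntegral.
Context {R : realType} {d : measure_display} {Omega : measurableType d}.
Variable P : probability Omega R.
Variable H : R.
Hypothesis H01 : 0 < H < 1.
Variable W : (R * R -> R) -> Omega -> R.
Hypothesis W_noise : is_noise P H W.
Implicit Types (phi psi g h : R * R -> R) (U V X Y : Omega -> R).

Lemma cvge0D (u v : nat -> \bar R) : u n @[n --> \oo] --> 0%E -> v n @[n --> \oo] --> 0%E ->
  (u n + v n)%E @[n --> \oo] --> 0%E.
Proof. by move=> cu cv; rewrite -[X in _ --> X](adde0 0%E); apply: cvgeD. Qed.

Lemma ereal_ladder (a b c : \bar R) : (0 <= a)%E -> (0 <= b)%E -> (0 <= c)%E ->
  (2%:E * a + 2%:E * (2%:E * b + 2%:E * c) = 4%:E * c + (2%:E * a + 4%:E * b))%E.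
Proof.
move=> a0 b0 c0; rewrite ge0_muleDr ?mule_ge0// !muleA -!EFinM.
have -> : 2 * 2 = 4 :> R by ring.
by rewrite [RHS]addeC -addeA.
Qed.

Lemma sqnormZ g c : nice g -> sqnorm H (fun z => c * g z) = ((c ^+ 2)%:E * sqnorm H g)%E.
Proof.
move=> [mg _ lg]; rewrite /sqnorm -ge0_integralZl//; last 3 first.
- exact: measurable_sq_density.
- by move=> z _; exact: sq_density_ge0.
- by rewrite lee_fin sqr_ge0.
apply: eq_integral => z _; rewrite -EFinM (mulrA (c ^+ 2)); congr (_ * _)%:E.
rewrite /slice_sq /Fsq /FC /FS !wintZ//; try exact: osc_sin; try exact: osc_cos.
by ring.
Qed.

Lemma sqnorm_eq g h : (forall z, g z = h z) -> sqnorm H g = sqnorm H h.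
Proof. by move=> /funext ->. Qed.

Lemma sqnormB_sym g h : nice g -> nice h ->
  sqnorm H (fun z => g z - h z) = sqnorm H (fun z => h z - g z).
Proof.
move=> ng nh; rewrite -[RHS]mul1e -(expr1n _ 2) -(sqrrN 1) -sqnormZ; last exact: niceB.
by apply: sqnorm_eq => z; ring.
Qed.

Lemma sqnormD_le g h c : nice g -> nice h ->
  (sqnorm H (fun z => g z + c * h z)%R <= 2%:E * sqnorm H g + (2 * c ^+ 2)%:E * sqnorm H h)%E.
Proof.
move=> ng nh; have nh' : nice (fun z => - c * h z).
  by have := nice_lin (- c) nice0 nh; congr nice; apply/funext => z; rewrite add0r.
rewrite (sqnorm_eq (h := fun z => g z - (- c * h z))); last by move=> z; ring.
by apply: (le_trans (sqnormB_le H01 ng nh')); rewrite sqnormZ// sqrrN EFinM muleA.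
Qed.

Lemma E2Z X c : measurable_fun setT X -> E2 P (fun w => c * X w) = ((c ^+ 2)%:E * E2 P X)%E.
Proof.
move=> mX; rewrite /E2 -ge0_integralZl//; last 3 first.
- exact: measurable_sqE.
- by move=> w _; rewrite lee_fin sqr_ge0.
- by rewrite lee_fin sqr_ge0.
by apply: eq_integral => w _; rewrite -EFinM exprMn.
Qed.

Lemma E2_ae U V : measurable_fun setT U -> measurable_fun setT V ->
  {ae P, forall w, U w = V w} -> E2 P U = E2 P V.
Proof.
move=> mU mV UV; apply: ae_eq_integral => //; [exact: measurable_sqE|exact: measurable_sqE|].
by apply: filterS UV => w -> _.
Qed.

(** On [nice] integrands [sqnorm_H] is the integral [sqnorm] over the plane, and linear operations
    can be carried out slice by slice. *)
Definition wi g X : Prop := nice g /\ wiener_integral P H W g X.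

Lemma wi_approx g X : wi g X -> exists phi : nat -> R * R -> R,
  [/\ forall n, C0_infty_half (phi n), sqnorm H (fun z => phi n z - g z) @[n --> \oo] --> 0%E &
      E2 P (fun w => W (phi n) w - X w) @[n --> \oo] --> 0%E].
Proof.
move=> [ng [_ _ [phi [tp cp cX]]]]; exists phi; split => //.
apply: cvg_trans cp; rewrite (_ : (fun n => sqnorm_H _ _) = (fun n => sqnorm H (fun z => phi n z - g z)))//.
by apply/funext => n; apply: (sqnorm_HE H01); apply: niceB => //; exact: test_nice.
Qed.

Lemma sqnorm_limit_fin g (gn : nat -> R * R -> R) : nice g -> (forall n, nice (gn n)) ->
  (forall n, sqnorm H (gn n) < +oo)%E -> sqnorm H (fun z => gn n z - g z) @[n --> \oo] --> 0%E ->
  (sqnorm H g < +oo)%E.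
Proof.
move=> ng nn fn cg; have [N hN] := cvge0_lt cg ltr01.
have E : sqnorm H g = sqnorm H (fun z => gn N z - (gn N z - g z)).
  by apply: sqnorm_eq => z; ring.
rewrite E; apply: (le_lt_trans (sqnormB_le H01 (nn N) (niceB (nn N) ng))).
apply: lte_add_pinfty; apply: lte_mul_pinfty => //.
by apply: (lt_trans (hN N (leqnn N))); exact: ltry.
Qed.

Lemma wiI g X (phi : nat -> R * R -> R) : nice g -> measurable_fun setT X ->
  (forall n, C0_infty_half (phi n)) -> sqnorm H (fun z => phi n z - g z) @[n --> \oo] --> 0%E ->
  E2 P (fun w => W (phi n) w - X w) @[n --> \oo] --> 0%E -> wi g X.
Proof.
move=> ng mX tp cp cX; split => //; split => //.
  apply: nice_in_H => //; apply: (sqnorm_limit_fin ng _ _ cp) => n; first exact: test_nice.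
  exact: test_sqnorm_fin.
exists phi; split => //; apply: cvg_trans cp.
rewrite (_ : (fun n => sqnorm_H _ _) = (fun n => sqnorm H (fun z => phi n z - g z)))//.
by apply/funext => n; apply: (sqnorm_HE H01); apply: niceB => //; exact: test_nice.
Qed.

Lemma wi_measurable g X : wi g X -> measurable_fun setT X.
Proof. by move=> [_ []]. Qed.

Lemma wi_nice g X : wi g X -> nice g.
Proof. by case. Qed.

Lemma wi_sqnorm_fin g X : wi g X -> (sqnorm H g < +oo)%E.
Proof. by move=> [ng [[_ _ fg] _ _]]; rewrite -(sqnorm_HE H01). Qed.

Lemma wi_test phi : C0_infty_half phi -> wi phi (W phi).
Proof.
move=> tp; apply: (@wiI _ _ (fun=> phi)) => //.
- exact: test_nice.
- exact: (noise_measurable W_noise).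
- rewrite (_ : (fun n => _) = fun=> 0%E); first exact: cvg_cst.
  apply/funext => n; rewrite (sqnorm_eq (h := fun z => 0 * phi z)); last by move=> z; rewrite subrr mul0r.
  by rewrite sqnormZ ?expr0n ?mul0e//; exact: test_nice.
- rewrite (_ : (fun n => _) = fun=> 0%E); first exact: cvg_cst.
  by apply/funext => n; apply: integral0_eq => w _; rewrite subrr expr0n.
Qed.

Lemma wi_lin g h X Y c : wi g X -> wi h Y -> wi (fun z => g z + c * h z) (fun w => X w + c * Y w).
Proof.
move=> iX iY; have ng := wi_nice iX; have nh := wi_nice iY.
have mX := wi_measurable iX; have mY := wi_measurable iY.
have [phi [tp cp cX]] := wi_approx iX; have [psi [ts cs cY]] := wi_approx iY.
have mp n := noise_measurable W_noise (tp n); have ms n := noise_measurable W_noise (ts n).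
have tl n := C0_infty_half_lin c (tp n) (ts n).
have mcY : measurable_fun setT (fun w => c * Y w) by exact: measurable_funM.
apply: (@wiI _ _ (fun n z => phi n z + c * psi n z)).
- exact: nice_lin.
- exact: measurable_funD.
- exact: tl.
- apply: (@ge0_cvge0_le _ _ (fun n => 2%:E * sqnorm H (fun z => phi n z - g z)%R +
      (2 * c ^+ 2)%:E * sqnorm H (fun z => psi n z - h z)%R)%E).
  + by move=> n; exact: sqnorm_ge0.
  + move=> n; rewrite (sqnorm_eq (h := fun z => (phi n z - g z) + c * (psi n z - h z))); last by move=> z; ring.
    by apply: sqnormD_le; apply: niceB => //; exact: test_nice.
  + exact: (cvge0D (cvge0Ml 2 cp) (cvge0Ml (2 * c ^+ 2) cs)).
- apply: (@ge0_cvge0_le _ _ (fun n => 2%:E * E2 P (fun w => W (phi n) w - X w)%R +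
      (2 * c ^+ 2)%:E * E2 P (fun w => W (psi n) w - Y w)%R)%E).
  + by move=> n; exact: E2_ge0.
  + move=> n; have mn := noise_measurable W_noise (tl n).
    have m1 : measurable_fun setT (fun w => W (phi n) w - X w) by exact: measurable_funB.
    have m2 : measurable_fun setT (fun w => W (psi n) w - Y w) by exact: measurable_funB.
    have m3 : measurable_fun setT (fun w => c * (W (psi n) w - Y w)) by exact: measurable_funM.
    rewrite (@E2_ae _ (fun w => (W (phi n) w - X w) + c * (W (psi n) w - Y w))).
    * by apply: (le_trans (E2D_le P m1 m3)); rewrite E2Z// EFinM muleA.
    * by apply: measurable_funB => //; exact: measurable_funD.
    * exact: measurable_funD.
    * by have := noise_lin H01 W_noise c (tp n) (ts n); apply: filterS => w ->; ring.
  + exact: (cvge0D (cvge0Ml 2 cX) (cvge0Ml (2 * c ^+ 2) cY)).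
Qed.

Lemma wi_gaussian g X : wi g X -> centered_gaussian P X.
Proof.
move=> iX; have [phi [tp cp cX]] := wi_approx iX.
by apply: (gaussian_limit _ (wi_measurable iX) cX) => n; exact: (noise_gaussian W_noise).
Qed.

(** Two uses of [(a + b)^2 <= 2 a^2 + 2 b^2], through an approximating test function, turn the
    isometry into an inequality with factor 4. It suffices for uniqueness, completeness and the
    increments. *)
Lemma wi_E2_le g X : wi g X -> (E2 P X <= 4%:E * sqnorm H g)%E.
Proof.
move=> iX; have [phi [tp cp cX]] := wi_approx iX; have ng := wi_nice iX; have mX := wi_measurable iX.
pose e n := (2%:E * E2 P (fun w => W (phi n) w - X w)%R + 4%:E * sqnorm H (fun z => phi n z - g z)%R)%E.
apply: (@cvg_ereal_le _ _ _ e).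
- have fg := wi_sqnorm_fin iX.
  by rewrite ge0_fin_numE; [exact: lte_mul_pinfty|rewrite mule_ge0// sqnorm_ge0].
- exact: (cvge0D (cvge0Ml 2 cX) (cvge0Ml 4 cp)).
move=> n; have mW := noise_measurable W_noise (tp n); have np := test_nice (tp n).
have h1 : (E2 P X <= 2%:E * E2 P (fun w => W (phi n) w - X w)%R + 2%:E * E2 P (W (phi n)))%E.
  rewrite E2B_sym; apply: le_trans (E2D_le P _ mW); last exact: measurable_funB.
  by rewrite le_eqVlt; apply/orP; left; apply/eqP; apply: eq_integral => w _; rewrite subrK.
have h2 : (E2 P (W (phi n)) <= 2%:E * sqnorm H (fun z => phi n z - g z)%R + 2%:E * sqnorm H g)%E.
  rewrite (noise_E2 H01 W_noise)//.
  rewrite (sqnorm_eq (h := fun z => (phi n z - g z) + 1 * g z)); last by move=> z; ring.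
  by apply: (le_trans (sqnormD_le 1 (niceB np ng) ng)); rewrite expr1n mulr1.
apply: (le_trans h1); rewrite /e -ereal_ladder ?E2_ge0 ?sqnorm_ge0//.
by rewrite leeD2l// lee_wpmul2l.
Qed.

Lemma wi_isometry g h X Y : wi g X -> wi h Y ->
  (E2 P (fun w => X w - Y w)%R <= 4%:E * sqnorm H (fun z => g z - h z)%R)%E.
Proof.
move=> iX iY; have := wi_E2_le (wi_lin (-1) iX iY).
rewrite (sqnorm_eq (h := fun z => g z - h z)); last by move=> z; rewrite mulN1r.
by congr (_ <= _)%E; apply: eq_integral => w _; rewrite mulN1r.
Qed.

Lemma wi_unique g X Y : wi g X -> wi g Y -> {ae P, forall w, X w = Y w}.
Proof.
move=> iX iY; have mX := wi_measurable iX; have mY := wi_measurable iY.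
have : E2 P (fun w => X w - Y w) = 0%E.
  apply/eqP; rewrite eq_le E2_ge0 andbT; apply: (le_trans (wi_isometry iX iY)).
  rewrite (sqnorm_eq (h := fun z => 0 * g z)); last by move=> z; rewrite subrr mul0r.
  by rewrite sqnormZ ?expr0n ?mul0e ?mule0//; exact: wi_nice iX.
move=> /E2_eq0 => /(_ (measurable_funB mX mY)); apply: filterS => w /eqP.
by rewrite subr_eq0 => /eqP.
Qed.

(** The limit is an explicit [lim_version] along a fast subsequence, so it inherits measurability
    with respect to any sigma-algebra that observes the [Xn]. A diagonal choice of test functions
    shows that it is a Wiener integral of [g]. *)
Lemma wi_limit g (gn : nat -> R * R -> R) (Xn : nat -> Omega -> R) : nice g ->
  (forall n, wi (gn n) (Xn n)) -> sqnorm H (fun z => gn n z - g z) @[n --> \oo] --> 0%E ->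
  exists f : nat -> nat, wi g (lim_version (fun n => Xn (f n))).
Proof.
move=> ng iX cg.
(* The 16 pays for the factor 4 of [wi_isometry] and for the comparison of consecutive terms:
   [4 * (2 / 8 + 2) / 16 <= 1]. *)
have e0 n : 0 < 8^-1 ^+ n / 16 :> R by rewrite divr_gt0// exprn_gt0// invr_gt0.
have /choice[f hf] : forall n, exists m, (sqnorm H (fun z => gn m z - g z)%R <= (8^-1 ^+ n / 16)%:E)%E.
  by move=> n; have [N hN] := cvge0_lt cg (e0 n); exists N; apply/ltW/hN.
exists f; set Y := fun n => Xn (f n).
have nn n : nice (gn n) := wi_nice (iX n).
have mY n : measurable_fun setT (Y n) by exact: wi_measurable (iX _).
have cY : E2 P (fun w => Y n w - lim_version Y w) @[n --> \oo] --> 0%E.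
  apply: E2_complete => // n.
  apply: (le_trans (wi_isometry (iX _) (iX _))).
  have h : (sqnorm H (fun z => gn (f n.+1) z - gn (f n) z)%R <=
      2%:E * (8^-1 ^+ n.+1 / 16)%:E + 2%:E * (8^-1 ^+ n / 16)%:E)%E.
    rewrite (sqnorm_eq (h := fun z => (gn (f n.+1) z - g z) - (gn (f n) z - g z))); last by move=> z; ring.
    apply: (le_trans (sqnormB_le H01 (niceB (nn _) ng) (niceB (nn _) ng))).
    by apply: leeD; apply: lee_wpmul2l.
  have h' : (sqnorm H (fun z => gn (f n.+1) z - gn (f n) z)%R <= (8^-1 ^+ n / 4)%:E)%E.
    apply: (le_trans h); rewrite -!EFinM -EFinD lee_fin exprS.
    have : 0 <= 8^-1 ^+ n :> R by rewrite exprn_ge0.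
    by set q := _ ^+ n => q0; lra.
  have -> : ((8^-1 : R) ^+ n)%:E = (4%:E * (8^-1 ^+ n / 4)%:E)%E by rewrite -EFinM; congr EFin; field.
  exact: lee_wpmul2l h'.
have h0 n : 0 < 2^-1 ^+ n :> R by rewrite exprn_gt0// invr_gt0.
have /choice[phi hphi] : forall n, exists p : R * R -> R, [/\ C0_infty_half p,
    (sqnorm H (fun z => p z - gn (f n) z)%R <= (2^-1 ^+ n)%:E)%E &
    (E2 P (fun w => W p w - Y n w)%R <= (2^-1 ^+ n)%:E)%E].
  move=> n; have [p [tp cp cX]] := wi_approx (iX (f n)).
  have [N1 h1] := cvge0_lt cp (h0 n); have [N2 h2] := cvge0_lt cX (h0 n).
  exists (p (maxn N1 N2)); split => //; apply/ltW; [apply: h1|apply: h2].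
    exact: leq_maxl.
  exact: leq_maxr.
have ch : ((2^-1 : R) ^+ n)%:E @[n --> \oo] --> 0%E.
  apply: cvg_EFin; first exact: nearW.
  by apply: cvg_expr; rewrite gtr0_norm ?invr_gt0// invf_lt1 ?ltr1n.
have c8 : ((8^-1 : R) ^+ n / 16)%:E @[n --> \oo] --> 0%E.
  apply: cvg_EFin; first exact: nearW.
  rewrite -[X in _ --> X](mul0r 16^-1); apply: cvgM; last exact: cvg_cst.
  by apply: cvg_expr; rewrite gtr0_norm ?invr_gt0// invf_lt1 ?ltr1n.
apply: (@wiI _ _ phi).
- exact: ng.
- exact: measurable_lim_version.
- by move=> n; case: (hphi n).
- apply: (@ge0_cvge0_le _ _ (fun n => 2%:E * ((2^-1 : R) ^+ n)%:E + 2%:E * ((8^-1 : R) ^+ n / 16)%:E)%E).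
  + by move=> n; exact: sqnorm_ge0.
  + move=> n; have [tp h1 _] := hphi n; have np := test_nice tp.
    rewrite (sqnorm_eq (h := fun z => (phi n z - gn (f n) z) + 1 * (gn (f n) z - g z))); last by move=> z; ring.
    apply: (le_trans (sqnormD_le 1 (niceB np (nn _)) (niceB (nn _) ng))).
    by rewrite expr1n mulr1; apply: leeD; apply: lee_wpmul2l.
  + exact: (cvge0D (cvge0Ml 2 ch) (cvge0Ml 2 c8)).
- apply: (@ge0_cvge0_le _ _ (fun n => 2%:E * ((2^-1 : R) ^+ n)%:E + 2%:E * E2 P (fun w => Y n w - lim_version Y w)%R)%E).
  + by move=> n; exact: E2_ge0.
  + move=> n; have [tp _ h2] := hphi n; have mW := noise_measurable W_noise tp.
    apply: (le_trans (E2_triangle P mW (mY n) (measurable_lim_version mY))).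
    by apply: leeD => //; apply: lee_wpmul2l.
  + exact: (cvge0D (cvge0Ml 2 ch) (cvge0Ml 2 cY)).
Qed.

End WienerIntegral.

(** * Wiener integrals observable in the filtration *)

Section Observable.
Context {R : realType} {d : measure_display} {Omega : measurableType d}.
Variable P : probability Omega R.
Variable H : R.
Hypothesis H01 : 0 < H < 1.
Variable W : (R * R -> R) -> Omega -> R.
Hypothesis W_noise : is_noise P H W.
Implicit Types (phi psi g h : R * R -> R) (U V X Y : Omega -> R).

Definition observable (t : R) X : Prop :=
  forall B : set R, measurable B -> noise_filtration P H W t (X @^-1` B).

Let gens (t : R) : set (set Omega) :=
  [set A | exists (s : R) (f : R -> R) (X : Omega -> R) (B : set R),
         [/\ 0 <= s <= t, C0_infty f,
             wiener_integral P H W (fun z => if 0 <= z.1 <= s then f z.2 else 0) X,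
             measurable B & A = X @^-1` B]]
      `|` P.-negligible.

Let observableP t X :
  observable t X <-> measurable_fun setT (X : g_sigma_algebraType (gens t) -> R).
Proof.
split => [h _ B mB|h B mB]; first by rewrite setTI; exact: h.
by have := h measurableT B mB; rewrite setTI.
Qed.

Lemma observable_lin t X Y c : observable t X -> observable t Y ->
  observable t (fun w => X w + c * Y w).
Proof.
move=> /observableP mX /observableP mY; apply/observableP.
by apply: measurable_funD => //; exact: measurable_funM.
Qed.

Lemma observable_lim_version t (X : nat -> Omega -> R) : (forall n, observable t (X n)) ->
  observable t (lim_version X).
Proof.
by move=> oX; apply/observableP; apply: lim_version_sub => n; exact/observableP.
Qed.

(** Every subset of a null set belongs to the filtration, so a change on such a set alters preimages
    only by members of the filtration. *)
Lemma observable_ae t X Y : observable t X -> {ae P, forall w, X w = Y w} -> observable t Y.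
Proof.
move=> oX XY B mB; pose N := [set w | X w <> Y w].
have nN (M : set Omega) : M `<=` N -> noise_filtration P H W t M.
  move=> MN; apply: sub_sigma_algebra; right.
  exact: negligibleS XY.
have -> : Y @^-1` B = ((X @^-1` B) `\` N) `|` ((Y @^-1` B) `&` N).
  apply/seteqP; split => w /=.
    move=> YB; have [e|ne] := pselect (X w = Y w); last by right.
    by left; split; [rewrite /= e|move=> h; exact: h].
  by move=> [[XB h]|[]//]; have <- : X w = Y w by exact: contrapT.
have h1 : @measurable _ (g_sigma_algebraType (gens t)) (X @^-1` B) by exact: oX.
have h2 : @measurable _ (g_sigma_algebraType (gens t)) N by exact: nN.
have h3 : @measurable _ (g_sigma_algebraType (gens t)) (Y @^-1` B `&` N).
  by apply: nN => w [].
exact: measurableU (measurableD h1 h2) h3.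
Qed.

Lemma observable_generator t s f X : 0 <= s <= t -> C0_infty f ->
  wiener_integral P H W (fun z => if 0 <= z.1 <= s then f z.2 else 0) X -> observable t X.
Proof.
move=> st cf wX B mB; apply: sub_sigma_algebra; left.
by exists s, f, X, B.
Qed.

(** Existence of the integral and adaptedness travel together, so that each approximation proves
    both at once. *)
Definition adapted_wi (t : R) g : Prop := exists2 X, wi P H W g X & observable t X.

Lemma adapted_wi_lin t g h c : adapted_wi t g -> adapted_wi t h ->
  adapted_wi t (fun z => g z + c * h z).
Proof.
move=> [X iX oX] [Y iY oY]; exists (fun w => X w + c * Y w); first exact: wi_lin.
exact: observable_lin.
Qed.

Lemma adapted_wi_limit t g (gn : nat -> R * R -> R) : nice g ->
  (forall n, adapted_wi t (gn n)) -> sqnorm H (fun z => gn n z - g z) @[n --> \oo] --> 0%E ->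
  adapted_wi t g.
Proof.
move=> ng hn cg.
have /choice[X hX] : forall n, exists X, wi P H W (gn n) X /\ observable t X.
  by move=> n; have [X iX oX] := hn n; exists X.
have [f hf] := wi_limit H01 W_noise ng (fun n => (hX n).1) cg.
exists (lim_version (fun n => X (f n))) => //.
by apply: observable_lim_version => n; exact: (hX _).2.
Qed.

(** Once the integral of [1_[0,s] f] exists it generates the filtration by definition; the
    approximation by test functions supplies the existence. *)
Lemma adapted_wi_generator t s f (phi : nat -> R * R -> R) : 0 <= s <= t -> C0_infty f ->
  nice (fun z => if 0 <= z.1 <= s then f z.2 else 0) ->
  (forall n, C0_infty_half (phi n)) ->
  sqnorm H (fun z => phi n z - (if 0 <= z.1 <= s then f z.2 else 0)) @[n --> \oo] --> 0%E ->
  adapted_wi t (fun z => if 0 <= z.1 <= s then f z.2 else 0).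
Proof.
move=> st cf ng tp cp.
have [k hk] := wi_limit H01 W_noise ng (fun n => wi_test H01 W_noise (tp n)) cp.
exists (lim_version (fun n => W (phi (k n)))) => //.
by case: hk => _ hk; exact: observable_generator hk.
Qed.

Lemma adapted_wi0 t : adapted_wi t (fun=> 0).
Proof.
pose p (z : R * R) := if 0 <= z.1 then bump 0 1 1 z.1 * bump 0 1 1 z.2 else 0.
have tp : C0_infty_half p by eexists; [exact: (tensor_bump_C0_infty ltr01 ltr01 ltr01 ltr01)|].
have iX := wi_lin H01 W_noise (-1) (wi_test H01 W_noise tp) (wi_test H01 W_noise tp).
exists (fun=> 0).
  have E1 : (fun z => p z + -1 * p z) = fun=> 0 by apply/funext => z; ring.
  have E2 : (fun w => W p w + -1 * W p w) = fun=> 0 by apply/funext => w; ring.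
  by move: iX; rewrite E1 E2.
exact/observableP.
Qed.

Lemma adapted_wi_sum t (n : nat) (g : nat -> R * R -> R) :
  (forall k, adapted_wi t (g k)) -> adapted_wi t (fun z => \sum_(k < n) g k z).
Proof.
move=> hg; elim: n => [|n IH].
  by have := adapted_wi0 t; congr adapted_wi; apply/funext => z; rewrite big_ord0.
have := adapted_wi_lin 1 IH (hg n); congr adapted_wi; apply/funext => z.
by rewrite big_ord_recr /= mul1r.
Qed.

Lemma adapted_wiZ t g c : adapted_wi t g -> adapted_wi t (fun z => c * g z).
Proof.
by move=> /(adapted_wi_lin c (adapted_wi0 t)); congr adapted_wi; apply/funext => z; rewrite add0r.
Qed.

Lemma adapted_wiB t g h : adapted_wi t g -> adapted_wi t h -> adapted_wi t (fun z => g z - h z).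
Proof.
by move=> ag /(adapted_wi_lin (-1) ag); congr adapted_wi; apply/funext => z; rewrite mulN1r.
Qed.

End Observable.

(** * Bumps, intervals and products of a time indicator with a spatial profile *)

Section Profiles.
Context {R : realType}.
Local Notation mu := (@lebesgue_measure R).
Implicit Types (f p : R -> R).

Let bump_profile (l k r : R) : R := if r < l then expR (- (k * (l ^+ 2 - r ^+ 2))^-1) else 0.

Lemma bump_sym (a b k x : R) : bump a b k x = bump_profile ((b - a) / 2) k `|x - (a + b) / 2|.
Proof.
rewrite /bump /bump_profile real_normK ?num_real//.
have -> : (`|x - (a + b) / 2| < (b - a) / 2) = (a < x < b).
  rewrite ltr_norml; apply/idP/idP => /andP[h1 h2]; apply/andP; split; lra.
by case: ifP => // _; congr (expR (- (k * _)^-1)); field.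
Qed.

Lemma bump_unimodal (a b k : R) : 0 < k -> unimodal (bump a b k).
Proof.
move=> k0; rewrite (funext (bump_sym a b k)).
apply: (@unimodal_sym _ (bump_profile _ _)) => [r|r s r0 rs]; rewrite /bump_profile.
  by case: ifP => // _; exact: expR_ge0.
have [sl|_] := ltP s ((b - a) / 2); last by case: ifP => // _; exact: expR_ge0.
rewrite (le_lt_trans rs sl) ler_expR lerN2.
have s0 : 0 <= s := le_trans r0 rs.
have l0 : 0 <= (b - a) / 2 := ltW (le_lt_trans s0 sl).
have hs : 0 < ((b - a) / 2) ^+ 2 - s ^+ 2 by rewrite subr_gt0 ltr_sqr ?nnegrE.
have hrs : r ^+ 2 <= s ^+ 2 by rewrite ler_sqr ?nnegrE.
have hr : 0 < ((b - a) / 2) ^+ 2 - r ^+ 2 by apply: lt_le_trans hs _; rewrite lerD2l lerN2.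
by rewrite lef_pV2 ?posrE ?mulr_gt0// ler_pM2l// lerD2l lerN2.
Qed.

Lemma bump_measurable (a b k : R) : a < b -> 0 < k -> measurable_fun setT (bump a b k).
Proof.
move=> ab k0; apply: continuous_measurable_fun.
exact: C0_infty_continuous (bump_C0_infty ab k0).
Qed.

Lemma bump_le_indic (a b k x : R) : 0 < k -> bump a b k x <= \1_(`]a, b[%classic) x.
Proof.
move=> k0; rewrite /bump indicE mem_setE in_itv/=; case: ifP => // xab.
rewrite -expR0 ler_expR oppr_le0 invr_ge0 mulr_ge0 ?(ltW k0)//.
by case/andP: xab => h1 h2; rewrite mulr_ge0// subr_ge0 ltW.
Qed.

Lemma mu_itv (a b : R) (b0 b1 : bool) : a <= b ->
  mu [set` Interval (BSide b0 a) (BSide b1 b)] = (b - a)%:E.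
Proof.
rewrite le_eqVlt => /predU1P[->|ab]; rewrite lebesgue_measure_itv/= lte_fin.
  by rewrite ltxx subrr.
by rewrite ab EFinN.
Qed.

Lemma itv_L1 (a b : R) (b0 b1 : bool) : a <= b ->
  L1 (\1_[set` Interval (BSide b0 a) (BSide b1 b)] : R -> R).
Proof.
move=> ab; apply: indic_L1 => //.
by apply: (@le_lt_trans _ _ (b - a)%:E); [rewrite -(mu_itv b0 b1 ab)|exact: ltry].
Qed.

Lemma bump_L1 (a b k : R) : a < b -> 0 < k -> L1 (bump a b k).
Proof.
move=> ab k0; apply: (L1_le (bump_measurable ab k0) _ (itv_L1 false true (ltW ab))) => x.
by rewrite ger0_norm ?bump_ge0//; exact: bump_le_indic.
Qed.

Lemma cvg_bump (a b x : R) : bump a b n.+1%:R x @[n --> \oo] --> (\1_(`]a, b[%classic) x : R).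
Proof.
rewrite indicE mem_setE /bump in_itv/=.
have [xab|xab] := boolP (a < x < b); last by rewrite /bump; exact: cvg_cst.
have q0 : 0 < (x - a) * (b - x) by case/andP: xab => h1 h2; rewrite mulr_gt0// subr_gt0.
have c : (- (n.+1%:R * ((x - a) * (b - x)))^-1) @[n --> \oo] --> (0 : R).
  rewrite -[X in _ --> X](mulr0 (- ((x - a) * (b - x))^-1)).
  rewrite (_ : (fun n => _) = fun n => (- ((x - a) * (b - x))^-1) * n.+1%:R^-1).
    by apply: cvgM; [exact: cvg_cst|exact: cvg_harmonic].
  by apply/funext => n; rewrite invfM mulNr mulrC.
by rewrite -[X in _ --> X]expR0; apply: (cvg_comp _ _ c); exact: continuous_expR.
Qed.

Lemma unimodal_itv (a b : R) (b0 b1 : bool) : 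
  unimodal (\1_[set` Interval (BSide b0 a) (BSide b1 b)] : R -> R).
Proof.
split=> [x|c c0]; first by [].
have [c1|c1] := leP c 1.
  rewrite (_ : [set x | _] = [set` Interval (BSide b0 a) (BSide b1 b)]); first exact: interval_is_interval.
  apply/seteqP; split => x /=; rewrite indicE mem_setE; first by case: (x \in _) => //=; rewrite leNgt c0.
  by move=> ->.
rewrite (_ : [set x | _] = set0); first by move=> x y [].
apply/seteqP; split => x //=; rewrite indicE leNgt; apply/negP/negPn.
by rewrite (le_lt_trans _ c1)// lern1; case: (_ \in _).
Qed.

Lemma Fsq_weight (H : R) f (C D xi : R) : 0 < H < 1 -> xi != 0 -> 0 <= C -> 0 <= D ->
  Fsq f xi <= C -> Fsq f xi <= D / xi ^+ 2 -> Fsq f xi <= (C + D) * freq_weight H xi.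
Proof.
move=> H01 xi0 C0 D0 fC fD; rewrite mulrDl.
have [x1|x1] := leP 1 `|xi|.
  apply: (le_trans fD); apply: (@le_trans _ _ (D * freq_weight H xi)).
    by rewrite ler_wpM2l// freq_weight_ge.
  by rewrite lerDr mulr_ge0// freq_weight_ge0.
by rewrite (freq_weight_lt1 H01 xi0 x1) !mulr1; apply: (le_trans fC); rewrite lerDl.
Qed.

(** The mass of the profile controls low frequencies and its height controls high ones. *)
Lemma Fsq_unimodal_weight (H : R) f (M I xi : R) : 0 < H < 1 -> xi != 0 -> unimodal f -> L1 f ->
  (forall x, f x <= M) -> \int[mu]_x f x <= I ->
  Fsq f xi <= (2 * I ^+ 2 + 8 * M ^+ 2) * freq_weight H xi.
Proof.
move=> H01 xi0 uf lf fM fI; apply: Fsq_weight => //.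
- by rewrite mulr_ge0 ?sqr_ge0.
- by rewrite mulr_ge0 ?sqr_ge0.
- have E : \int[mu]_x `|f x| = \int[mu]_x f x by apply: eq_Rintegral => x _; rewrite ger0_norm ?uf.1.
  have I0 : 0 <= \int[mu]_x f x by apply: Rintegral_ge0 => x _; exact: uf.1.
  apply: (le_trans (Fsq_le_L1 xi lf)); rewrite E ler_pM2l//.
  by rewrite ler_sqr ?nnegrE// (le_trans I0).
- exact: Fsq_unimodal.
Qed.

(** The integrand [1_[0,s] f] of the generators of the filtration. *)
Definition tens (s : R) f (z : R * R) : R := if 0 <= z.1 <= s then f z.2 else 0.

Lemma tens_measurable s f : measurable_fun setT f -> measurable_fun setT (tens s f).
Proof.
move=> mf; apply: measurable_fun_ifT => //.
  by apply: measurable_and; apply: measurable_fun_ler => //; exact: measurable_fst.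
exact: measurableT_comp mf measurable_snd.
Qed.

Lemma tens_slice s f t : (fun x => tens s f (t, x)) = fun x => (0 <= t <= s)%R%:R * f x.
Proof. by apply/funext => x; rewrite /tens /=; case: ifP; rewrite ?mul1r ?mul0r. Qed.

Lemma tens_nice s f : L1 f -> nice (tens s f).
Proof.
move=> lf; split.
- exact: tens_measurable (L1_measurable lf).
- by move=> t x t0; rewrite /tens/= [0 <= t]leNgt t0.
- by move=> t; rewrite tens_slice; exact: L1Z.
Qed.

Lemma FsqZ f c xi : L1 f -> Fsq (fun x => c * f x) xi = c ^+ 2 * Fsq f xi.
Proof.
move=> lf; rewrite /Fsq /FC /FS !wintZ//; try exact: osc_sin; try exact: osc_cos.
by ring.
Qed.

Lemma slice_sq_tens s f z : L1 f -> slice_sq (tens s f) z = (0 <= z.1 <= s)%R%:R * Fsq f z.2.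
Proof.
move=> lf; rewrite /slice_sq tens_slice FsqZ//.
by case: (0 <= z.1 <= s); rewrite ?expr1n ?expr0n.
Qed.

Lemma sqnorm_dominated_itv (H : R) (S : seq R) (s C : R) (f_ : nat -> R * R -> R) (f : R * R -> R) :
  0 < H < 1 -> 0 <= s -> 0 <= C -> (forall n, nice (f_ n)) -> nice f ->
  (forall n z, off S z -> slice_sq (f_ n) z <= C * (0 <= z.1 <= s)%R%:R * freq_weight H z.2) ->
  (forall z, off S z -> slice_sq f z <= C * (0 <= z.1 <= s)%R%:R * freq_weight H z.2) ->
  (forall z, off S z -> slice_sq (fun z => f_ n z - f z) z @[n --> \oo] --> 0) ->
  sqnorm H (fun z => f_ n z - f z)%R @[n --> \oo] --> 0%E.
Proof.
move=> H01 s0 C0 nn nf h1 h2 h3.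
have [K K0 hK] := sqnorm_weight H01.
pose tau (t : R) := C * \1_(`[0, s]%classic) t.
have mt : measurable_fun setT tau by apply: measurable_funM => //; exact: measurable_indic.
have tau0 t : 0 <= tau t by rewrite mulr_ge0.
have tauE t : tau t = C * (0 <= t <= s)%R%:R by rewrite /tau indicE mem_setE inE.
have tauI : (\int[mu]_t (tau t)%:E <= (C * s)%:E)%E.
  under eq_integral do rewrite EFinM.
  rewrite ge0_integralZl//; last exact/measurable_EFinP/measurable_indic.
  rewrite integral_indic// setIT EFinM; apply: lee_wpmul2l => //.
  by apply: (@le_trans _ _ (s - 0)%:E); [rewrite -mu_segment|rewrite subr0].
have Cs : 0 <= C * s by rewrite mulr_ge0.
apply: (@sqnorm_dominated _ _ H01 S f_ f (fun z => tau z.1 * freq_weight H z.2)) => //.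
- apply: measurable_funM; first exact: (measurableT_comp mt measurable_fst).
  exact: (measurableT_comp (measurable_freq_weight H) measurable_snd).
- exact: le_lt_trans (hK tau (C * s) mt tau0 Cs tauI) (ltry _).
- by move=> n z oz; rewrite tauE; exact: h1.
- by move=> z oz; rewrite tauE; exact: h2.
Qed.

End Profiles.

(** * From smooth bumps to unimodal profiles in space *)

Section AdaptedProfiles.
Context {R : realType} {d : measure_display} {Omega : measurableType d}.
Local Notation mu := (@lebesgue_measure R).
Variable P : probability Omega R.
Variable H : R.
Hypothesis H01 : 0 < H < 1.
Variable W : (R * R -> R) -> Omega -> R.
Hypothesis W_noise : is_noise P H W.
Implicit Types (f p : R -> R).
Variables (t s : R).
Hypothesis st : 0 <= s <= t.

Let s0 : 0 <= s. Proof. by case/andP: st. Qed.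

Lemma adapted_bump a b k : a < b -> 0 < k -> adapted_wi P H W t (tens s (bump a b k)).
Proof.
move=> ab k0; pose f := bump a b k.
have lf : L1 f := bump_L1 ab k0.
pose phi n (z : R * R) := if 0 <= z.1 then bump (-1) s n.+1%:R z.1 * f z.2 else 0.
(* Test functions are cut at time 0, so any negative left end does: only the jump at [s] has to be
   approximated. *)
have s1 : -1 < s by apply: lt_le_trans s0.
have tp n : C0_infty_half (phi n).
  by eexists; [exact: (tensor_bump_C0_infty s1 (ltr0Sn R n) ab k0)|].
pose c n (u : R) := (0 <= u)%R%:R * bump (-1) s n.+1%:R u.
have phiE n u : (fun x => phi n (u, x)) = fun x => c n u * f x.
  by apply/funext => x; rewrite /phi /c /=; case: ifP => _; rewrite ?mul1r ?mul0r.
have c0 n u : 0 <= c n u by rewrite mulr_ge0// bump_ge0.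
have c1 n u : c n u <= (0 <= u <= s)%R%:R.
  rewrite /c; have [u0|u0] := leP 0 u; last by rewrite mul0r.
  rewrite mul1r /=; apply: (le_trans (bump_le_indic _ _ _ (ltr0Sn R n))).
  rewrite indicE mem_setE in_itv/= ler_nat.
  by case: (ltP u s) => [/ltW->|]; [rewrite andbT; case: (-1 < u)|rewrite andbF].
apply: (adapted_wi_generator H01 W_noise st (bump_C0_infty ab k0) (tens_nice s lf) tp).
pose C := 2 * (\int[mu]_x f x) ^+ 2 + 8 * 1 ^+ 2.
have C0 : 0 <= C by apply: addr_ge0; apply: mulr_ge0 => //; exact: sqr_ge0.
have hF xi : xi != 0 -> Fsq f xi <= C * freq_weight H xi.
  by move=> xi0; apply: (Fsq_unimodal_weight H01 xi0 (bump_unimodal a b k0) lf) => // x; exact: bump_le1.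
(* At time [s] itself the bumps vanish while the indicator is 1, so [s] is an exceptional time. *)
apply: (@sqnorm_dominated_itv _ H [:: s] s C) => //.
- by move=> n; exact: test_nice.
- exact: tens_nice.
- move=> n z [_ xi0]; rewrite /slice_sq phiE FsqZ//.
  rewrite (mulrAC C) [leRHS]mulrC; apply: ler_pM; [exact: sqr_ge0|exact: Fsq_ge0| |exact: hF].
  have := c1 n z.1; have := c0 n z.1; case: (0 <= z.1 <= s) => /= h1 h2.
    by rewrite expr_le1.
  by rewrite (_ : c n z.1 = 0) ?expr0n//; apply/eqP; rewrite eq_le h1 h2.
- move=> z [_ xi0]; rewrite -/(tens s f) slice_sq_tens//.
  by rewrite (mulrAC C) [leRHS]mulrC ler_wpM2l// hF.
- move=> [u xi] [/= us _]; rewrite inE in us.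
  have E n : slice_sq (fun z => phi n z - tens s f z) (u, xi) = (c n u - (0 <= u <= s)%R%:R) ^+ 2 * Fsq f xi.
    rewrite /slice_sq /= -FsqZ//; congr Fsq; apply/funext => x.
    rewrite mulrBl; congr (_ - _); first exact: (congr1 (@^~ x) (phiE n u)).
    exact: (congr1 (@^~ x) (tens_slice s f u)).
  rewrite (funext E) -[X in _ --> X](mul0r (Fsq f xi)); apply: cvgM; last exact: cvg_cst.
  have cc : c n u @[n --> \oo] --> ((0 <= u <= s)%R%:R : R).
    rewrite /c; have [u0|u0] := leP 0 u; last first.
      by rewrite (_ : (fun n => _) = fun=> 0); [exact: cvg_cst|apply/funext => n; rewrite mul0r].
    rewrite (_ : (fun n => _) = fun n => bump (-1) s n.+1%:R u); last by apply/funext => n; rewrite mul1r.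
    have -> : (true && (u <= s))%:R = \1_(`]-1, s[%classic) u :> R.
      rewrite indicE mem_setE in_itv/= (lt_le_trans _ u0)//=.
      by rewrite lt_neqAle us.
    exact: cvg_bump.
  rewrite -[X in _ --> X](expr0n _ 2) -[X in X ^+ 2](subrr ((0 <= u <= s)%R%:R : R)).
  apply: (@cvg_comp _ _ _ _ (fun x : R => x ^+ 2) _ (nbhs ((0 <= u <= s)%R%:R - (0 <= u <= s)%R%:R : R))).
    by apply: cvgB => //; exact: cvg_cst.
  exact: exprn_continuous.
Qed.

Lemma adapted_tens_limit (p_ : nat -> R -> R) p (C : R) : (forall n, L1 (p_ n)) -> L1 p -> 0 <= C ->
  (forall n xi, xi != 0 -> Fsq (p_ n) xi <= C * freq_weight H xi) ->
  (forall xi, xi != 0 -> Fsq p xi <= C * freq_weight H xi) ->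
  (forall xi, FC (p_ n) xi @[n --> \oo] --> FC p xi) ->
  (forall xi, FS (p_ n) xi @[n --> \oo] --> FS p xi) ->
  (forall n, adapted_wi P H W t (tens s (p_ n))) -> adapted_wi P H W t (tens s p).
Proof.
move=> ln lp C0 hn hp cC cS an.
apply: (adapted_wi_limit H01 W_noise (tens_nice s lp) an).
apply: (@sqnorm_dominated_itv _ H [::] s C) => //.
- by move=> n; exact: tens_nice.
- exact: tens_nice.
- move=> n z [_ xi0]; rewrite slice_sq_tens//.
  by rewrite (mulrAC C) [leRHS]mulrC ler_wpM2l// hn.
- move=> z [_ xi0]; rewrite slice_sq_tens//.
  by rewrite (mulrAC C) [leRHS]mulrC ler_wpM2l// hp.
- move=> [u xi] _.
  have E n : slice_sq (fun z => tens s (p_ n) z - tens s p z) (u, xi) =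
      (0 <= u <= s)%R%:R ^+ 2 * ((FC (p_ n) xi - FC p xi) ^+ 2 + (FS (p_ n) xi - FS p xi) ^+ 2).
    transitivity (Fsq (fun x => (0 <= u <= s)%R%:R * (p_ n x - p x)) xi).
      rewrite /slice_sq /=; congr Fsq; apply/funext => x; rewrite mulrBr.
      by rewrite -(congr1 (@^~ x) (tens_slice s (p_ n) u)) -(congr1 (@^~ x) (tens_slice s p u)).
    rewrite FsqZ; last exact: L1B.
    by rewrite /Fsq /FC /FS !wintB//; try exact: osc_sin; try exact: osc_cos.
  rewrite (funext E) -[X in _ --> X](mulr0 ((0 <= u <= s)%R%:R ^+ 2)); apply: cvgM; first exact: cvg_cst.
  have sq (v : nat -> R) l : v n @[n --> \oo] --> l -> (v n - l) ^+ 2 @[n --> \oo] --> 0.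
    move=> cv; rewrite -[X in _ --> X](expr0n _ 2) -[X in X ^+ 2](subrr l).
    apply: (@cvg_comp _ _ _ _ (fun x : R => x ^+ 2) _ (nbhs (l - l))); last exact: exprn_continuous.
    by apply: cvgB => //; exact: cvg_cst.
  by rewrite -[X in _ --> X](addr0 0); apply: cvgD; apply: sq; [exact: cC|exact: cS].
Qed.

Lemma adapted_open_itv a b : a < b -> adapted_wi P H W t (tens s \1_(`]a, b[%classic)).
Proof.
move=> ab; have lO : L1 (\1_(`]a, b[%classic) : R -> R) := itv_L1 false true (ltW ab).
have IO : \int[mu]_x (\1_(`]a, b[%classic) x : R) = b - a.
  by rewrite Rintegral_indic//; transitivity (fine (b - a)%:E) => //; congr fine; exact: (mu_itv false true (ltW ab)).
have lB n : L1 (bump a b n.+1%:R) by exact: bump_L1.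
have mO : measurable_fun setT (\1_(`]a, b[%classic) : R -> R) by exact: measurable_indic.
have C0 : 0 <= 2 * (b - a) ^+ 2 + 8 * 1 ^+ 2 by apply: addr_ge0; apply: mulr_ge0 => //; exact: sqr_ge0.
have dom k : osc k -> wint k (bump a b n.+1%:R) @[n --> \oo] --> wint k \1_(`]a, b[%classic).
  move=> ok; apply: (dominated_wint ok _ mO _ lO) => [n|x|n x].
  - exact: bump_measurable.
  - exact: cvg_bump.
  - by rewrite ger0_norm ?bump_ge0//; exact: bump_le_indic.
apply: (adapted_tens_limit lB lO C0).
- move=> n xi xi0; apply: Fsq_unimodal_weight => //; [exact: bump_unimodal|by move=> x; exact: bump_le1|].
  by rewrite -IO; apply: le_Rintegral; [by []|exact: lB|exact: lO|move=> x _; exact: bump_le_indic].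
- move=> xi xi0; apply: Fsq_unimodal_weight => //; first exact: unimodal_itv.
  by rewrite IO.
- by move=> xi; apply: dom; exact: osc_cos.
- by move=> xi; apply: dom; exact: osc_sin.
- by move=> n; exact: adapted_bump.
Qed.

(** End points do not change any [wint], so the open interval, taken as a constant sequence,
    converges to each of the other kinds of interval. *)
Lemma adapted_itv a b b0 b1 : a <= b ->
  adapted_wi P H W t (tens s \1_[set` Interval (BSide b0 a) (BSide b1 b)]).
Proof.
move=> ab; set I := [set` _].
have mI : measurable I by exact: measurable_itv.
have lI : L1 (\1_I : R -> R) := itv_L1 b0 b1 ab.
have lO : L1 (\1_(`]a, b[%classic) : R -> R) := itv_L1 false true ab.
have OI x : \1_(`]a, b[%classic) x <= \1_I x :> R.
  rewrite !indicE !mem_setE ler_nat in_itv/=; case: (boolP (a < x < b)) => // /andP[h1 h2].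
  by rewrite itv_boundlr; case: b0 @I mI lI; case: b1 => *; rewrite /= !bnd_simp ?(ltW h1) ?(ltW h2) ?h1 ?h2.
have IE : \int[mu]_x (\1_I x : R) = \int[mu]_x (\1_(`]a, b[%classic) x : R).
  rewrite !Rintegral_indic//; congr fine.
  by transitivity (b - a)%:E; [exact: mu_itv|symmetry; exact: (mu_itv false true ab)].
have wE k : osc k -> wint k \1_I = wint k \1_(`]a, b[%classic).
  move=> ok; apply/eqP; rewrite -subr_eq0 -wintB// -normr_le0.
  apply: (le_trans (wint_le ok (L1B lI lO))).
  rewrite (_ : \int[mu]_x _ = \int[mu]_x (\1_I x - \1_(`]a, b[%classic) x)).
    by rewrite RintegralB// IE subrr.
  by apply: eq_Rintegral => x _; rewrite ger0_norm// subr_ge0.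
have aO : adapted_wi P H W t (tens s \1_(`]a, b[%classic)).
  have [ab'|ba] := ltP a b; first exact: adapted_open_itv.
  have := adapted_wi0 H01 W_noise t; congr adapted_wi; apply/funext => z.
  rewrite /tens indicE mem_setE in_itv/=.
  by rewrite (_ : (a < z.2 < b) = false) ?if_same//; apply/negP => /andP[h1 h2]; lra.
have C0 : 0 <= 2 * (\int[mu]_x (\1_I x : R)) ^+ 2 + 8 * 1 ^+ 2.
  by apply: addr_ge0; apply: mulr_ge0 => //; exact: sqr_ge0.
have FE xi : Fsq \1_(`]a, b[%classic) xi = Fsq \1_I xi.
  by rewrite /Fsq /FC /FS !wE//; try exact: osc_sin; try exact: osc_cos.
have bd xi : xi != 0 -> Fsq \1_I xi <= (2 * (\int[mu]_x (\1_I x : R)) ^+ 2 + 8 * 1 ^+ 2) * freq_weight H xi.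
  by move=> xi0; apply: Fsq_unimodal_weight => //; exact: unimodal_itv.
apply: (adapted_tens_limit (fun=> lO) lI C0) => //.
- by move=> _ xi xi0; rewrite FE; exact: bd.
- by move=> xi; rewrite /FC wE; [exact: cvg_cst|exact: osc_cos].
- by move=> xi; rewrite /FS wE; [exact: cvg_cst|exact: osc_sin].
Qed.

(** The staircases are combinations of interval indicators. Their transforms have a bound uniform in
    [m]: the mass is at most that of [p], and [wint_stair_le] applies with height at most
    [M + 1]. *)
Lemma adapted_unimodal p (M : R) : unimodal p -> L1 p -> (forall x, p x <= M) ->
  adapted_wi P H W t (tens s p).
Proof.
move=> up lp pM; have p0 := up.1; have M0 : 0 <= M := le_trans (p0 0) (pM 0).
pose q m := stair p m (stair_height M m).
have lq m : L1 (q m) := stair_L1 m (stair_height M m) p0 lp.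
have I0 : 0 <= \int[mu]_x p x by apply: Rintegral_ge0 => x _; exact: p0.
have hM m : (stair_height M m)%:R / m.+1%:R <= M + 1.
  by apply: (le_trans (stair_height_le m M0)); rewrite lerD2l invf_le1 ?ler1n.
have bd (f : R -> R) xi : xi != 0 -> L1 f -> (forall x, 0 <= f x <= p x) ->
    (forall k, osc k -> osc_bound k (2 / `|xi|) -> `|wint k f| <= (M + 1) * (2 / `|xi|)) ->
    Fsq f xi <= (2 * (\int[mu]_x p x) ^+ 2 + 8 * (M + 1) ^+ 2) * freq_weight H xi.
  move=> xi0 lf fp hf; apply: Fsq_weight => //.
  - by apply: mulr_ge0 => //; exact: sqr_ge0.
  - by apply: mulr_ge0 => //; exact: sqr_ge0.
  - apply: (le_trans (Fsq_le_L1 xi lf)); rewrite ler_pM2l// ler_sqr ?nnegrE//; last by apply: Rintegral_ge0.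
    by apply: le_Rintegral => //; [exact: L1_norm|move=> x _; case/andP: (fp x) => h1 h2; rewrite ger0_norm].
  - have h1 := hf _ (osc_cos xi) (osc_bound_cos xi0).
    have h2 := hf _ (osc_sin xi) (osc_bound_sin xi0).
    rewrite /Fsq /FC /FS; apply: (le_trans (lerD (sqr_le_norm h1) (sqr_le_norm h2))).
    rewrite !exprMn exprVn real_normK ?num_real// le_eqVlt; apply/orP; left; apply/eqP.
    by field.
have C0 : 0 <= 2 * (\int[mu]_x p x) ^+ 2 + 8 * (M + 1) ^+ 2.
  by apply: addr_ge0; apply: mulr_ge0 => //; exact: sqr_ge0.
have pM' x : 0 <= p x <= M by rewrite p0 pM.
apply: (adapted_tens_limit lq lp C0).
- move=> m xi xi0; apply: bd => //; first by move=> x; exact: stair_le.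
  move=> k ok kL; apply: (le_trans (wint_stair_le m (stair_height M m) ok kL up lp)).
  by rewrite ler_wpM2r ?divr_ge0.
- move=> xi xi0; apply: bd => //; first by move=> x; rewrite p0 /=.
  move=> k ok kL; apply: (le_trans (wint_unimodal ok kL up pM lp)).
  by rewrite ler_wpM2r ?divr_ge0// lerDl.
- by move=> xi; apply: cvg_wint_stair => //; exact: osc_cos.
- by move=> xi; apply: cvg_wint_stair => //; exact: osc_sin.
- move=> m.
  have := adapted_wi_sum H01 W_noise (stair_height M m)
    (g := fun j => fun z => m.+1%:R^-1 * tens s \1_(level p m j) z).
  have -> : (fun z => \sum_(j < stair_height M m) m.+1%:R^-1 * tens s \1_(level p m j) z) = tens s (q m).
    apply/funext => z; rewrite /tens /q /stair; case: ifP => // _.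
    by apply: big1 => j _; rewrite mulr0.
  apply=> j; apply: (adapted_wiZ H01 W_noise).
  have [a [b [b0 [b1 [ab ->]]]]] := is_interval_L1 (@level_interval _ p m j up) (@level_L1 _ p m j p0 lp).
  exact: adapted_itv.
Qed.

End AdaptedProfiles.

(** * Mild integrands *)

Section PowerWeights.
Context {R : realType}.
Variables (H T : R).
Hypothesis H01 : 0 < H < 1.
Hypothesis T0 : 0 < T.

Lemma min_interp (a b th : R) : 0 <= a -> 0 <= b -> 0 <= th <= 1 ->
  Num.min a b <= a `^ (1 - th) * b `^ th.
Proof.
move=> a0 b0 /andP[th0 th1]; have m0 : 0 <= Num.min a b by rewrite le_min a0 b0.
have [E|m1] := eqVneq (Num.min a b) 0; first by rewrite E mulr_ge0 ?powR_ge0.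
have -> : Num.min a b = Num.min a b `^ (1 - th) * Num.min a b `^ th.
  by rewrite -powRD ?subrK ?powRr1// m1 implybT.
apply: ler_pM; rewrite ?powR_ge0//; apply: ge0_ler_powR; rewrite ?nnegrE ?subr_ge0//.
  by rewrite ge_min lexx.
by rewrite ge_min lexx orbT.
Qed.

(** Up to a constant, the bound for the squared transform of a kernel at time [r]: the mass gives 1
    and the height gives [1 / (r xi^2)]. *)
Definition decay (r xi : R) : R := Num.min 1 ((r * xi ^+ 2)^-1).

Lemma decay_ge0 r xi : 0 < r -> 0 <= decay r xi.
Proof. by move=> r0; rewrite le_min ler01 invr_ge0 mulr_ge0 ?sqr_ge0// ltW. Qed.

Lemma decay_mono r s xi : 0 < r -> r <= s -> decay s xi <= decay r xi.
Proof.
move=> r0 rs; have s0 := lt_le_trans r0 rs.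
rewrite le_min ge_min lexx /= ge_min; apply/orP; right.
have [->|xi0] := eqVneq xi 0; first by rewrite expr0n !mulr0.
have x2 : 0 < xi ^+ 2 by rewrite lt_neqAle eq_sym sqrf_eq0 xi0 sqr_ge0.
by move: (xi ^+ 2) x2 => u u0; rewrite lef_pV2 ?posrE ?mulr_gt0// ler_pM2r.
Qed.

(** Since [decay] is at most 1, the exponent can be lowered from [p] to the [a] with the desired
    power of [r]. At low frequencies the factor [r ^ - a] is inserted at the price of [T ^ a]. *)
Lemma decay_pow (a p r xi : R) : 0 <= a -> a <= p -> p <= 1 -> 0 < r <= T -> xi != 0 ->
  decay r xi `^ p <= (1 + T `^ a) * (r `^ (- a) * (if 1 <= `|xi| then `|xi| `^ (- (2 * a)) else 1)).
Proof.
move=> a0 ap p1 /andP[r0 rT] xi0; have p0 := le_trans a0 ap.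
have x0 : 0 < `|xi| by rewrite normr_gt0.
have ra0 := powR_ge0 r (- a).
rewrite mulrDl mul1r; case: ifPn => x1.
  have y0 : 0 < (r * xi ^+ 2)^-1.
    by rewrite invr_gt0 mulr_gt0// -real_normK ?num_real// exprn_gt0.
  have q0 : 0 < decay r xi by rewrite lt_min ltr01 y0.
  apply: (@le_trans _ _ (decay r xi `^ a)).
    by apply: ger_powR => //; rewrite q0 ge_min lexx.
  apply: (@le_trans _ _ ((r * xi ^+ 2)^-1 `^ a)).
    by apply: ge0_ler_powR; rewrite ?nnegrE ?(ltW q0) ?(ltW y0)// ge_min lexx orbT.
  rewrite -powR_inv1; last by rewrite mulr_ge0 ?sqr_ge0// ltW.
  rewrite -powRrM mulN1r powRM ?sqr_ge0 ?(ltW r0)//.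
  rewrite -real_normK ?num_real// -powR_mulrn// -powRrM mulrN.
  by rewrite lerDl mulr_ge0 ?powR_ge0// mulr_ge0 ?powR_ge0.
apply: (@le_trans _ _ 1).
  have e1 : (1 : R) `^ p = 1 by rewrite powR1.
  rewrite -[leRHS]e1; apply: ge0_ler_powR; rewrite ?nnegrE//; first exact: decay_ge0.
  by rewrite ge_min lexx.
rewrite mulr1 [leLHS](_ : 1 = r `^ a * r `^ (- a)); last first.
  by rewrite -powRD ?subrr ?powRr0// implybE (gt_eqF r0) orbT.
apply: (@le_trans _ _ (T `^ a * r `^ (- a))); last by rewrite lerDr.
by apply: ler_wpM2r => //; apply: ge0_ler_powR => //; rewrite nnegrE ltW.
Qed.

Lemma freq_weight_ge1 (xi : R) : 1 <= `|xi| -> freq_weight H xi = `|xi| `^ (H - 2).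
Proof.
have /andP[H0 H1] := H01; move=> x1; apply/min_idPr; rewrite -[leRHS](powRr0 `|xi|).
by apply: ler_powR => //; lra.
Qed.

(** Interpolation with weight [H / 8] gives [(h / r) ^ (H / 4)] and leaves [decay] with exponent
    [1 - H / 8], which is lowered to [1 - H / 2]. This produces [|xi| ^ (H - 2)] and, in all, the
    power [- (1 - H / 2) - H / 4 = - (1 - H / 4)] of [r]. *)
Lemma decay_time : exists2 K : R, 0 <= K & forall r h xi, 0 < r <= T -> 0 <= h -> xi != 0 ->
  Num.min (decay r xi) ((h / r) ^+ 2) <= K * h `^ (H / 4) * (r `^ (- (1 - H / 4)) * freq_weight H xi).
Proof.
have /andP[H0 H1] := H01.
exists (1 + T `^ (1 - H / 2)); first by rewrite addr_ge0 ?powR_ge0.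
move=> r h xi /andP[r0 rT] h0 xi0.
have hr0 : 0 <= h / r by rewrite divr_ge0// ltW.
apply: (le_trans (min_interp (th := H / 8) (decay_ge0 xi r0) (sqr_ge0 _) _)).
  by apply/andP; split; lra.
have -> : ((h / r) ^+ 2) `^ (H / 8) = h `^ (H / 4) * r `^ (- (H / 4)).
  rewrite -powR_mulrn// -powRrM powRM ?invr_ge0// 1?ltW//.
  rewrite -(powR_inv1 (ltW r0)) -powRrM (_ : 2%:R * (H / 8) = H / 4); last by field.
  by rewrite mulN1r.
have hd : decay r xi `^ (1 - H / 8) <= (1 + T `^ (1 - H / 2)) *
    (r `^ (- (1 - H / 2)) * (if 1 <= `|xi| then `|xi| `^ (- (2 * (1 - H / 2))) else 1)).
  by apply: decay_pow; rewrite ?r0 ?rT//; lra.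
apply: (le_trans (ler_wpM2r _ hd)); first by rewrite mulr_ge0 ?powR_ge0.
have -> : r `^ (- (1 - H / 4)) = r `^ (- (1 - H / 2)) * r `^ (- (H / 4)).
  rewrite -powRD ?implybE ?(gt_eqF r0) ?orbT//; congr (_ `^ _); by field.
have -> : (if 1 <= `|xi| then `|xi| `^ (- (2 * (1 - H / 2))) else 1) = freq_weight H xi.
  case: ifPn => x1; first by rewrite freq_weight_ge1//; congr (_ `^ _); field.
  by rewrite freq_weight_lt1// ltNge.
by rewrite le_eqVlt; apply/orP; left; apply/eqP; ring.
Qed.

(** The case [h = r] of [decay_time], where the minimum is [decay] itself. *)
Lemma decay_base : exists2 K : R, 0 <= K & forall r xi, 0 < r <= T -> xi != 0 ->
  decay r xi <= K * (r `^ (- (1 - H / 4)) * freq_weight H xi).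
Proof.
have /andP[H0 H1] := H01; have [K K0 hK] := decay_time.
exists (K * T `^ (H / 4)); first by rewrite mulr_ge0 ?powR_ge0.
move=> r xi rT xi0; have /andP[r0 rT'] := rT.
have := hK r r xi rT (ltW r0) xi0; rewrite divff ?gt_eqF// expr1n (min_idPl _); last by rewrite ge_min lexx.
move=> h; apply: (le_trans h); apply: ler_wpM2r; first by rewrite mulr_ge0 ?powR_ge0 ?freq_weight_ge0.
by rewrite ler_wpM2l//; apply: ge0_ler_powR; rewrite ?nnegrE ?(ltW r0) ?(ltW T0)// divr_ge0// ltW.
Qed.

(** [min(1, u^2) <= u ^ (H / 4)] costs [|xi| ^ (H / 4)]. With [decay] lowered to the exponent
    [1 - H / 4] the frequency exponent is [3 H / 4 - 2], still below [H - 2]. *)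
Lemma decay_space : exists2 K : R, 0 <= K & forall r y xi, 0 < r <= T -> 0 <= y -> xi != 0 ->
  decay r xi * Num.min 1 ((xi * y) ^+ 2) <= K * y `^ (H / 4) * (r `^ (- (1 - H / 4)) * freq_weight H xi).
Proof.
have /andP[H0 H1] := H01.
exists (1 + T `^ (1 - H / 4)); first by rewrite addr_ge0 ?powR_ge0.
move=> r y xi /andP[r0 rT] y0 xi0.
have x0 : 0 < `|xi| by rewrite normr_gt0.
have hd : decay r xi `^ 1 <= (1 + T `^ (1 - H / 4)) *
    (r `^ (- (1 - H / 4)) * (if 1 <= `|xi| then `|xi| `^ (- (2 * (1 - H / 4))) else 1)).
  by apply: decay_pow; rewrite ?r0 ?rT//; lra.
rewrite powRr1 in hd; last exact: decay_ge0.
have hy : Num.min 1 ((xi * y) ^+ 2) <= `|xi| `^ (H / 4) * y `^ (H / 4).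
  rewrite -powRM// -real_normK ?num_real// normrM (ger0_norm y0).
  set u := `|xi| * y; have u0 : 0 <= u by rewrite mulr_ge0.
  have [u1|u1] := leP 1 u.
    rewrite ge_min -[X in X <= _](powRr0 u); apply/orP; left.
    by apply: ler_powR => //; lra.
  rewrite ge_min; apply/orP; right; move: u0; rewrite le_eqVlt => /predU1P[<-|u0].
    by rewrite expr0n powR_ge0.
  by rewrite -(powR_mulrn 2 (ltW u0)); apply: ger_powR; [rewrite u0 ltW|lra].
apply: (le_trans (ler_pM (decay_ge0 xi r0) _ hd hy)).
  by rewrite le_min ler01 sqr_ge0.
rewrite -!mulrA ler_wpM2l ?addr_ge0 ?powR_ge0//.
have key : (if 1 <= `|xi| then `|xi| `^ (- (2 * (1 - H / 4))) else 1) * `|xi| `^ (H / 4) <= freq_weight H xi.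
  case: ifPn => x1.
    rewrite freq_weight_ge1// -powRD; last by rewrite implybE (gt_eqF x0) orbT.
    by apply: ler_powR => //; lra.
  rewrite -ltNge in x1; rewrite freq_weight_lt1// mul1r.
  have e1 : (1 : R) `^ (H / 4) = 1 by rewrite powR1.
  rewrite -[leRHS]e1; apply: ge0_ler_powR; rewrite ?nnegrE// ?(ltW x1)//.
  by rewrite divr_ge0// ltW.
move: key; set J := if _ then _ else _; set X := _ `^ (H / 4); set Y := y `^ _; set Q := r `^ _ => key.
have -> : Q * (J * (X * Y)) = (Y * Q) * (J * X) by ring.
by rewrite (mulrA Y); apply: ler_wpM2l => //; apply: mulr_ge0; exact: powR_ge0.
Qed.

End PowerWeights.

(** * Increments of the mild integrand for a general kernel *)

Section GoodKernel.
Context {R : realType}.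
Local Notation mu := (@lebesgue_measure R).
Local Notation mu2 := (mu \x mu)%E.

(** The common properties through which both equations are treated. [kernel0] records a default
    value: for the heat kernel it comes from the convention that a nonzero power of 0 is 0. *)
Record good_kernel (T C : R) (G : R -> R -> R) : Prop := GoodKernel {
  kernel_measurable : measurable_fun setT (fun z : R * R => G z.1 z.2);
  kernel0 : forall x, G 0 x = 0;
  kernel_ge0 : forall r x, 0 < r -> 0 <= G r x;
  kernel_norm : forall r x, G r x = G r `|x|;
  kernel_decr : forall r x y, 0 < r -> 0 <= x -> x <= y -> G r y <= G r x;
  kernel_L1 : forall r, 0 < r <= T -> L1 (G r);
  kernel_mass : forall r, 0 < r <= T -> \int[mu]_x G r x <= C;
  kernel_sup : forall r x, 0 < r <= T -> G r x ^+ 2 <= C / r;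
  kernel_incr : forall r h, 0 < r -> 0 <= h -> r + h <= T ->
    \int[mu]_x `|G (r + h) x - G r x| <= C * (h / r) }.

Variables (H T C : R) (G : R -> R -> R).
Hypothesis H01 : 0 < H < 1.
Hypothesis T0 : 0 < T.
Hypothesis gk : good_kernel T C G.

Definition mild (t x : R) (z : R * R) : R :=
  if 0 <= z.1 <= t then G (t - z.1) (x - z.2) else 0.

Let C0 : 0 <= C.
Proof.
apply: le_trans (kernel_mass gk (r := T) _); last by rewrite T0 lexx.
by apply: Rintegral_ge0 => x _; exact: (kernel_ge0 gk).
Qed.

Let kernel_even r x y : G r (x - y) = G r (y - x).
Proof. by rewrite (kernel_norm gk) distrC -(kernel_norm gk). Qed.

Lemma mild_slice t x s : 0 <= s <= t ->
  (fun y => mild t x (s, y)) = fun y => G (t - s) (y - x).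
Proof. by move=> st; apply/funext => y; rewrite /mild /= st kernel_even. Qed.

Lemma mild_slice0 t x s : ~~ (0 <= s <= t) -> (fun y => mild t x (s, y)) = fun=> 0.
Proof. by move=> st; apply/funext => y; rewrite /mild /= (negbTE st). Qed.

Lemma Fsq0 xi : Fsq (fun=> 0 : R) xi = 0.
Proof. by rewrite /Fsq /FC /FS !wint0 expr0n addr0. Qed.

Lemma sliceB (f g : R * R -> R) (f1 g1 : R -> R) s xi : (fun y => f (s, y)) = f1 ->
  (fun y => g (s, y)) = g1 -> slice_sq (fun z => f z - g z) (s, xi) = Fsq (fun y => f1 y - g1 y) xi.
Proof. by move=> <- <-. Qed.

Lemma kernel_L1_le r : 0 <= r <= T -> L1 (G r).
Proof.
move=> /andP[]; rewrite le_eqVlt => /predU1P[<- _|r0 rT].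
  by rewrite (_ : G 0 = fun=> 0); [exact: L1_0|apply/funext => x; rewrite (kernel0 gk)].
by apply: (kernel_L1 gk); rewrite r0.
Qed.

Lemma mild_slice_L1 t x s : t <= T -> L1 (fun y => mild t x (s, y)).
Proof.
move=> tT; have [st|st] := boolP (0 <= s <= t); last by rewrite mild_slice0//; exact: L1_0.
rewrite mild_slice//; apply: L1_shift; apply: kernel_L1_le.
by case/andP: st => s0 st; apply/andP; split; lra.
Qed.

Lemma mild_measurable t x : measurable_fun setT (mild t x).
Proof.
apply: measurable_fun_ifT => //.
  by apply: measurable_and; apply: measurable_fun_ler => //; exact: measurable_fst.
apply: (measurableT_comp (f := fun z : R * R => G z.1 z.2) (g := fun z : R * R => (t - z.1, x - z.2)) (kernel_measurable gk)).
by apply/measurable_fun_pairP; split; exact: measurable_funB.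
Qed.

Lemma mild_nice t x : t <= T -> nice (mild t x).
Proof.
move=> tT; split.
- exact: mild_measurable.
- by move=> s y s0; rewrite /mild/= [0 <= s]leNgt s0.
- by move=> s; exact: mild_slice_L1.
Qed.

Lemma kernel_unimodal r x : 0 < r -> unimodal (fun y => G r (y - x)).
Proof.
move=> r0; rewrite (_ : (fun y => _) = fun y => G r `|y - x|); last first.
  by apply/funext => y; exact: (kernel_norm gk).
apply: unimodal_sym => [y|a b a0 ab]; first exact: (kernel_ge0 gk).
exact: (kernel_decr gk).
Qed.

Lemma kernel_le_sqrt r y : 0 < r <= T -> G r y <= Num.sqrt (C / r).
Proof.
move=> rT; have /andP[r0 _] := rT; rewrite -(ger0_norm (kernel_ge0 gk y r0)) -sqrtr_sqr.
by rewrite ler_wsqrtr// (kernel_sup gk).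
Qed.

(** [2 C ^ 2] comes from the mass, and [8 C] from [Fsq_unimodal] with squared height [C / r]. *)
Let Cf : R := 2 * C ^+ 2 + 8 * C.

Let Cf0 : 0 <= Cf.
Proof. by apply: addr_ge0; apply: mulr_ge0 => //; exact: sqr_ge0. Qed.

Lemma Fsq_kernel r xi : 0 < r <= T -> xi != 0 -> Fsq (G r) xi <= Cf * decay r xi.
Proof.
move=> rT xi0; have /andP[r0 _] := rT; have l := kernel_L1 gk rT.
have x2 : 0 < xi ^+ 2 by rewrite lt_neqAle eq_sym sqrf_eq0 xi0 sqr_ge0.
have I0 : 0 <= \int[mu]_x G r x by apply: Rintegral_ge0 => x _; exact: (kernel_ge0 gk).
have h1 : Fsq (G r) xi <= 2 * C ^+ 2.
  apply: (le_trans (Fsq_le_L1 xi l)); rewrite ler_pM2l//.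
  have -> : \int[mu]_x `|G r x| = \int[mu]_x G r x.
    by apply: eq_Rintegral => x _; rewrite ger0_norm// (kernel_ge0 gk).
  by rewrite ler_sqr ?nnegrE// (kernel_mass gk).
have h2 : Fsq (G r) xi <= 8 * C * (r * xi ^+ 2)^-1.
  have u : unimodal (G r).
    by have := kernel_unimodal 0 r0; congr unimodal; apply/funext => y; rewrite subr0.
  have := Fsq_unimodal xi0 u (fun y => kernel_le_sqrt y rT) l.
  have Cr : 0 <= C / r by rewrite divr_ge0// ltW.
  rewrite sqr_sqrtr// => h; apply: (le_trans h).
  by rewrite le_eqVlt; apply/orP; left; apply/eqP; field; rewrite xi0 gt_eqF.
rewrite /decay; case: (leP 1 ((r * xi ^+ 2)^-1)) => [h|h].
  by rewrite mulr1; apply: (le_trans h1); rewrite /Cf lerDl mulr_ge0.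
apply: (le_trans h2); apply: ler_wpM2r; first by rewrite invr_ge0; apply: mulr_ge0; exact: ltW.
by rewrite /Cf lerDr; apply: mulr_ge0 => //; exact: sqr_ge0.
Qed.

(** Two bounds: the triangle inequality with [decay] nonincreasing in time gives the first term of
    the minimum, and the L1 distance of [kernel_incr] gives the second. *)
Lemma Fsq_kernel_time r h xi : 0 < r -> 0 <= h -> r + h <= T -> xi != 0 ->
  Fsq (fun x => G (r + h) x - G r x) xi <=
    (4 * Cf + 2 * C ^+ 2) * Num.min (decay r xi) ((h / r) ^+ 2).
Proof.
move=> r0 h0 rhT xi0.
have rT : 0 < r <= T by rewrite r0 /= (le_trans _ rhT)// lerDl.
have rhT' : 0 < r + h <= T by rewrite rhT ltr_wpDr.
have l1 := kernel_L1 gk rT; have l2 := kernel_L1 gk rhT'.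
have d0 := decay_ge0 xi r0.
have hr0 : 0 <= h / r by rewrite divr_ge0// ltW.
have I0 : 0 <= \int[mu]_x `|G (r + h) x - G r x| by apply: Rintegral_ge0.
have h1 : Fsq (fun x => G (r + h) x - G r x) xi <= 4 * Cf * decay r xi.
  apply: (le_trans (Fsq_B_le xi l2 l1)).
  have k1 := Fsq_kernel rT xi0; have k2 := Fsq_kernel rhT' xi0.
  have k3 : Cf * decay (r + h) xi <= Cf * decay r xi.
    by apply: ler_wpM2l => //; apply: decay_mono => //; rewrite lerDl.
  rewrite -mulrA; move: k1 k2 k3; set a := Fsq _ _; set b := Fsq _ _; set c := Cf * _; set e := Cf * _; lra.
have h2 : Fsq (fun x => G (r + h) x - G r x) xi <= 2 * C ^+ 2 * (h / r) ^+ 2.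
  apply: (le_trans (Fsq_le_L1 xi (L1B l2 l1))); rewrite -mulrA ler_pM2l// -exprMn.
  have n0 : 0 <= C * (h / r) by exact: mulr_ge0.
  by rewrite ler_sqr ?nnegrE//; exact: (kernel_incr gk).
have c1 : 0 <= 2 * C ^+ 2 by apply: mulr_ge0 => //; exact: sqr_ge0.
have c2 : 0 <= 4 * Cf by apply: mulr_ge0.
case: (leP (decay r xi) ((h / r) ^+ 2)) => _.
  by apply: (le_trans h1); rewrite ler_wpM2r// lerDl.
by apply: (le_trans h2); apply: ler_wpM2r; [exact: sqr_ge0|rewrite lerDr].
Qed.

(** The shift factor [2 - 2 cos] is at most 4 and at most the square of its argument. *)
Lemma Fsq_kernel_space r x x' xi : 0 < r <= T -> xi != 0 ->
  Fsq (fun y => G r (y - x) - G r (y - x')) xi <=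
    4 * Cf * (decay r xi * Num.min 1 ((xi * `|x - x'|) ^+ 2)).
Proof.
move=> rT xi0; have /andP[r0 _] := rT; have l := kernel_L1 gk rT; have d0 := decay_ge0 xi r0.
have hF := Fsq_kernel rT xi0; have F0 := Fsq_ge0 (G r) xi.
have -> : (xi * `|x - x'|) ^+ 2 = (xi * (x - x')) ^+ 2 by rewrite !exprMn real_normK ?num_real.
case: (leP 1 ((xi * (x - x')) ^+ 2)) => _.
  rewrite mulr1 -mulrA Fsq_shiftB//.
  apply: (@le_trans _ _ (4 * Fsq (G r) xi)); last by rewrite ler_pM2l.
  by apply: ler_wpM2r => //; have := cos_geN1 (xi * (x - x')); lra.
apply: (le_trans (Fsq_shiftB_le x x' xi l)).
rewrite [leRHS]mulrA mulrC; apply: ler_wpM2r; first exact: sqr_ge0.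
by rewrite -mulrA; apply: (le_trans hF); apply: ler_peMl; [exact: mulr_ge0|rewrite ler1n].
Qed.

Lemma sqnorm_le_weight (S : seq R) (g : R * R -> R) (tau : R -> R) (A K : R) :
  (forall (tau : R -> R) (A : R), measurable_fun setT tau -> (forall s, 0 <= tau s) ->
    0 <= A -> (\int[mu]_s (tau s)%:E <= A%:E)%E ->
    (\int[mu2]_z (`|tau z.1 * freq_weight H z.2| * spectral_density H z.2)%:E <= (A * K)%:E)%E) ->
  nice g -> measurable_fun setT tau -> (forall s, 0 <= tau s) -> 0 <= A ->
  (\int[mu]_s (tau s)%:E <= A%:E)%E ->
  (forall s xi, s \notin S -> xi != 0 -> slice_sq g (s, xi) <= tau s * freq_weight H xi) ->
  (sqnorm H g <= (A * K)%:E)%E.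
Proof.
move=> hK ng mt t0 A0 hA hg; apply: le_trans (hK tau A mt t0 A0 hA).
apply: (@sqnorm_le _ _ H01 S) => //; last by move=> [s xi] [/= h1 h2]; exact: hg.
apply: measurable_funM; first exact: (measurableT_comp mt measurable_fst).
exact: (measurableT_comp (measurable_freq_weight H) measurable_snd).
Qed.

Lemma time_weight_intZ a b c : a <= b -> 0 <= c ->
  (\int[mu]_s (c * time_weight H a b s)%:E <= (c * ((b - a) `^ (H / 4) / (H / 4)))%:E)%E.
Proof.
move=> ab c0; under eq_integral do rewrite EFinM.
rewrite ge0_integralZl//; last 2 first.
- by apply/measurable_EFinP; exact: measurable_time_weight.
- by move=> s _; rewrite lee_fin time_weight_ge0.
by rewrite EFinM; apply: lee_wpmul2l => //; exact: time_weight_int.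
Qed.

Lemma mild_space_increment : exists2 K : R, 0 <= K & forall t x x', 0 <= t <= T ->
  (sqnorm H (fun z => mild t x z - mild t x' z)%R <= (K * `|x - x'| `^ (H / 4))%:E)%E.
Proof.
have /andP[H0 H1] := H01.
have [K K0 hK] := sqnorm_weight H01; have [Ks Ks0 hKs] := decay_space H01 T0.
have TH0 : 0 <= T `^ (H / 4) / (H / 4) by rewrite divr_ge0 ?powR_ge0// divr_ge0// ltW.
have c4 : 0 <= 4 * Cf by exact: mulr_ge0.
exists (4 * Cf * Ks * (T `^ (H / 4) / (H / 4)) * K).
  exact: (mulr_ge0 (mulr_ge0 (mulr_ge0 c4 Ks0) TH0) K0).
move=> t x x' /andP[t0 tT]; pose c := 4 * Cf * (Ks * `|x - x'| `^ (H / 4)).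
have c0 : 0 <= c by exact: (mulr_ge0 c4 (mulr_ge0 Ks0 (powR_ge0 _ _))).
have -> : 4 * Cf * Ks * (T `^ (H / 4) / (H / 4)) * K * `|x - x'| `^ (H / 4) =
    c * (T `^ (H / 4) / (H / 4)) * K by rewrite /c; ring.
apply: (@sqnorm_le_weight [:: t] _ (fun s => c * time_weight H 0 t s) (c * (T `^ (H / 4) / (H / 4))) K hK).
- by apply: niceB; exact: mild_nice.
- by apply: measurable_funM => //; exact: measurable_time_weight.
- by move=> s; rewrite mulr_ge0// time_weight_ge0.
- by rewrite mulr_ge0.
- apply: (le_trans (time_weight_intZ t0 c0)); rewrite lee_fin ler_wpM2l// subr0.
  rewrite ler_wpM2r ?invr_ge0 ?divr_ge0 ?(ltW H0)//.
  by apply: ge0_ler_powR; rewrite ?nnegrE ?divr_ge0 ?(ltW H0) ?(ltW T0).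
- move=> s xi; rewrite inE => st xi0.
  have [h|h] := boolP (0 <= s <= t); last first.
    rewrite (sliceB xi (mild_slice0 x h) (mild_slice0 x' h)).
    rewrite (_ : (fun y => _) = fun=> 0); last by apply/funext => y; rewrite subrr.
    by rewrite Fsq0 !mulr_ge0// ?time_weight_ge0 ?freq_weight_ge0.
  have /andP[s0 st'] := h.
  have rT : 0 < t - s <= T by rewrite subr_gt0 lt_neqAle st st'; lra.
  rewrite (sliceB xi (mild_slice x h) (mild_slice x' h)).
  apply: (le_trans (Fsq_kernel_space x x' rT xi0)).
  have -> : time_weight H 0 t s = (t - s) `^ (- (1 - H / 4)).
    by rewrite /time_weight s0 lt_neqAle st st'.
  apply: (le_trans (ler_wpM2l c4 (hKs _ _ _ rT (normr_ge0 _) xi0))).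
  by rewrite /c le_eqVlt; apply/orP; left; apply/eqP; ring.
Qed.

(** Before time [t] the two kernels are compared by [Fsq_kernel_time]. Between [t] and [t'] only the
    later one is present, and there the integral of the time weight over [[t, t']] itself supplies
    [(t' - t) ^ (H / 4)]. *)
Lemma mild_time_increment : exists2 K : R, 0 <= K & forall t t' x, 0 <= t -> t <= t' -> t' <= T ->
  (sqnorm H (fun z => mild t' x z - mild t x z)%R <= (K * (t' - t) `^ (H / 4))%:E)%E.
Proof.
have /andP[H0 H1] := H01.
have [K K0 hK] := sqnorm_weight H01.
have [Kt Kt0 hKt] := decay_time H01 T0; have [Kb Kb0 hKb] := decay_base H01 T0.
have H4 : 0 <= H / 4 by rewrite divr_ge0// ltW.
have TH0 : 0 <= T `^ (H / 4) / (H / 4) by rewrite divr_ge0 ?powR_ge0.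
pose Ct := 4 * Cf + 2 * C ^+ 2.
have Ct0 : 0 <= Ct by apply: addr_ge0; apply: mulr_ge0 => //; exact: sqr_ge0.
pose D := Ct * Kt * (T `^ (H / 4) / (H / 4)) + Cf * Kb / (H / 4).
have D0 : 0 <= D.
  apply: addr_ge0; first exact: (mulr_ge0 (mulr_ge0 Ct0 Kt0) TH0).
  by apply: mulr_ge0; [exact: mulr_ge0|rewrite invr_ge0].
exists (D * K); first exact: mulr_ge0.
move=> t t' x t0 tt' tT'; pose h := t' - t; have h0 : 0 <= h by rewrite subr_ge0.
have tT := le_trans tt' tT'.
pose c := Ct * (Kt * h `^ (H / 4)); have c0 : 0 <= c by exact: (mulr_ge0 Ct0 (mulr_ge0 Kt0 (powR_ge0 _ _))).
have CK : 0 <= Cf * Kb by exact: mulr_ge0.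
pose tau s := c * time_weight H 0 t s + Cf * Kb * time_weight H t t' s.
pose A := D * h `^ (H / 4).
have m1 : measurable_fun setT (fun s => c * time_weight H 0 t s).
  by apply: measurable_funM => //; exact: measurable_time_weight.
have m2 : measurable_fun setT (fun s => Cf * Kb * time_weight H t t' s).
  by apply: measurable_funM => //; exact: measurable_time_weight.
have -> : D * K * (t' - t) `^ (H / 4) = A * K by rewrite /A /h; ring.
apply: (@sqnorm_le_weight [:: t; t'] _ tau A K hK).
- by apply: niceB; exact: mild_nice.
- exact: measurable_funD.
- by move=> s; rewrite addr_ge0// mulr_ge0// time_weight_ge0.
- by rewrite mulr_ge0// powR_ge0.
- under eq_integral do rewrite EFinD.
  rewrite ge0_integralD//; last 4 first.
  + by move=> s _; rewrite lee_fin mulr_ge0// time_weight_ge0.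
  + exact/measurable_EFinP.
  + by move=> s _; rewrite lee_fin mulr_ge0// time_weight_ge0.
  + exact/measurable_EFinP.
  apply: (le_trans (leeD (time_weight_intZ t0 c0) (time_weight_intZ tt' CK))).
  rewrite -EFinD lee_fin subr0 -/h.
  have -> : A = c * (T `^ (H / 4) / (H / 4)) + Cf * Kb * (h `^ (H / 4) / (H / 4)).
    by rewrite /A /D /c; ring.
  rewrite lerD2r.
  rewrite ler_wpM2l// ler_wpM2r ?invr_ge0//.
  by apply: ge0_ler_powR; rewrite ?nnegrE ?(ltW T0).
- move=> s xi; rewrite !inE negb_or => /andP[st st'] xi0.
  have tau0 : 0 <= tau s * freq_weight H xi.
    by rewrite mulr_ge0 ?freq_weight_ge0// addr_ge0// mulr_ge0// time_weight_ge0.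
  have [s0|s0] := leP 0 s; last first.
    have e1 : ~~ (0 <= s <= t) by rewrite [0 <= s]leNgt s0.
    have e2 : ~~ (0 <= s <= t') by rewrite [0 <= s]leNgt s0.
    rewrite (sliceB xi (mild_slice0 x e2) (mild_slice0 x e1)).
    rewrite (_ : (fun y => _) = fun=> 0); last by apply/funext => y; rewrite subrr.
    by rewrite Fsq0.
  have [slt|tls] := leP s t.
    have slt' : s < t by rewrite lt_neqAle st.
    have e1 : 0 <= s <= t by rewrite s0.
    have e2 : 0 <= s <= t' by rewrite s0 (le_trans slt).
    rewrite (sliceB xi (mild_slice x e2) (mild_slice x e1)).
    have r0 : 0 < t - s by rewrite subr_gt0.
    have rT : 0 < t - s <= T by rewrite r0; lra.
    have rh : t - s + h <= T by rewrite /h; lra.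
    have E : Fsq (fun y => G (t' - s) (y - x) - G (t - s) (y - x)) xi =
        Fsq (fun y => G (t - s + h) y - G (t - s) y) xi.
      have -> : t' - s = t - s + h by rewrite /h; ring.
      rewrite -(Fsq_shift x xi (f := fun y => G (t - s + h) y - G (t - s) y))//.
      apply: L1B; apply: (kernel_L1 gk) => //; rewrite rh andbT; lra.
    rewrite E; apply: (le_trans (Fsq_kernel_time r0 h0 rh xi0)).
    have -> : tau s = c * (t - s) `^ (- (1 - H / 4)).
      rewrite /tau /time_weight s0 slt' /= (leNgt t s) slt' /=; ring.
    apply: (le_trans (ler_wpM2l Ct0 (hKt _ h xi rT h0 xi0))).
    by rewrite /c le_eqVlt; apply/orP; left; apply/eqP; ring.
  have e1 : ~~ (0 <= s <= t) by rewrite negb_and -!ltNge tls orbT.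
  have [st2|st2] := leP s t'; last first.
    have e2 : ~~ (0 <= s <= t') by rewrite negb_and -!ltNge st2 orbT.
    rewrite (sliceB xi (mild_slice0 x e2) (mild_slice0 x e1)).
    rewrite (_ : (fun y => _) = fun=> 0); last by apply/funext => y; rewrite subrr.
    by rewrite Fsq0.
  have st3 : s < t' by rewrite lt_neqAle st'.
  have e2 : 0 <= s <= t' by rewrite s0.
  rewrite (sliceB xi (mild_slice x e2) (mild_slice0 x e1)).
  rewrite (_ : (fun y => _) = fun y => G (t' - s) (y - x)); last by apply/funext => y; rewrite subr0.
  have rT : 0 < t' - s <= T by rewrite subr_gt0 st3; lra.
  rewrite Fsq_shift; last exact: (kernel_L1 gk).
  apply: (le_trans (Fsq_kernel rT xi0)).
  have -> : tau s = Cf * Kb * (t' - s) `^ (- (1 - H / 4)).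
    by rewrite /tau /time_weight (ltW tls) st3 s0 (ltNge s t) (ltW tls) /=; ring.
  apply: (le_trans (ler_wpM2l Cf0 (hKb _ _ rT xi0))).
  by rewrite le_eqVlt; apply/orP; left; apply/eqP; ring.
Qed.

Lemma mild_increment : exists2 K : R, 0 <= K & forall t t' x x', 0 <= t <= T -> 0 <= t' <= T ->
  (sqnorm H (fun z => mild t x z - mild t' x' z)%R <=
    (K * (`|t - t'| `^ (H / 4) + `|x - x'| `^ (H / 4)))%:E)%E.
Proof.
have [K1 K10 h1] := mild_time_increment; have [K2 K20 h2] := mild_space_increment.
exists (2 * K1 + 2 * K2); first by rewrite addr_ge0// mulr_ge0.
have key t t' x : 0 <= t <= T -> 0 <= t' <= T ->
    (sqnorm H (fun z => mild t x z - mild t' x z)%R <= (K1 * `|t - t'| `^ (H / 4))%:E)%E.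
  move=> /andP[t0 tT] /andP[t0' tT']; have [tt'|/ltW tt'] := leP t t'.
    rewrite sqnormB_sym//; [|exact: mild_nice|exact: mild_nice].
    by rewrite distrC (@ger0_norm _ (t' - t)) ?subr_ge0//; exact: h1.
  by rewrite (@ger0_norm _ (t - t')) ?subr_ge0//; exact: h1.
move=> t t' x x' ht ht'; have /andP[_ tT] := ht; have /andP[_ tT'] := ht'.
rewrite (sqnorm_eq H (h := fun z => (mild t x z - mild t' x z) + 1 * (mild t' x z - mild t' x' z))); last by move=> z; ring.
apply: (le_trans (sqnormD_le H01 1 (niceB (mild_nice _ tT) (mild_nice _ tT')) (niceB (mild_nice _ tT') (mild_nice _ tT')))).
rewrite expr1n mulr1; apply: (le_trans (leeD (lee_wpmul2l _ (key t t' x ht ht')) (lee_wpmul2l _ (h2 t' x x' ht')))) => //.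
rewrite -!EFinM -EFinD lee_fin.
have := powR_ge0 `|t - t'| (H / 4); have := powR_ge0 `|x - x'| (H / 4).
set a := _ `^ _; set b := _ `^ _ => a0 b0.
by have := mulr_ge0 K10 a0; have := mulr_ge0 K20 b0; have := mulr_ge0 K10 b0; have := mulr_ge0 K20 a0; lra.
Qed.

End GoodKernel.

(** * Existence and adaptedness of the stochastic convolution *)

Section AdaptedMild.
Context {R : realType} {d : measure_display} {Omega : measurableType d}.
Local Notation mu := (@lebesgue_measure R).
Variable P : probability Omega R.
Variable H : R.
Hypothesis H01 : 0 < H < 1.
Variable W : (R * R -> R) -> Omega -> R.
Hypothesis W_noise : is_noise P H W.
Variables (T C : R) (G : R -> R -> R).
Hypothesis T0 : 0 < T.
Hypothesis gk : good_kernel T C G.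
Variables (t x : R).
Hypothesis t0 : 0 < t.
Hypothesis tT : t <= T.

Let step (n : nat) : R := t / n.+1%:R.

Let profile (n k : nat) (y : R) : R := G (t - k%:R * step n) (y - x).

(** A difference of two integrands of the form [1_[0,s] f], each of them adapted; it is supported on
    the half-open cell []k step, (k + 1) step]]. *)
Let cell (n k : nat) (z : R * R) : R :=
  tens (k.+1%:R * step n) (profile n k) z - tens (k%:R * step n) (profile n k) z.

(* Off the partition points, [approx n] freezes [s] at the left end of its cell. *)
Let approx (n : nat) (z : R * R) : R := \sum_(k < n.+1) cell n k z.

Let step_gt0 n : 0 < step n.
Proof. by rewrite divr_gt0. Qed.

Let stepn n : n.+1%:R * step n = t.
Proof. by rewrite /step mulrC divfK. Qed.

Let step_le n k : (k <= n.+1)%N -> 0 <= k%:R * step n <= t.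
Proof.
move=> kn; rewrite mulr_ge0 ?(ltW (step_gt0 n))//= -[leRHS](stepn n).
by rewrite ler_pM2r// ler_nat.
Qed.

Let step_lt n k : (k < n.+1)%N -> 0 < t - k%:R * step n <= T.
Proof.
move=> kn; have /andP[h1 h2] := step_le (ltnW kn).
have h3 : k%:R * step n < t by rewrite -[ltRHS](stepn n) ltr_pM2r// ltr_nat.
by rewrite subr_gt0 h3 /=; apply: le_trans tT; rewrite gerBl.
Qed.

Let profile_L1 n k : (k < n.+1)%N -> L1 (profile n k).
Proof. by move=> kn; apply: L1_shift; exact: (kernel_L1 gk (step_lt kn)). Qed.

Let approx_adapted n : adapted_wi P H W t (approx n).
Proof.
pose c k z := if (k < n.+1)%N then cell n k z else 0.
have -> : approx n = fun z => \sum_(k < n.+1) c k z.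
  by apply/funext => z; apply: eq_bigr => k _; rewrite /c ltn_ord.
apply: (adapted_wi_sum H01 W_noise) => k; rewrite /c.
case: ltnP => [kn|_]; last exact: adapted_wi0.
have /andP[r0 _] := step_lt kn.
have h (s : R) : 0 <= s <= t -> adapted_wi P H W t (tens s (profile n k)).
  move=> st; apply: (adapted_unimodal H01 W_noise st (kernel_unimodal gk x r0) (profile_L1 kn)) => y.
  exact: (kernel_le_sqrt gk _ (step_lt kn)).
by apply: (adapted_wiB H01 W_noise); apply: h; apply: step_le => //; exact: ltnW.
Qed.

Let cell0 n k s y : ~~ (k%:R * step n < s <= k.+1%:R * step n) -> cell n k (s, y) = 0.
Proof.
rewrite negb_and -!leNgt => h; rewrite /cell /tens /=.
have kk : k%:R * step n <= k.+1%:R * step n by rewrite ler_pM2r// ler_nat.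
case: (leP 0 s) => //= s0; last by rewrite subrr.
case/orP: h => h; first by rewrite h (le_trans h kk) subrr.
by rewrite -ltNge in h; rewrite !leNgt h (le_lt_trans kk h) subrr.
Qed.

Let cell1 n k s y : k%:R * step n < s <= k.+1%:R * step n -> cell n k (s, y) = profile n k y.
Proof.
move=> /andP[h1 h2]; rewrite /cell /tens /= h2 (leNgt s) h1 andbF subr0.
have s0 : 0 <= s by apply: le_trans (ltW h1); rewrite mulr_ge0// ltW.
by rewrite s0.
Qed.

Let approx_out n s : ~~ (0 < s <= t) -> (fun y => approx n (s, y)) = fun=> 0.
Proof.
move=> h; apply/funext => y; apply: big1 => k _; apply: cell0; apply: contra h => /andP[h1 h2].
have /andP[k0 _] := step_le (ltnW (ltn_ord k)); have /andP[_ k1] := step_le (ltn_ord k).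
by rewrite (le_lt_trans k0 h1) (le_trans h2 k1).
Qed.

(** Freezing at the left end makes the kernel time [r] at least [t - s]: the kernel is taken away
    from its singularity, and [decay_mono] bounds the approximation by the majorant of the integrand
    itself. *)
Let approx_in n s : 0 < s < t -> exists r, [/\ t - s <= r, r <= t - s + step n, 0 < r <= T &
  (fun y => approx n (s, y)) = fun y => G r (y - x)].
Proof.
move=> /andP[s0 st].
have ex : exists m, s <= m%:R * step n by exists n.+1; rewrite stepn ltW.
case: (ex_minnP ex) => -[|k] hk hmin.
  by move: hk; rewrite mul0r leNgt s0.
have kn : (k < n.+1)%N by apply: hmin; rewrite stepn ltW.
have ks : k%:R * step n < s by rewrite ltNge; apply/negP => /hmin; rewrite ltnn.
have k1 : k.+1%:R * step n = k%:R * step n + step n by rewrite -natr1 mulrDl mul1r.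
exists (t - k%:R * step n); split; last 2 first.
- exact: step_lt.
- apply/funext => y; rewrite /approx (bigD1 (Ordinal kn))//= cell1 ?ks ?hk// big1 ?addr0// => j jk.
  apply: cell0; apply/negP => /andP[h1 h2].
  have {}jk : (nat_of_ord j != k) by apply: contra jk => /eqP h; apply/eqP/val_inj.
  have a1 : k%:R * step n < j.+1%:R * step n := lt_le_trans ks h2.
  have a2 : j%:R * step n < k.+1%:R * step n := lt_le_trans h1 hk.
  rewrite ltr_pM2r// ltr_nat in a1; rewrite ltr_pM2r// ltr_nat in a2.
  by rewrite eqn_leq -(ltnS k) -(ltnS j) a1 a2 in jk.
- by rewrite lerD2l lerN2 ltW.
- move: hk; rewrite k1; move: (k%:R * step n) => b; move: (step n) => a; lra.
Qed.

Let approx_nice n : nice (approx n).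
Proof. by have [X iX _] := approx_adapted n; exact: wi_nice iX. Qed.

Lemma adapted_mild_gt0 : adapted_wi P H W t (mild G t x).
Proof.
have nm := mild_nice gk x tT.
apply: (adapted_wi_limit H01 W_noise nm approx_adapted).
have /andP[H0 H1] := H01.
have [K K0 hK] := sqnorm_weight H01; have [Kb Kb0 hKb] := decay_base H01 T0.
have C0 : 0 <= C.
  apply: le_trans (kernel_mass gk (r := T) _); last by rewrite T0 lexx.
  by apply: Rintegral_ge0 => y _; exact: (kernel_ge0 gk).
pose Cf := 2 * C ^+ 2 + 8 * C.
have Cf0 : 0 <= Cf by apply: addr_ge0; apply: mulr_ge0 => //; exact: sqr_ge0.
have CK : 0 <= Cf * Kb by exact: mulr_ge0.
pose tau s := Cf * Kb * time_weight H 0 t s.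
have mt : measurable_fun setT tau by apply: measurable_funM => //; exact: measurable_time_weight.
have tau0 s : 0 <= tau s by rewrite mulr_ge0// time_weight_ge0.
pose A := Cf * Kb * ((t - 0) `^ (H / 4) / (H / 4)).
have A0 : 0 <= A by apply: mulr_ge0 => //; rewrite divr_ge0 ?powR_ge0// divr_ge0// ltW.
have hA : (\int[mu]_s (tau s)%:E <= A%:E)%E by apply: time_weight_intZ => //; exact: ltW.
have bound s r xi : 0 < s < t -> t - s <= r -> 0 < r <= T -> xi != 0 ->
    Fsq (fun y => G r (y - x)) xi <= tau s * freq_weight H xi.
  move=> /andP[s0 st] sr rT xi0; rewrite Fsq_shift; last exact: (kernel_L1 gk).
  apply: (le_trans (Fsq_kernel T0 gk rT xi0)).
  have rs : 0 < t - s <= T by rewrite subr_gt0 st; lra.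
  have /andP[rs0 _] := rs.
  apply: (le_trans (ler_wpM2l Cf0 (decay_mono xi rs0 sr))).
  apply: (le_trans (ler_wpM2l Cf0 (hKb _ _ rs xi0))).
  rewrite /tau /time_weight (ltW s0) st /= le_eqVlt; apply/orP; left; apply/eqP; ring.
have off_cases s : s \notin [:: 0; t] -> (0 < s < t) \/ (~~ (0 < s <= t) /\ ~~ (0 <= s <= t)).
  rewrite !inE negb_or => /andP[s0 st].
  have [s1|s1] := ltP 0 s; last by right; rewrite [0 <= s]le_eqVlt eq_sym (negbTE s0) /= ltNge s1.
  have [s2|s2] := ltP s t; first by left.
  have s3 : (s <= t) = false by rewrite le_eqVlt (negbTE st) /= ltNge s2.
  by right; rewrite s3 !andbF.
apply: (@sqnorm_dominated _ _ H01 [:: 0; t] approx (mild G t x) (fun z => tau z.1 * freq_weight H z.2)) => //.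
- apply: measurable_funM; first exact: (measurableT_comp mt measurable_fst).
  exact: (measurableT_comp (measurable_freq_weight H) measurable_snd).
- exact: le_lt_trans (hK tau A mt tau0 A0 hA) (ltry _).
- move=> n [s xi] [/= hs xi0]; rewrite /slice_sq /=.
  have [s01|[h _]] := off_cases s hs; last first.
    by rewrite approx_out// Fsq0 mulr_ge0 ?freq_weight_ge0.
  have [r [r1 r2 rT ->]] := approx_in n s01; exact: bound s01 r1 rT xi0.
- move=> [s xi] [/= hs xi0]; rewrite /slice_sq /=.
  have [s01|[_ h]] := off_cases s hs; last first.
    by rewrite mild_slice0// Fsq0 mulr_ge0 ?freq_weight_ge0.
  have /andP[s0 st] := s01.
  rewrite (mild_slice gk); last by rewrite !ltW.
  have rT : 0 < t - s <= T by rewrite subr_gt0 st /=; apply: le_trans tT; rewrite gerBl ltW.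
  exact: (bound s (t - s) xi s01 (lexx _) rT xi0).
- move=> [s xi] [/= hs xi0].
  have [s01|[h h']] := off_cases s hs; last first.
    rewrite (_ : (fun n => _) = fun=> 0); first exact: cvg_cst.
    apply/funext => n; rewrite (sliceB xi (approx_out n h) (mild_slice0 G x h')).
    by rewrite (_ : (fun y => _) = fun=> 0) ?Fsq0//; apply/funext => y; rewrite subrr.
  have /andP[s0 st] := s01; have st' : 0 <= s <= t by rewrite !ltW.
  have ts : 0 < t - s by rewrite subr_gt0.
  (* [kernel_incr] between the times [t - s] and [r], which differ by at most one step, bounds the
     L1 distance of the slices. *)
  pose e n := 2 * (C * (step n / (t - s))) ^+ 2.
  have he n : slice_sq (fun z => approx n z - mild G t x z) (s, xi) <= e n.
    have [r [r1 r2 rT E]] := approx_in n s01.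
    rewrite (sliceB xi E (mild_slice gk x st')).
    have rT' : 0 < t - s <= T by rewrite ts /=; apply: le_trans tT; rewrite gerBl ltW.
    have lr := kernel_L1 gk rT; have lts : L1 (G (t - s)) := kernel_L1 gk rT'.
    rewrite (Fsq_shift x xi (f := fun y => G r y - G (t - s) y)); last exact: L1B.
    apply: (le_trans (Fsq_le_L1 xi (L1B lr lts))); rewrite ler_pM2l//.
    have q0 : 0 <= r - (t - s) by rewrite subr_ge0.
    have := kernel_incr gk ts q0; rewrite (addrC (t - s)) subrK => hi.
    have I0 : 0 <= \int[mu]_y `|G r y - G (t - s) y| by apply: Rintegral_ge0.
    have hr : C * ((r - (t - s)) / (t - s)) <= C * (step n / (t - s)).
      by rewrite ler_wpM2l// ler_wpM2r ?invr_ge0 ?(ltW ts)// lerBlDr addrC.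
    have hI : \int[mu]_y `|G r y - G (t - s) y| <= C * (step n / (t - s)).
      by apply: le_trans hr; apply: hi; case/andP: rT.
    by rewrite ler_sqr ?nnegrE// (le_trans I0).
  have ce : e n @[n --> \oo] --> 0.
    have E n : e n = (2 * (C * (t / (t - s))) ^+ 2) * (n.+1%:R^-1 * n.+1%:R^-1).
      have n0 : n.+1%:R != 0 :> R by rewrite pnatr_eq0.
      by rewrite /e /step; move: (n.+1%:R : R) n0 => a a0; field; rewrite a0 gt_eqF.
    rewrite (funext E) -[X in _ --> X](mulr0 (2 * (C * (t / (t - s))) ^+ 2)); apply: cvgM; first exact: cvg_cst.
    by rewrite -[X in _ --> X](mulr0 0); apply: cvgM; exact: cvg_harmonic.
  apply: (squeeze_cvgr _ (cvg_cst 0) ce); apply: nearW => n.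
  by rewrite he andbT; exact: Fsq_ge0.
Qed.

End AdaptedMild.

Lemma adapted_mild {R : realType} {d : measure_display} {Omega : measurableType d}
    (P : probability Omega R) (H : R) (W : (R * R -> R) -> Omega -> R) (T C : R) (G : R -> R -> R)
    (t x : R) : 0 < H < 1 -> is_noise P H W -> 0 < T -> good_kernel T C G -> 0 <= t <= T ->
  adapted_wi P H W t (mild G t x).
Proof.
move=> H01 WN T0 gk /andP[]; rewrite le_eqVlt => /predU1P[<- _|t0 tT]; last first.
  exact: (adapted_mild_gt0 H01 WN T0 gk x t0 tT).
(* At [t = 0] the integrand can only live on [s = 0], where [kernel0] makes it vanish. *)
have := adapted_wi0 H01 WN 0; congr adapted_wi; apply/funext => -[s y]; rewrite /mild /=.
case: ifP => // /andP[s0 s1]; have -> : s = 0 by apply/eqP; rewrite eq_le s0 s1.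
by rewrite subrr (kernel0 gk).
Qed.

(** * The wave and heat kernels *)

Section Kernels.
Context {R : realType}.
Local Notation mu := (@lebesgue_measure R).

Lemma measurable_inv : measurable_fun setT (fun x : R => x^-1).
Proof.
rewrite (_ : (fun x => _) = fun x => if 0 <= x then x `^ (-1) else - ((- x) `^ (-1))).
  apply: measurable_fun_ifT; first exact: measurable_fun_ler.
    exact: measurable_powR.
  apply: measurable_funN; apply: (measurableT_comp (measurable_powR (-1))).
  exact: measurable_funN.
apply/funext => x; case: leP => [x0|/ltW x0]; first by rewrite powR_inv1.
by rewrite powR_inv1 ?oppr_ge0// invrN opprK.
Qed.

Lemma wave_kernelE (r x : R) : wave_kernel r x = 2^-1 * \1_(`]- r, r[%classic) x.
Proof. by rewrite /wave_kernel indicE mem_setE in_itv/= ltr_norml. Qed.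

(** The constant is [T]: the mass is [r], the height is at most 1 with [1 <= T / r], and the kernel
    increases with [r], so the L1 distance is the difference [h] of the masses, at most
    [T * (h / r)]. *)
Lemma wave_kernel_good (T : R) : 0 < T -> good_kernel T T (@wave_kernel R).
Proof.
move=> T0.
have l r : 0 < r -> L1 (wave_kernel r : R -> R).
  move=> r0; rewrite (funext (wave_kernelE r)); apply: L1Z.
  by apply: (itv_L1 false true); lra.
have IE r : 0 < r -> \int[mu]_x wave_kernel r x = r.
  move=> r0; have rr : - r <= r by lra.
  have lI : L1 (\1_(`]- r, r[%classic) : R -> R) := itv_L1 false true rr.
  rewrite (funext (wave_kernelE r)) RintegralZl// Rintegral_indic//.
  transitivity (2^-1 * fine (r - - r)%:E); last by rewrite /=; field.
  by congr (_ * fine _); exact: (mu_itv false true rr).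
split.
- apply: measurable_funM => //; apply: measurableT_comp => //.
  apply: measurable_fun_ltr; last exact: measurable_fst.
  by apply: measurableT_comp => //; exact: measurable_snd.
- by move=> x; rewrite /wave_kernel ltNge normr_ge0 mulr0.
- by move=> r x r0; rewrite mulr_ge0.
- by move=> r x; rewrite /wave_kernel normr_id.
- move=> r x y r0 x0 xy; rewrite /wave_kernel ler_wpM2l ?invr_ge0//.
  rewrite (ger0_norm x0) (ger0_norm (le_trans x0 xy)) ler_nat.
  by case: (ltP y r) => // /(le_lt_trans xy) ->.
- by move=> r /andP[r0 _]; exact: l.
- by move=> r /andP[r0 rT]; rewrite IE.
- move=> r x /andP[r0 rT]; apply: (@le_trans _ _ 1); last by rewrite ler_pdivlMr// mul1r.
  rewrite /wave_kernel expr_le1//.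
  rewrite -[leRHS]mulr1; apply: ler_pM => //; first by rewrite invf_le1 ?ler1n.
  by rewrite lern1; case: (_ < _).
- move=> r h r0 h0 rhT; have rh0 : 0 < r + h by rewrite ltr_wpDr.
  rewrite (_ : \int[mu]_x _ = \int[mu]_x (wave_kernel (r + h) x - wave_kernel r x)).
    rewrite RintegralB//; [|exact: l|exact: l]; rewrite !IE// addrAC subrr add0r.
    by rewrite mulrCA ler_peMr// ler_pdivlMr// mul1r; lra.
  apply: eq_Rintegral => x _; rewrite ger0_norm// subr_ge0 /wave_kernel ler_wpM2l ?invr_ge0// ler_nat.
  by case: (ltP `|x| r) => // xr; rewrite (lt_le_trans xr)// lerDl.
Qed.

Lemma heat_kernelE (r x : R) : 0 < r ->
  heat_kernel r x = (Num.sqrt (2 * pi * r))^-1 * expR (- (x ^+ 2 / (2 * r))).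
Proof.
move=> r0; have p0 : 0 <= 2 * pi * r by rewrite !mulr_ge0 ?pi_ge0// ltW.
by rewrite /heat_kernel powRN powR12_sqrt// real_normK ?num_real.
Qed.

Lemma heat_kernel_pdf (r x : R) : 0 < r -> heat_kernel r x = normal_pdf 0 (Num.sqrt r) x.
Proof.
move=> r0; rewrite heat_kernelE// normal_pdf0E ?gt_eqF ?sqrtr_gt0// /normal_peak sqr_sqrtr ?ltW//.
congr (_^-1 * expR _); first by congr Num.sqrt; rewrite -mulr_natr; ring.
by rewrite -[r *+ 2]mulr_natl mulNr.
Qed.

Lemma heat_kernel_L1 (r : R) : 0 < r -> L1 (heat_kernel r : R -> R).
Proof.
move=> r0; rewrite (_ : heat_kernel r = normal_pdf 0 (Num.sqrt r)).
  exact: integrable_normal_pdf.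
by apply/funext => x; exact: heat_kernel_pdf.
Qed.

Lemma heat_kernel_mass (r : R) : 0 < r -> \int[mu]_x heat_kernel r x = 1.
Proof.
move=> r0; rewrite (_ : heat_kernel r = normal_pdf 0 (Num.sqrt r)).
  by rewrite /Rintegral integral_normal_pdf.
by apply/funext => x; exact: heat_kernel_pdf.
Qed.

Lemma heat_kernel_ge0 (r x : R) : 0 <= heat_kernel r x.
Proof. by rewrite mulr_ge0 ?powR_ge0 ?expR_ge0. Qed.

(** With [c = sqrt(r / (r + h))] the kernel at time [r + h] dominates [c] times the kernel at time
    [r]. Splitting off this part bounds the L1 distance by [2 (1 - c)], and
    [1 - c <= 1 - c^2 = h / (r + h)]. *)
Lemma heat_kernel_incr (r h : R) : 0 < r -> 0 <= h ->
  \int[mu]_x `|heat_kernel (r + h) x - heat_kernel r x| <= 2 * (h / r).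
Proof.
move=> r0 h0; have rh0 : 0 < r + h by rewrite ltr_wpDr.
pose c := Num.sqrt (r / (r + h)).
have q1 : r / (r + h) <= 1 by rewrite ler_pdivrMr// mul1r lerDl.
have q0 : 0 <= r / (r + h) by rewrite divr_ge0 ?ltW.
have c0 : 0 <= c by exact: sqrtr_ge0.
have c2 : c ^+ 2 = r / (r + h) by rewrite sqr_sqrtr.
have c1 : c <= 1 by rewrite -[leRHS]sqrtr1 ler_wsqrtr.
have cr : c * (Num.sqrt (2 * pi * r))^-1 = (Num.sqrt (2 * pi * (r + h)))^-1.
  have p2 : 0 <= 2 * pi :> R by rewrite mulr_ge0 ?pi_ge0.
  rewrite /c sqrtrM ?ltW// !(sqrtrM _ p2) sqrtrV ?ltW//.
  have s1 : Num.sqrt r != 0 by rewrite gt_eqF ?sqrtr_gt0.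
  have s2 : Num.sqrt (r + h) != 0 by rewrite gt_eqF ?sqrtr_gt0.
  have s3 : Num.sqrt (2 * pi) != 0 :> R by rewrite gt_eqF ?sqrtr_gt0 ?mulr_gt0 ?pi_gt0.
  by field; rewrite s1 s2 s3.
have key x : c * heat_kernel r x <= heat_kernel (r + h) x.
  rewrite !heat_kernelE// mulrA cr ler_wpM2l ?invr_ge0 ?sqrtr_ge0// ler_expR lerN2.
  by rewrite ler_wpM2l ?sqr_ge0// lef_pV2 ?posrE ?mulr_gt0// ler_pM2l// lerDl.
have l1 := heat_kernel_L1 r0; have l2 := heat_kernel_L1 rh0.
have l3 := L1Z c l1; have l4 := L1Z (1 - c) l1; have l5 := L1B l2 l3.
have l6 : L1 (fun x => heat_kernel (r + h) x - c * heat_kernel r x + (1 - c) * heat_kernel r x) := L1D l5 l4.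
apply: (@le_trans _ _ (\int[mu]_x (heat_kernel (r + h) x - c * heat_kernel r x + (1 - c) * heat_kernel r x))).
  apply: le_Rintegral => //; first exact: L1_norm (L1B l2 l1).
  move=> x _; have a0 := heat_kernel_ge0 r x; have := key x.
  have : 0 <= (1 - c) * heat_kernel r x by rewrite mulr_ge0// subr_ge0.
  set a := heat_kernel r x; set b := heat_kernel (r + h) x => k1 k2.
  by rewrite ler_norml; apply/andP; split; nra.
rewrite (RintegralD _ l5 l4)// (RintegralB _ l2 l3)// (RintegralZl _ _ l1)// (RintegralZl _ _ l1)// !heat_kernel_mass// !mulr1.
have hr : 1 - c <= h / r.
  apply: (@le_trans _ _ (1 - c ^+ 2)).
    by rewrite lerD2l lerN2 expr2 ler_piMr.
  rewrite c2 (_ : 1 - r / (r + h) = h / (r + h)); last by field; rewrite gt_eqF.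
  by rewrite ler_wpM2l// lef_pV2 ?posrE// lerDl.
lra.
Qed.

(** The constant 2 is that of [heat_kernel_incr]; the mass is 1 and the squared height is at most
    [1 / (2 pi r)]. *)
Lemma heat_kernel_good (T : R) : good_kernel T 2 (@heat_kernel R).
Proof.
split.
- apply: measurable_funM.
    apply: (measurableT_comp (measurable_powR _)).
    by apply: measurable_funM => //; exact: measurable_fst.
  apply: measurableT_comp => //; apply: measurable_funN; apply: measurable_funM.
    by apply: measurable_funX; apply: measurableT_comp => //; exact: measurable_snd.
  apply: (measurableT_comp measurable_inv).
  by apply: measurable_funM => //; exact: measurable_fst.
- by move=> x; rewrite /heat_kernel mulr0 powR0 ?mul0r// oppr_eq0 invr_eq0 pnatr_eq0.
- by move=> r x _; exact: heat_kernel_ge0.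
- by move=> r x; rewrite /heat_kernel normr_id.
- move=> r x y r0 x0 xy; rewrite !heat_kernelE// ler_wpM2l ?invr_ge0 ?sqrtr_ge0// ler_expR lerN2.
  by rewrite ler_wpM2r ?invr_ge0 ?mulr_ge0 ?(ltW r0)// ler_sqr ?nnegrE// (le_trans x0).
- by move=> r /andP[r0 _]; exact: heat_kernel_L1.
- by move=> r /andP[r0 _]; rewrite heat_kernel_mass// ler1n.
- move=> r x /andP[r0 _]; have p0 : 0 < 2 * pi * r by rewrite !mulr_gt0 ?pi_gt0.
  rewrite heat_kernelE// exprMn exprVn (sqr_sqrtr (ltW p0)).
  apply: (@le_trans _ _ ((2 * pi * r)^-1 * 1)).
    rewrite ler_wpM2l ?invr_ge0 ?(ltW p0)// expr_le1 ?expR_ge0// -expR0 ler_expR oppr_le0.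
    by rewrite divr_ge0 ?sqr_ge0// mulr_ge0// ltW.
  rewrite mulr1 invfM ler_wpM2r ?invr_ge0 ?(ltW r0)//.
  have p2 : 1 <= 2 * pi :> R by have := pi_ge2 R; lra.
  by apply: (@le_trans _ _ 1); [rewrite invf_le1// (lt_le_trans _ p2)|rewrite ler1n].
- by move=> r h r0 h0 _; exact: heat_kernel_incr.
Qed.

Lemma kernel_good (T : R) (e : spde R) : 0 < T -> exists C, good_kernel T C (kernel_G e).
Proof.
move=> T0; case: e => [u0 v0|u0]; first by exists T; exact: wave_kernel_good.
by exists 2; exact: heat_kernel_good.
Qed.

End Kernels.

(** * Continuity of the initial term *)

Section InitialTerm.
Context {R : realType}.
Local Notation mu := (@lebesgue_measure R).

(** Reduces joint continuity to sequences, the form in which dominated convergence applies. *)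
Lemma sequentially_continuous (f : R * R -> R) (z0 : R * R) :
  (forall t s : nat -> R, t n @[n --> \oo] --> z0.1 -> s n @[n --> \oo] --> z0.2 ->
    f (t n, s n) @[n --> \oo] --> f z0) -> {for z0, continuous f}.
Proof.
move=> hf; apply/cvgrPdist_lt => e e0; apply: contrapT => hn.
have /choice[z hz] : forall n, exists z : R * R, [/\ `|z0.1 - z.1| < n.+1%:R^-1, `|z0.2 - z.2| < n.+1%:R^-1 &
    e <= `|f z0 - f z|].
  move=> n; apply: contrapT => h; apply: hn.
  have n0 : 0 < n.+1%:R^-1 :> R by rewrite invr_gt0.
  exists (ball z0.1 n.+1%:R^-1, ball z0.2 n.+1%:R^-1); first by split; exact: nbhsx_ballx.
  move=> z [/= z1 z2]; rewrite ltNge; apply/negP => h1; apply: h; exists z; split => //.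
have ch (g : R * R -> R) : (forall n, `|g z0 - g (z n)| < n.+1%:R^-1) -> g (z n) @[n --> \oo] --> g z0.
  move=> hg; apply/cvgrPdist_lt => d d0.
  have := @cvg_harmonic R => /cvgrPdist_lt/(_ d d0); apply: filterS => n.
  rewrite sub0r normrN /harmonic ger0_norm ?invr_ge0// => h; exact: lt_trans (hg n) h.
have := hf (fun n => (z n).1) (fun n => (z n).2) (ch fst (fun n => let: And3 a _ _ := hz n in a))
  (ch snd (fun n => let: And3 _ a _ := hz n in a)).
move=> /cvgrPdist_lt/(_ e e0)[n _ /(_ n (leqnn n))] /=; rewrite -surjective_pairing.
by have [_ _ h] := hz n; rewrite ltNge h.
Qed.

(** The expectation of [u0(x + sqrt t Z)] for a standard Gaussian [Z]: this substitution removes the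
    singularity of the kernel at [t = 0] and includes the initial condition. *)
Definition heat_initial (u0 : R -> R) (t x : R) : R :=
  \int[mu]_y (normal_pdf 0 1 y * u0 (x + Num.sqrt t * y)).

Section Heat.
Variables (u0 : R -> R) (M : R).
Hypothesis cu : continuous u0.
Hypothesis uM : forall x, `|u0 x| <= M.

Let mu0 : measurable_fun setT u0. Proof. exact: continuous_measurable_fun. Qed.

Lemma heat_initial_continuous : continuous (fun z : R * R => heat_initial u0 z.1 z.2).
Proof.
move=> [t0 x0]; apply: sequentially_continuous => t x /= ct cx.
pose f (s y : R) (z : R) := normal_pdf 0 1 z * u0 (y + Num.sqrt s * z).
have E s y : heat_initial u0 s y = wint (fun=> 1) (f s y).
  by apply: eq_Rintegral => z _; rewrite mul1r.
rewrite E (_ : (fun n => _) = fun n => wint (fun=> 1) (f (t n) (x n))); last by apply/funext => n; exact: E.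
have o1 : osc (fun=> 1 : R) by split => // y; rewrite normr1.
have lp : L1 (normal_pdf 0 1 : R -> R) by exact: integrable_normal_pdf.
have mf s y : measurable_fun setT (f s y).
  apply: measurable_funM; first exact: L1_measurable.
  have ms : measurable_fun setT (fun z : R => y + Num.sqrt s * z).
    by apply: measurable_funD => //; apply: (@measurable_funM _ _ _ _ (fun=> Num.sqrt s) id).
  exact: (measurableT_comp mu0 ms).
apply: (dominated_wint o1 (fun n => mf (t n) (x n)) (mf t0 x0) _ (L1Z M lp)).
- move=> z; apply: cvgM; first exact: cvg_cst.
  have cs : Num.sqrt (t n) @[n --> \oo] --> Num.sqrt t0 by apply: (cvg_comp _ Num.sqrt ct); exact: sqrt_continuous.
  have cz : x n + Num.sqrt (t n) * z @[n --> \oo] --> x0 + Num.sqrt t0 * z.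
    by apply: cvgD => //; apply: cvgM => //; exact: cvg_cst.
  by apply: (cvg_comp _ u0 cz); exact: cu.
- move=> n z; rewrite normrM mulrC (ger0_norm (normal_pdf_ge0 _ _ _)).
  by rewrite ler_wpM2r ?normal_pdf_ge0.
Qed.

Lemma heat_initialE (t x : R) : 0 <= t -> I0 (Heat u0) t x = heat_initial u0 t x.
Proof.
rewrite le_eqVlt => /predU1P[<-|t0] /=.
  rewrite ltxx /heat_initial sqrtr0.
  rewrite (_ : (fun y => _) = fun y => u0 x * normal_pdf 0 1 y).
    rewrite RintegralZl//; last exact: integrable_normal_pdf.
    by rewrite /Rintegral integral_normal_pdf mulr1.
  by apply/funext => y; rewrite mul0r addr0 mulrC.
rewrite t0; pose f (y : R) := heat_kernel t (x - y) * u0 y.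
have s0 : 0 < Num.sqrt t by rewrite sqrtr_gt0.
have lf : L1 f.
  have lh : L1 (fun y => heat_kernel t (x - y)).
    rewrite (_ : (fun y => _) = fun y => heat_kernel t (y - x)).
      exact: L1_shift (heat_kernel_L1 t0).
    by apply/funext => y; rewrite /heat_kernel distrC.
  apply: (L1_le (g := fun y => M * heat_kernel t (x - y))); last exact: L1Z.
    by apply: measurable_funM => //; exact: L1_measurable lh.
  move=> y; rewrite normrM mulrC (ger0_norm (heat_kernel_ge0 _ _)).
  by rewrite ler_wpM2r ?heat_kernel_ge0.
have := Rintegral_affine x s0 lf.
rewrite -[RHS]mulrC => h.
have -> : \int[mu]_y (heat_kernel t (x - y) * u0 y) = Num.sqrt t * \int[mu]_y f (Num.sqrt t * y + x).
  by rewrite h mulrCA mulfV ?mulr1// gt_eqF.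
have sl : L1 (fun y => f (Num.sqrt t * y + x)) := integrable_affine x s0 lf.
rewrite -(RintegralZl _ _ sl)//; apply: eq_Rintegral => y _.
rewrite /f mulrA opprD addrCA subrr addr0; congr (_ * u0 _); last by rewrite addrC.
rewrite (normal_pdf_scale y s0) -heat_kernel_pdf//; congr (_ * _).
by rewrite /heat_kernel normrN.
Qed.

End Heat.

Section Wave.
Variables (u0 v0 : R -> R).
Hypothesis cu : continuous u0.
Hypothesis lv : locally_integrable setT v0.

Lemma wave_integrable a b : mu.-integrable `[a, b] (EFin \o v0).
Proof.
have [mv _ hv] := lv.
apply/integrableP; split; first by apply/measurable_EFinP; exact: measurable_funTS.
by apply: hv => //; exact: segment_compact.
Qed.

Let prim (N y : R) : R := \int[mu]_(z in `[- N, y]) v0 z.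

Lemma wave_prim N a b : - N <= a -> a <= b ->
  \int[mu]_(z in `[a, b]) v0 z = prim N b - prim N a.
Proof.
move=> Na ab; have Nb := le_trans Na ab.
have := Rintegral_itvB (wave_integrable (- N) b) (x := a); rewrite !bnd_simp => /(_ Na ab) ->.
rewrite Rintegral_itv_obnd_cbnd//; apply: (integrableS _ _ _ (wave_integrable a b)) => //.
by apply: subset_itvr; rewrite bnd_simp.
Qed.

Lemma prim_continuous N y : - N < y < N -> {for y, continuous (prim N)}.
Proof.
move=> yN; have NN : - N <= N by case/andP: yN => h1 h2; exact: ltW (lt_trans h1 h2).
have h := parameterized_integral_continuous NN (wave_integrable (- N) N).
have sub : `]- N, N[%classic `<=` `[- N, N]%classic by apply: subset_itv; rewrite bnd_simp.
have := continuous_subspaceW sub h; rewrite continuous_open_subspace; last exact: interval_open.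
by move=> /(_ y); apply; rewrite inE /= in_itv.
Qed.

Lemma wave_initial_continuous : continuous (fun z : R * R => I0 (Wave u0 v0) (Num.max z.1 0) z.2).
Proof.
move=> [t0 x0]; apply: sequentially_continuous => t x /= ct cx.
have cm : Num.max (t n) 0 @[n --> \oo] --> Num.max t0 0.
  have E (a : R) : Num.max a 0 = (a + `|a|) / 2.
    by rewrite maxr_absE addr0 subr0.
  rewrite E (_ : (fun n => _) = fun n => (t n + `|t n|) / 2); last by apply/funext => n; exact: E.
  by apply: cvgM; [apply: cvgD => //; exact: cvg_norm|exact: cvg_cst].
move: cm; set m := fun n => Num.max (t n) 0; set m0 := Num.max t0 0 => cm.
have m_ge0 n : 0 <= m n by rewrite le_max lexx orbT.
have m0_ge0 : 0 <= m0 by rewrite le_max lexx orbT.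
have cp : x n + m n @[n --> \oo] --> x0 + m0 by exact: cvgD.
have cn : x n - m n @[n --> \oo] --> x0 - m0 by exact: cvgB.
(* The margin 1 keeps the limit interval inside []- N, N[], where the primitive is continuous, and
   the nearby intervals to the right of the base point [- N]. *)
pose N := `|x0| + m0 + 1.
have xN := ler_norm x0; have xN' := ler_norm (- x0); rewrite normrN in xN'.
have cN a : `|x0 - a| <= m0 -> {for a, continuous (prim N)}.
  by rewrite ler_norml => /andP[h1 h2]; apply: prim_continuous; rewrite /N; apply/andP; split; lra.
have c1 : prim N (x n + m n) @[n --> \oo] --> prim N (x0 + m0).
  apply: (cvg_comp _ (prim N) cp); apply: cN.
  by rewrite opprD addrA subrr sub0r normrN ger0_norm.
have c2 : prim N (x n - m n) @[n --> \oo] --> prim N (x0 - m0).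
  by apply: (cvg_comp _ (prim N) cn); apply: cN; rewrite subKr ger0_norm.
have u1 : u0 (x n + m n) @[n --> \oo] --> u0 (x0 + m0) by apply: (cvg_comp _ u0 cp); exact: cu.
have u2 : u0 (x n - m n) @[n --> \oo] --> u0 (x0 - m0) by apply: (cvg_comp _ u0 cn); exact: cu.
have cI : \int[mu]_(y in `[(x n - m n), (x n + m n)]) v0 y @[n --> \oo] -->
    \int[mu]_(y in `[(x0 - m0), (x0 + m0)]) v0 y.
  rewrite (@wave_prim N); [|rewrite /N; lra|lra].
  have c3 : prim N (x n + m n) - prim N (x n - m n) @[n --> \oo] --> prim N (x0 + m0) - prim N (x0 - m0) by exact: cvgB.
  apply: cvg_trans c3; apply: near_eq_cvg; near=> n.
  rewrite (@wave_prim N)//; last by have := m_ge0 n; lra.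
  have : `|(x0 - m0) - (x n - m n)| < 1.
    by near: n; move/cvgrPdist_lt : cn; apply.
  by rewrite ltr_norml /N => /andP[h1 h2]; lra.
apply: cvgD; first by apply: cvgM; [exact: cvg_cst|exact: cI].
by apply: cvgM; [exact: cvg_cst|exact: cvgD].
Unshelve. all: by end_near.
Qed.

End Wave.

(** Freezing negative times at 0 gives a continuous function on the whole plane, from which both
    measurability and continuity on the strip [0 <= t <= T] follow. *)
Lemma I0_continuous (e : spde R) : admissible e ->
  continuous (fun z : R * R => I0 e (Num.max z.1 0) z.2).
Proof.
case: e => [u0 v0 [cu lv]|u0 [cu [M uM]]]; first exact: wave_initial_continuous.
have h : (fun z : R * R => I0 (Heat u0) (Num.max z.1 0) z.2) = fun z => heat_initial u0 z.1 z.2.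
  apply/funext => z; rewrite (heat_initialE cu uM) ?le_max ?lexx ?orbT// /heat_initial.
  have -> : Num.sqrt (Num.max z.1 0) = Num.sqrt z.1; last by [].
  by case: (leP z.1 0) => [z0|//]; rewrite sqrtr0 ler0_sqrtr.
by rewrite h; exact: heat_initial_continuous cu uM.
Qed.

End InitialTerm.

(** * Existence and uniqueness *)

Section MildSolution.
Context {R : realType} {d : measure_display} {Omega : measurableType d}.
Variable P : probability Omega R.
Variables T H : R.
Hypothesis T0 : 0 < T.
Hypothesis H01 : 0 < H < 1.
Variable W : (R * R -> R) -> Omega -> R.
Hypothesis W_noise : is_noise P H W.
Implicit Types (t s x y : R).

(** Choose [k] with [q ^ - k <= 1 / 32] and use [exp(- y) <= k! / y ^ k]. The rate 32 is the one
    required by the chaining. *)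
Lemma exp_geometric_decay (A q : R) : 0 < A -> 1 < q -> exists2 C, 0 <= C &
  forall n, 2 * expR (- (A * q ^+ n)) <= C * 32^-1 ^+ n.
Proof.
move=> A0 q1; have q0 : 0 < q by exact: lt_trans q1.
have : (fun k => q^-1 ^+ k) @ \oo --> (0 : R).
  by apply: cvg_expr; rewrite gtr0_norm ?invr_gt0// invf_lt1.
move=> /cvgrPdist_lt /(_ 32^-1); rewrite invr_gt0 ltr0n => /(_ isT)[k _ /(_ k (leqnn k))].
rewrite /= sub0r normrN ger0_norm ?exprn_ge0 ?invr_ge0 ?(ltW q0)// => /ltW hk.
exists (2 * (k`!%:R / A ^+ k)).
  by apply: mulr_ge0 => //; apply: divr_ge0 => //; rewrite exprn_ge0// ltW.
move=> n; have y0 : 0 < A * q ^+ n by rewrite mulr_gt0 ?exprn_gt0.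
rewrite -mulrA ler_wpM2l//.
apply: (@le_trans _ _ (k`!%:R / (A * q ^+ n) ^+ k)).
  rewrite expRN -div1r ler_pdivrMr ?expR_gt0// mulrAC ler_pdivlMr ?exprn_gt0// mul1r.
  exact: expR_pow_le (ltW y0).
rewrite exprMn invfM mulrA ler_wpM2l//.
  by apply: divr_ge0 => //; rewrite exprn_ge0// ltW.
rewrite -exprM mulnC exprM -exprVn -exprVn.
by apply: lerXn2r => //; rewrite nnegrE ?exprn_ge0 ?invr_ge0// ltW.
Qed.

(** The 1-Lipschitz projection onto [[0, T]] extends the field to all real times without enlarging
    its increments, as chaining over the whole plane requires. *)
Definition clamp t : R := Num.min (Num.max t 0) T.

Lemma clamp_itv t : 0 <= clamp t <= T.
Proof. by rewrite /clamp le_min ge_min lexx orbT le_max lexx orbT ltW. Qed.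

Lemma clamp_id t : 0 <= t <= T -> clamp t = t.
Proof. by move=> /andP[t0 tT]; rewrite /clamp (max_idPl t0) (min_idPl tT). Qed.

Lemma clamp_lipschitz t s : `|clamp t - clamp s| <= `|t - s|.
Proof.
wlog ts : t s / s <= t => [hw|].
  by have [|/ltW] := leP s t => /hw//; rewrite distrC (distrC t).
have st0 : 0 <= t - s by rewrite subr_ge0.
have mono : clamp s <= clamp t by rewrite /clamp le_min2// le_max2.
rewrite !ger0_norm// ?subr_ge0// lerBlDl /clamp addr_minl addr_maxl.
by apply: le_min2; [apply: le_max2; rewrite ?add0r// addrC subrK|rewrite lerDl].
Qed.

Variable e : spde R.
Hypothesis e_admissible : admissible e.

Let good_G : exists C, good_kernel T C (kernel_G e) := kernel_good e T0.

Lemma stochastic_convolution : exists X : R -> R -> Omega -> R, forall t x,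
  wi P H W (mild_integrand e (clamp t) x) (X t x) /\ observable P H W (clamp t) (X t x).
Proof.
have [C gk] := good_G.
have X t x := cid2 (adapted_mild x H01 W_noise T0 gk (clamp_itv t)).
exists (fun t x => s2val (X t x)) => t x; split; [exact: (s2valP (X t x))|exact: (s2valP' (X t x))].
Qed.

Lemma powR_expn_half (a : R) n : (2^-1 ^+ n) `^ a = (2^-1 `^ a) ^+ n :> R.
Proof.
have h : (0 : R) <= 2^-1 by rewrite invr_ge0.
by rewrite -(powR_mulrn n h) -(powR_mulrn n (powR_ge0 _ a)) -!powRrM (mulrC a).
Qed.

(** A threshold [r ^ n] against a variance of order [r ^ (4 n)]: the exponent of the Gaussian tail
    grows like [r ^ - (2 n)]. *)
Lemma tail_exponent (c r V : R) n : r != 0 -> V != 0 ->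
  c * r ^+ n ^+ 2 / (V * r ^+ 4 ^+ n) = c / V * (r ^- 2) ^+ n.
Proof.
move=> r0 V0; rewrite (exprAC r 4) exprVn (exprAC r 2).
have : r ^+ n != 0 by rewrite expf_neq0.
by move: (r ^+ n) => z z0; field; rewrite z0.
Qed.

Lemma mild_tail (X : R -> R -> Omega -> R) :
  (forall t x, wi P H W (mild_integrand e (clamp t) x) (X t x)) ->
  exists C r : R, [/\ 0 <= C, 0 < r < 1 & forall n t s t' s',
    `|t - t'| <= 2^-1 ^+ n -> `|s - s'| <= 2^-1 ^+ n ->
    (P [set w | (r ^+ n < `|X t s w - X t' s' w|)%R] <= (C * 32^-1 ^+ n)%:E)%E].
Proof.
move=> iX; have [C gk] := good_G; have [K K0 hK] := mild_increment H01 T0 gk.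
have [c c0 tail] := gaussian_tail P.
have /andP[H0 H1] := H01; pose a := H / 4; have a0 : 0 < a by rewrite divr_gt0.
(* The increments at scale 2^-n have standard deviation of order [r ^+ (2 * n)],
   hence exceed [r ^+ n] with super-polynomially small probability. *)
pose r : R := 2^-1 `^ (a / 4); have r0 : 0 < r by rewrite powR_gt0 ?invr_gt0.
have r1 : r < 1.
  have <- : 1 `^ (a / 4) = 1 :> R by rewrite powR1.
  apply: gt0_ltr_powR.
  - exact: divr_gt0.
  - by rewrite nnegrE invr_ge0.
  - by rewrite nnegrE.
  - by rewrite invf_lt1// ltr1n.
have r4 : r ^+ 4 = 2^-1 `^ a.
  by rewrite /r -powR_mulrn ?powR_ge0// -powRrM divfK// pnatr_eq0.
(* A factor 4 from [wi_isometry] and a factor 2 for the time and space increments; [K + 1] in place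
   of [K] makes [V] positive. *)
pose V := 8 * (K + 1); have V0 : 0 < V by rewrite mulr_gt0// ltr_wpDl.
have q1 : 1 < (r ^+ 2)^-1 by rewrite invf_gt1 ?exprn_gt0// exprn_ilt1// ltW.
have [D D0 hD] := exp_geometric_decay (divr_gt0 c0 V0) q1.
exists D, r; rewrite r0 r1; split => // n t s t' s' tt ss.
have iD := wi_lin H01 W_noise (-1) (iX t s) (iX t' s').
have gD : centered_gaussian P (fun w => X t s w - X t' s' w).
  by have := wi_gaussian H01 W_noise iD; congr centered_gaussian; apply/funext => w; rewrite mulN1r.
have hpow y : 0 <= y <= 2^-1 ^+ n -> y `^ a <= (r ^+ 4) ^+ n.
  move=> /andP[y0 yn]; rewrite r4 -powR_expn_half; apply: ge0_ler_powR => //; first exact: ltW.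
  by rewrite nnegrE exprn_ge0// invr_ge0.
have b0 : 0 < (r ^+ 4) ^+ n by rewrite !exprn_gt0.
have E2D : (E2 P (fun w => X t s w - X t' s' w)%R <= (V * (r ^+ 4) ^+ n)%:E)%E.
  apply: (le_trans (wi_isometry H01 W_noise (iX t s) (iX t' s'))).
  apply: (le_trans (lee_wpmul2l _ (hK _ _ s s' (clamp_itv t) (clamp_itv t')))) => //.
  rewrite -EFinM lee_fin /V.
  have h1 := hpow _ (introT andP (conj (normr_ge0 _) (le_trans (clamp_lipschitz t t') tt))).
  have h2 := hpow _ (introT andP (conj (normr_ge0 _) ss)).
  apply: (@le_trans _ _ (4 * (K * (2 * (r ^+ 4) ^+ n)))).
    by rewrite !ler_wpM2l// (le_trans (lerD h1 h2))// -mulr2n mulr_natl.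
  rewrite (_ : 4 * _ = 8 * K * (r ^+ 4) ^+ n); last by ring.
  by apply: ler_wpM2r; [exact: ltW|rewrite ler_wpM2l// lerDl].
apply: (le_trans (tail _ _ _ gD E2D (mulr_gt0 V0 b0) (exprn_ge0 n (ltW r0)))).
rewrite lee_fin; apply: le_trans (hD n); rewrite le_eqVlt; apply/orP; left; apply/eqP.
by rewrite tail_exponent ?gt_eqF.
Qed.

(** The continuous version itself is taken as the solution: it differs from the Wiener integrals on
    null sets only, which preserves the equation and, the filtration containing those sets,
    adaptedness. *)
Lemma mild_solution_exists : exists u : R -> R -> Omega -> R,
  is_solution P H T W e u /\ continuous_paths T u.
Proof.
have [X hX] := stochastic_convolution.
have iX t x := (hX t x).1; have [D [r [D0 r01 hr]]] := mild_tail iX.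
have mX t x : measurable_fun setT (X t x) by exact: wi_measurable (iX t x).
have [v [vc mv vX]] := kolmogorov_continuity mX D0 r01 hr.
have I0c := I0_continuous e_admissible.
pose J (z : R * R) := I0 e (Num.max z.1 0) z.2.
have JE t x : 0 <= t <= T -> J (t, x) = I0 e t x.
  by move=> /andP[t0 _]; rewrite /J /= (max_idPl t0).
exists (fun t x w => I0 e t x + v t x w); split; first split.
- apply: (@eq_measurable_fun _ _ _ _ _ (fun z : R * R * Omega => J z.1 + v z.1.1 z.1.2 z.2)).
    by move=> [[t x] w]; rewrite inE => /= h; rewrite JE.
  apply: measurable_funTS; apply: measurable_funD => //.
  apply: (measurableT_comp (continuous2_measurable I0c)).
  exact: measurable_fst.
- move=> t x tT B mB.
  have ov : observable P H W t (v t x).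
    apply: (observable_ae (X := X t x)); first by have := (hX t x).2; rewrite clamp_id.
    by apply: filterS (vX t x) => w ->.
  rewrite (_ : _ @^-1` B = v t x @^-1` ((fun y => I0 e t x + y) @^-1` B)); last by [].
  apply: ov; rewrite -[X in measurable X]setTI.
  by apply: (measurable_funD (@measurable_cst _ _ _ _ _ _) (@measurable_id _ _ _)).
- move=> t x tT; exists (X t x); have := iX t x; rewrite clamp_id// => iXt; split.
  + exact: iXt.2.
  + exact: (wi_gaussian H01 W_noise iXt).
  + by apply: filterS (vX t x) => w ->.
move=> w; have cJv : continuous (fun z : R * R => J z + v z.1 z.2 w).
  by move=> z; apply: cvgD; [exact: I0c|exact: vc].
apply: (subspace_eq_continuous (f := fun z : R * R => J z + v z.1 z.2 w)).
  by move=> [t x]; rewrite inE => /= h; rewrite JE.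
exact: continuous_subspaceT.
Qed.

(** At each point both solutions are [I0] plus a Wiener integral of the same integrand, and such an
    integral is determined almost surely. *)
Lemma mild_solution_unique u v : is_solution P H T W e u -> is_solution P H T W e v ->
  modification P T u v.
Proof.
have [C gk] := good_G.
move=> [_ _ hu] [_ _ hv] t x tT; have ng := mild_nice gk x (andP tT).2.
have [X [iX _ uX]] := hu t x tT; have [Y [iY _ vY]] := hv t x tT.
have XY := wi_unique H01 W_noise (conj ng iX) (conj ng iY).
by apply: filterS3 uX vY XY => w -> -> ->.
Qed.

End MildSolution.

Theorem theorem2p1 (R : realType) (d : measure_display)
    (Omega : measurableType d) (P : probability Omega R)
    (P_complete : measure_is_complete P)
    (T H : R) (T_gt0 : 0 < T) (H_range : 0 < H < 1)
    (W : (R * R -> R) -> Omega -> R) (W_noise : is_noise P H W)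
    (e : spde R) (e_admissible : admissible e) :
  exists u : R -> R -> Omega -> R,
    [/\ is_solution P H T W e u,
        forall v, is_solution P H T W e v -> modification P T u v &
        exists2 v, modification P T u v & continuous_paths T v].
Proof.
have [u [su cu]] := mild_solution_exists T_gt0 H_range W_noise e_admissible.
exists u; split => //; first by move=> v; exact: (mild_solution_unique T_gt0 H_range W_noise su).
by exists u => // t x _; exact: aeW.
Qed.
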